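(* For all $m,s\in\mathbb N$, the $\kappa$-module $\mathrm{Hom}_{\mathcal{AB}}(\mathsf m,\mathsf s)$ has a $\kappa$-basis given by $\mathbb{ND}_{m,s}/\sim$, the set of equivalence classes of normally ordered dotted $(m,s)$-Brauer diagrams (each class being identified with the morphism represented by any of its elements).
   Context: $\kappa$ is a commutative ring with $1$ in which $2$ is invertible; $\mathbb N=\{0,1,2,\dots\}$. All monoidal categories are strict. The affine Brauer category $\mathcal{AB}$ is the $\kappa$-linear monoidal category generated by one object $\mathsf 1$ (objects $\mathsf m:=\mathsf 1^{\otimes m}$, $m\in\mathbb N$; $\mathsf 0$ is the unit object) and four morphisms $U:\mathsf 0\to\mathsf 2$, $A:\mathsf 2\to\mathsf 0$, $S:\mathsf 2\to\mathsf 2$, $X:\mathsf 1\to\mathsf 1$ subject to $S\circ S=1_{\mathsf 2}$; $(S\otimes 1_{\mathsf 1})\circ(1_{\mathsf 1}\otimes S)\circ(S\otimes 1_{\mathsf 1})=(1_{\mathsf 1}\otimes S)\circ(S\otimes 1_{\mathsf 1})\circ(1_{\mathsf 1}\otimes S)$; $(1_{\mathsf 1}\otimes A)\circ(U\otimes 1_{\mathsf 1})=1_{\mathsf 1}=(A\otimes 1_{\mathsf 1})\circ(1_{\mathsf 1}\otimes U)$; $U=S\circ U$; $A=A\circ S$; $(A\otimes 1_{\mathsf 1})\circ(1_{\mathsf 1}\otimes S)=(1_{\mathsf 1}\otimes A)\circ(S\otimes 1_{\mathsf 1})$; $(S\otimes 1_{\mathsf 1})\circ(1_{\mathsf 1}\otimes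 U)=(1_{\mathsf 1}\otimes S)\circ(U\otimes 1_{\mathsf 1})$; $(X\otimes 1_{\mathsf 1})\circ S-S\circ(1_{\mathsf 1}\otimes X)=U\circ A-1_{\mathsf 2}$; $(1_{\mathsf 1}\otimes A)\circ(1_{\mathsf 1}\otimes X\otimes 1_{\mathsf 1})\circ(U\otimes 1_{\mathsf 1})=-X=(A\otimes 1_{\mathsf 1})\circ(1_{\mathsf 1}\otimes X\otimes 1_{\mathsf 1})\circ(1_{\mathsf 1}\otimes U)$. Draw $U$ as a cup, $A$ as a cap, $S$ as a crossing, $X$ as a dot $\bullet$ on a vertical line; $g\circ h$ is $g$ stacked on top of $h$, and $\otimes$ is horizontal juxtaposition. An $(m,s)$-Brauer diagram is a string diagram obtained from $U,A,S,1_{\mathsf 1}$ by tensor products and compositions with $m$ bottom and $s$ top endpoints, numbered $1,\dots,m$ (bottom) and $m+1,\dots,m+s$ (top) from left to right. Its strands pair up the endpoints; closed loops are called bubbles. Strands joining two top endpoints are cups, strands joining two bottom endpoints are caps, the others are vertical strands. Two such diagrams are equivalent if they have the same number of bubbles and give the same partition of $\{1,\dots,m+s\}$ into pairs. A dotted $(m,s)$-Brauer diagram is an $(m,s)$-Brauer diagram with finitely many dots on each segment (segments are the connected components left after deleting crossings, endpoints and points with horizontal tangent); it represents a morphism $\mathsf m\to\mathsf s$ of $\mathcal{AB}$. It is normally ordered if: (1) all its bubbles are crossing-free and no other strand shields any of them from the leftmost edge of the picture; (2) each bubble has an even number of dots (possibly $0$), all placed on its leftmost boundary; (3) any dot on a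 vertical strand is at the boundary of the top row; (4) any dot on a cap (resp. cup) is on the leftmost boundary of the cap (resp. rightmost boundary of the cup). $\mathbb{ND}_{m,s}$ is the set of these. Two dotted diagrams are equivalent ($\sim$) if their underlying diagrams without dots are equivalent and corresponding strands carry the same number of dots. Equivalent normally ordered diagrams represent the same morphism. Explicitly, with $\Delta_k:=A\circ(X\otimes 1_{\mathsf 1})^k\circ U\in\mathrm{End}_{\mathcal{AB}}(\mathsf 0)$, $x_k:=1_{\mathsf{k-1}}\otimes X\otimes 1_{\mathsf{s-k}}$ and $y_j:=1_{\mathsf{j-1}}\otimes X\otimes 1_{\mathsf{m-j}}$, a normally ordered diagram represents $\Delta_0^{k_0}\Delta_2^{k_2}\Delta_4^{k_4}\cdots\, x_s^{\alpha_s}\circ\cdots\circ x_1^{\alpha_1}\circ\hat d\circ y_m^{\beta_m}\circ\cdots\circ y_1^{\beta_1}$ (with $\Delta g:=\Delta\otimes g$), where $\hat d$ is an $(m,s)$-Brauer diagram without bubbles and dots, only finitely many $k_{2i}\in\mathbb N$ are nonzero, $\alpha_k=0$ if the $k$th top endpoint is the left endpoint of a cup of $\hat d$, and $\beta_j=0$ if the $j$th bottom endpoint is the right endpoint of a cap or lies on a vertical strand of $\hat d$. *)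

(* Defs.v *)
From HB Require Import structures.
From mathcomp Require Import all_boot all_algebra.
From mathcomp Require Import generic_quotient boolp.

Set Implicit Arguments.
Unset Strict Implicit.
Unset Printing Implicit Defensive.

Import GRing.Theory.
Local Open Scope ring_scope.
Local Open Scope quotient_scope.

Section Basis.
Context (R : pzRingType) (V : lmodType R) (I : eqType).

Definition lin_indep (b : I -> V) : Prop :=
  forall (r : seq I) (c : I -> R), uniq r ->
    \sum_(i <- r) c i *: b i = 0 -> {in r, forall i, c i = 0}.

Definition spanning (b : I -> V) : Prop :=
  forall v : V, exists (r : seq I) (c : I -> R), v = \sum_(i <- r) c i *: b i.

Definition is_basis (b : I -> V) : Prop := lin_indep b /\ spanning b.

End Basis.

Definition cast2 (F : nat -> nat -> Type) m m' s s' (em : m = m') (es : s = s')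
  (x : F m s) : F m' s' := ecast s' (F m' s') es (ecast m' (F m' s) em x).

(* Dotted Brauer diagrams are presented as words in the four pictures and the  *)
(* identities; [dcomp g h] is g stacked on top of h, and [diag m s] has m      *)
(* bottom and s top endpoints.                                                 *)

Inductive diag : nat -> nat -> Type :=
| dId m : diag m m
| dU : diag 0 2
| dA : diag 2 0
| dS : diag 2 2
| dX : diag 1 1
| dcomp m n p of diag n p & diag m n : diag m p
| dtens m s m' s' of diag m s & diag m' s' : diag (m + m') (s + s').

Declare Scope diag_scope.
Delimit Scope diag_scope with D.
Bind Scope diag_scope with diag.
Notation "g ∘ h" := (dcomp g%D h%D)
  (at level 40, left associativity) : diag_scope.
Notation "g ⊗ h" := (dtens g%D h%D)
  (at level 38, left associativity) : diag_scope.

(* A word is cut into elementary arcs: one for each U, A and X, two for each   *)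
(* S, one for each strand of an identity. Stacking glues arcs end to end, so   *)
(* the strands of the picture (open strands and bubbles) are the connected     *)
(* components of the resulting graph.                                          *)

Fixpoint earc m s (d : diag m s) : finType :=
  match d with
  | dId m => 'I_m
  | dU => unit
  | dA => unit
  | dS => 'I_2
  | dX => unit
  | dcomp _ _ _ g h => (earc g + earc h)%type
  | dtens _ _ _ _ g h => (earc g + earc h)%type
  end.

Fixpoint bot m s (d : diag m s) : 'I_m -> earc d :=
  match d in diag m s return 'I_m -> earc d with
  | dId _ => id
  | dU => fun=> tt
  | dA => fun=> tt
  | dS => id
  | dX => fun=> tt
  | dcomp _ _ _ g h => fun i => inr (bot h i)
  | dtens _ _ _ _ g h => fun i =>
      match split i with inl j => inl (bot g j) | inr j => inr (bot h j) end
  end.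

Fixpoint top m s (d : diag m s) : 'I_s -> earc d :=
  match d in diag m s return 'I_s -> earc d with
  | dId _ => id
  | dU => fun=> tt
  | dA => fun=> tt
  | dS => @rev_ord 2
  | dX => fun=> tt
  | dcomp _ _ _ g h => fun i => inl (top g i)
  | dtens _ _ _ _ g h => fun i =>
      match split i with inl j => inl (top g j) | inr j => inr (top h j) end
  end.

Fixpoint glued m s (d : diag m s) : rel (earc d) :=
  match d in diag m s return rel (earc d) with
  | dcomp _ _ _ g h => fun x y =>
      match x, y with
      | inl a, inl b => glued a b
      | inr a, inr b => glued a b
      | inl a, inr b | inr b, inl a =>
          [exists i, (bot g i == a) && (top h i == b)]
      end
  | dtens _ _ _ _ g h => fun x y =>
      match x, y with
      | inl a, inl b => glued a b
      | inr a, inr b => glued a b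
      | _, _ => false
      end
  | _ => fun _ _ => false
  end.

Fixpoint is_dot m s (d : diag m s) : pred (earc d) :=
  match d in diag m s return pred (earc d) with
  | dX => predT
  | dcomp _ _ _ g h => fun x =>
      match x with inl a => is_dot a | inr b => is_dot b end
  | dtens _ _ _ _ g h => fun x =>
      match x with inl a => is_dot a | inr b => is_dot b end
  | _ => pred0
  end.

Section Strands.
Context m s (d : diag m s).

Definition endpt (p : 'I_m + 'I_s) : earc d :=
  match p with inl i => bot d i | inr j => top d j end.

Definition same_strand : rel (earc d) := connect (@glued _ _ d).

Definition dots_on (x : earc d) : nat :=
  #|[pred y | same_strand x y && is_dot y]|.

(* One arc is selected on every bubble, i.e. on every strand without endpoints. *)
Definition bubble_reps : {pred earc d} :=
  [pred x in roots (@glued _ _ d) | [forall p, ~~ same_strand (endpt p) x]].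

Definition bubble_dots : seq nat := [seq dots_on x | x <- enum bubble_reps].

Definition dot_free : bool := [forall x : earc d, ~~ is_dot x].

Definition bubble_free : bool := #|bubble_reps| == 0.

Definition left_of_cup (k : 'I_s) : bool :=
  [exists k' : 'I_s, (k < k')%N && same_strand (top d k) (top d k')].

Definition right_of_cap (j : 'I_m) : bool :=
  [exists j' : 'I_m, (j' < j)%N && same_strand (bot d j') (bot d j)].

Definition on_vertical (j : 'I_m) : bool :=
  [exists k : 'I_s, same_strand (bot d j) (top d k)].

End Strands.

(* Same partition of the endpoints, same number of dots on the strand through  *)
(* each endpoint, and a dot-preserving bijection between the bubbles.          *)
Definition dequiv m s (d d' : diag m s) : bool :=
  [&& [forall p, forall q, same_strand (endpt d p) (endpt d q)
                        == same_strand (endpt d' p) (endpt d' q)],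
      [forall p, dots_on (endpt d p) == dots_on (endpt d' p)]
    & perm_eq (bubble_dots d) (bubble_dots d')].

Definition dpow m (f : diag m m) (n : nat) : diag m m := iter n (dcomp f) (dId m).

Lemma dot_at_size m (k : 'I_m) : (k + 1 + (m - k.+1))%N = m.
Proof. by rewrite addn1 subnKC. Qed.

(* 1^(k) ⊗ X ⊗ 1^(m-k-1); positions are counted from 0. *)
Definition dot_at m (k : 'I_m) : diag m m :=
  cast2 (dot_at_size k) (dot_at_size k) (dId k ⊗ dX ⊗ dId (m - k.+1))%D.

(* x_m^(a_m) ∘ ... ∘ x_1^(a_1) *)
Definition dot_row m (a : 'I_m -> nat) : diag m m :=
  foldl (fun f k => dpow (dot_at k) (a k) ∘ f)%D (dId m) (enum 'I_m).

Definition Delta (k : nat) : diag 0 0 := (dA ∘ dpow (dX ⊗ dId 1) k ∘ dU)%D.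

(* Delta_0^(k_0) Delta_2^(k_2) Delta_4^(k_4) ..., where k_(2i) = nth 0 k i;     *)
(* exponents beyond the end of the sequence are zero.                          *)
Definition bubble_row (k : seq nat) : diag 0 0 :=
  foldr (fun i f => dpow (Delta i.*2) (nth 0%N k i) ∘ f)%D (dId 0)
        (iota 0 (size k)).

(* The geometric conditions on a normally ordered diagram are encoded by the   *)
(* shape of its word: crossing-free bubbles on the far left, carrying evenly   *)
(* many dots on their left boundary, then all other dots in the top row (on    *)
(* vertical strands and right ends of cups) or in the bottom row (on left ends *)
(* of caps). The undotted part d is an arbitrary word, not a chosen one for    *)
(* its matching.                                                               *)
Variant normally_ordered m s : diag m s -> Prop :=
  NormallyOrdered (k : seq nat) (a : 'I_s -> nat) (d : diag m s)
    (b : 'I_m -> nat) of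
    dot_free d & bubble_free d &
    (forall i, left_of_cup d i -> a i = 0%N) &
    (forall j, right_of_cap d j || on_vertical d j -> b j = 0%N) :
  normally_ordered (bubble_row k ⊗ (dot_row a ∘ d ∘ dot_row b))%D.

HB.instance Definition _ m s := gen_eqMixin (diag m s).
HB.instance Definition _ m s := gen_choiceMixin (diag m s).

Definition ND m s : choiceType := {d : diag m s | `[< normally_ordered d >]}.

Lemma dequiv_refl m s : reflexive (@dequiv m s).
Proof.
move=> d; apply/and3P; split=> //.
- by apply/forallP=> p; apply/forallP.
- by apply/forallP.
Qed.

Lemma dequiv_sym m s : symmetric (@dequiv m s).
Proof.
move=> d d'; rewrite /dequiv perm_sym; congr [&& _, _ & _].
- by apply: eq_forallb => p; apply: eq_forallb => q; rewrite eq_sym.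
- by apply: eq_forallb => p; rewrite eq_sym.
Qed.

Lemma dequiv_trans m s : transitive (@dequiv m s).
Proof.
move=> d2 d1 d3 /and3P[/forallP h1 /forallP h2 h3].
move=> /and3P[/forallP h4 /forallP h5 h6]; apply/and3P; split.
- apply/forallP=> p; apply/forallP=> q.
  by rewrite (eqP (forallP (h1 p) q)) (eqP (forallP (h4 p) q)).
- by apply/forallP=> p; rewrite (eqP (h2 p)) (eqP (h5 p)).
- exact: perm_trans h3 h6.
Qed.

Section NDclass.
Context (m s : nat).

Definition nd_equiv : rel (ND m s) := fun d d' => dequiv (val d) (val d').

Lemma nd_equiv_refl : reflexive nd_equiv.
Proof. by move=> d; apply: dequiv_refl. Qed.

Lemma nd_equiv_sym : symmetric nd_equiv.
Proof. by move=> d d'; apply: dequiv_sym. Qed.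

Lemma nd_equiv_trans : transitive nd_equiv.
Proof. by move=> d2 d1 d3; apply: dequiv_trans. Qed.

Canonical nd_equiv_rel :=
  EquivRel nd_equiv nd_equiv_refl nd_equiv_sym nd_equiv_trans.

Definition NDclass := {eq_quot nd_equiv}.

End NDclass.

(* Morphisms of the affine Brauer category are formal K-linear terms modulo    *)
(* the smallest congruence containing the axioms of K-linear strict monoidal   *)
(* categories (objects are natural numbers, tensored by addition) and the      *)
(* defining relations. As associativity and right unitality of + are not       *)
(* definitional, strictness is expressed with [cast2].                         *)

Section AffineBrauer.
Context (K : comPzRingType).

Inductive term : nat -> nat -> Type :=
| tId m : term m m
| tU : term 0 2
| tA : term 2 0
| tS : term 2 2
| tX : term 1 1
| tcomp m n p of term n p & term m n : term m p
| ttens m s m' s' of term m s & term m' s' : term (m + m') (s + s')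
| t0 m s : term m s
| tadd m s of term m s & term m s : term m s
| tscale m s of K & term m s : term m s.

Local Notation "g ∘ h" := (tcomp g h) (at level 40, left associativity).
Local Notation "g ⊗ h" := (ttens g h) (at level 38, left associativity).
Local Notation "f [+] g" := (tadd f g) (at level 50, left associativity).
Local Notation "c [*] f" := (tscale c f) (at level 37, right associativity).
Local Notation "f [-] g" := (f [+] (-1) [*] g) (at level 50, left associativity).

Inductive eqv : forall m s, term m s -> term m s -> Prop :=
| eqv_refl m s (f : term m s) : eqv f f
| eqv_sym m s (f g : term m s) : eqv f g -> eqv g f
| eqv_trans m s (f g h : term m s) : eqv f g -> eqv g h -> eqv f h

| eqv_comp m n p (f f' : term n p) (g g' : term m n) :
    eqv f f' -> eqv g g' -> eqv (f ∘ g) (f' ∘ g')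
| eqv_tens m s m' s' (f f' : term m s) (g g' : term m' s') :
    eqv f f' -> eqv g g' -> eqv (f ⊗ g) (f' ⊗ g')
| eqv_add m s (f f' g g' : term m s) :
    eqv f f' -> eqv g g' -> eqv (f [+] g) (f' [+] g')
| eqv_scale m s (c : K) (f f' : term m s) :
    eqv f f' -> eqv (c [*] f) (c [*] f')

| eqv_addA m s (f g h : term m s) : eqv (f [+] (g [+] h)) (f [+] g [+] h)
| eqv_addC m s (f g : term m s) : eqv (f [+] g) (g [+] f)
| eqv_add0 m s (f : term m s) : eqv (t0 m s [+] f) f
| eqv_addN m s (f : term m s) : eqv (f [-] f) (t0 m s)
| eqv_scaleA m s (c c' : K) (f : term m s) :
    eqv (c [*] c' [*] f) ((c * c') [*] f)
| eqv_scale1 m s (f : term m s) : eqv (1 [*] f) f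
| eqv_scaleDr m s (c : K) (f g : term m s) :
    eqv (c [*] (f [+] g)) (c [*] f [+] c [*] g)
| eqv_scaleDl m s (c c' : K) (f : term m s) :
    eqv ((c + c') [*] f) (c [*] f [+] c' [*] f)

| eqv_compDl m n p (f f' : term n p) (g : term m n) :
    eqv ((f [+] f') ∘ g) (f ∘ g [+] f' ∘ g)
| eqv_compDr m n p (f : term n p) (g g' : term m n) :
    eqv (f ∘ (g [+] g')) (f ∘ g [+] f ∘ g')
| eqv_compZl m n p (c : K) (f : term n p) (g : term m n) :
    eqv ((c [*] f) ∘ g) (c [*] (f ∘ g))
| eqv_compZr m n p (c : K) (f : term n p) (g : term m n) :
    eqv (f ∘ (c [*] g)) (c [*] (f ∘ g))
| eqv_tensDl m s m' s' (f f' : term m s) (g : term m' s') :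
    eqv ((f [+] f') ⊗ g) (f ⊗ g [+] f' ⊗ g)
| eqv_tensDr m s m' s' (f : term m s) (g g' : term m' s') :
    eqv (f ⊗ (g [+] g')) (f ⊗ g [+] f ⊗ g')
| eqv_tensZl m s m' s' (c : K) (f : term m s) (g : term m' s') :
    eqv ((c [*] f) ⊗ g) (c [*] (f ⊗ g))
| eqv_tensZr m s m' s' (c : K) (f : term m s) (g : term m' s') :
    eqv (f ⊗ (c [*] g)) (c [*] (f ⊗ g))

| eqv_compA m n p q (f : term p q) (g : term n p) (h : term m n) :
    eqv (f ∘ (g ∘ h)) (f ∘ g ∘ h)
| eqv_idl m s (f : term m s) : eqv (tId s ∘ f) f
| eqv_idr m s (f : term m s) : eqv (f ∘ tId m) f

| eqv_tens_id m n : eqv (tId m ⊗ tId n) (tId (m + n))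
| eqv_interchange m n p m' n' p'
    (f : term n p) (g : term m n) (f' : term n' p') (g' : term m' n') :
    eqv ((f ∘ g) ⊗ (f' ∘ g')) ((f ⊗ f') ∘ (g ⊗ g'))
| eqv_tensA m1 s1 m2 s2 m3 s3
    (f : term m1 s1) (g : term m2 s2) (h : term m3 s3) :
    eqv (cast2 (addnA m1 m2 m3) (addnA s1 s2 s3) (f ⊗ (g ⊗ h))) (f ⊗ g ⊗ h)
| eqv_unitl m s (f : term m s) : eqv (tId 0 ⊗ f) f
| eqv_unitr m s (f : term m s) :
    eqv (cast2 (addn0 m) (addn0 s) (f ⊗ tId 0)) f

| rel_SS : eqv (tS ∘ tS) (tId 2)
| rel_braid :
    eqv ((tS ⊗ tId 1) ∘ (tId 1 ⊗ tS) ∘ (tS ⊗ tId 1))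
        ((tId 1 ⊗ tS) ∘ (tS ⊗ tId 1) ∘ (tId 1 ⊗ tS))
| rel_zigzag1 : @eqv 1 1 ((tId 1 ⊗ tA) ∘ (tU ⊗ tId 1)) (tId 1)
| rel_zigzag2 : @eqv 1 1 ((tA ⊗ tId 1) ∘ (tId 1 ⊗ tU)) (tId 1)
| rel_SU : eqv tU (tS ∘ tU)
| rel_AS : eqv tA (tA ∘ tS)
| rel_AS_slide :
    @eqv 3 1 ((tA ⊗ tId 1) ∘ (tId 1 ⊗ tS)) ((tId 1 ⊗ tA) ∘ (tS ⊗ tId 1))
| rel_SU_slide :
    @eqv 1 3 ((tS ⊗ tId 1) ∘ (tId 1 ⊗ tU)) ((tId 1 ⊗ tS) ∘ (tU ⊗ tId 1))
| rel_XS :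
    eqv ((tX ⊗ tId 1) ∘ tS [-] tS ∘ (tId 1 ⊗ tX)) (tU ∘ tA [-] tId 2)
| rel_X_rotate1 :
    @eqv 1 1 ((tId 1 ⊗ tA) ∘ (tId 1 ⊗ tX ⊗ tId 1) ∘ (tU ⊗ tId 1)) ((-1) [*] tX)
| rel_X_rotate2 :
    @eqv 1 1 ((tA ⊗ tId 1) ∘ (tId 1 ⊗ tX ⊗ tId 1) ∘ (tId 1 ⊗ tU)) ((-1) [*] tX).

HB.instance Definition _ m s := gen_eqMixin (term m s).
HB.instance Definition _ m s := gen_choiceMixin (term m s).

Section Hom.
Context (m s : nat).

Definition eqvb : rel (term m s) := fun f g => `[< eqv f g >].

Lemma eqvb_refl : reflexive eqvb.
Proof. by move=> f; apply/asboolP/eqv_refl. Qed.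

Lemma eqvb_sym : symmetric eqvb.
Proof.
by move=> f g; apply/idP/idP=> /asboolP h; apply/asboolP; apply: eqv_sym.
Qed.

Lemma eqvb_trans : transitive eqvb.
Proof.
by move=> g f h /asboolP fg /asboolP gh; apply/asboolP; apply: eqv_trans fg gh.
Qed.

Canonical eqv_rel := EquivRel eqvb eqvb_refl eqvb_sym eqvb_trans.

Definition ABHom := {eq_quot eqvb}.
HB.instance Definition _ := Choice.on ABHom.
HB.instance Definition _ := Quotient.on ABHom.

Lemma Hom_eqP (f g : term m s) : eqv f g <-> \pi_ABHom f = \pi_ABHom g.
Proof. by split=> [h|/eqmodP/asboolP //]; apply/eqmodP/asboolP. Qed.

Definition hadd (x y : ABHom) : ABHom := \pi_ABHom (repr x [+] repr y).
Definition hscale (c : K) (x : ABHom) : ABHom := \pi_ABHom (c [*] repr x).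
Definition hopp (x : ABHom) : ABHom := hscale (-1) x.
Definition hzero : ABHom := \pi_ABHom (t0 m s).

Lemma repr_eqv (f : term m s) : eqv (repr (\pi_ABHom f)) f.
Proof. by apply/Hom_eqP; rewrite reprK. Qed.

Lemma haddE f g : hadd (\pi f) (\pi g) = \pi_ABHom (f [+] g).
Proof. by apply/Hom_eqP/eqv_add; apply: repr_eqv. Qed.

Lemma hscaleE c f : hscale c (\pi f) = \pi_ABHom (c [*] f).
Proof. by apply/Hom_eqP/eqv_scale; apply: repr_eqv. Qed.

Lemma haddA : associative hadd.
Proof.
elim/quotW=> f; elim/quotW=> g; elim/quotW=> h.
by rewrite !haddE; apply/Hom_eqP/eqv_addA.
Qed.

Lemma haddC : commutative hadd.
Proof.
elim/quotW=> f; elim/quotW=> g.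
by rewrite !haddE; apply/Hom_eqP/eqv_addC.
Qed.

Lemma hadd0 : left_id hzero hadd.
Proof. by elim/quotW=> f; rewrite haddE; apply/Hom_eqP/eqv_add0. Qed.

Lemma haddN : left_inverse hzero hopp hadd.
Proof.
elim/quotW=> f; rewrite haddC /hopp hscaleE haddE.
by apply/Hom_eqP/eqv_addN.
Qed.

HB.instance Definition _ := GRing.isZmodule.Build ABHom haddA haddC hadd0 haddN.

Lemma hscaleA c c' (x : ABHom) : hscale c (hscale c' x) = hscale (c * c') x.
Proof. by elim/quotW: x => f; rewrite !hscaleE; apply/Hom_eqP/eqv_scaleA. Qed.

Lemma hscale1 : left_id 1 hscale.
Proof. by elim/quotW=> f; rewrite hscaleE; apply/Hom_eqP/eqv_scale1. Qed.

Lemma hscaleDr : right_distributive hscale +%R.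
Proof.
move=> c; elim/quotW=> f; elim/quotW=> g; rewrite /GRing.add /= haddE !hscaleE.
by rewrite haddE; apply/Hom_eqP/eqv_scaleDr.
Qed.

Lemma hscaleDl (x : ABHom) : {morph hscale^~ x : c c' / c + c'}.
Proof.
move=> c c'; elim/quotW: x => f; rewrite /= {2}/GRing.add /= !hscaleE haddE.
exact/Hom_eqP/eqv_scaleDl.
Qed.

HB.instance Definition _ :=
  GRing.Zmodule_isLmodule.Build K ABHom hscaleA hscale1 hscaleDr hscaleDl.

End Hom.

Fixpoint term_of m s (d : diag m s) : term m s :=
  match d with
  | dId m => tId m
  | dU => tU
  | dA => tA
  | dS => tS
  | dX => tX
  | dcomp _ _ _ g h => tcomp (term_of g) (term_of h)
  | dtens _ _ _ _ g h => ttens (term_of g) (term_of h)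
  end.

Definition hom_of m s (d : diag m s) : ABHom m s := \pi_(ABHom m s) (term_of d).

End AffineBrauer.

(* Main.v *)
From HB Require Import structures.
Require Import Defs.
From mathcomp Require Import all_boot all_algebra generic_quotient.
From mathcomp Require Import all_order boolp.
From mathcomp Require Import zify ring lra.

Set Implicit Arguments.
Unset Strict Implicit.
Unset Printing Implicit Defensive.

Import Order.TTheory GRing.Theory Num.Theory.
Local Open Scope ring_scope.
Local Open Scope quotient_scope.

(** * Morphisms with their domain and codomain *)

Fact hom_key : unit. Proof. exact: tt. Qed.

Section Category.
Context (K : comPzRingType).
Implicit Types m n p s : nat.

Definition hcomp m n p (x : ABHom K n p) (y : ABHom K m n) : ABHom K m p :=
  locked_with hom_key (\pi_(ABHom K m p) (tcomp (repr x) (repr y))).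

Definition htens m s m' s' (x : ABHom K m s) (y : ABHom K m' s') :
    ABHom K (m + m') (s + s') :=
  locked_with hom_key (\pi_(ABHom K (m + m') (s + s')) (ttens (repr x) (repr y))).

Lemma hcompE m n p (f : term K n p) (g : term K m n) :
  hcomp (\pi_(ABHom K n p) f) (\pi_(ABHom K m n) g)
    = \pi_(ABHom K m p) (tcomp f g).
Proof. by rewrite /hcomp unlock; apply/Hom_eqP/eqv_comp; apply: repr_eqv. Qed.

Lemma htensE m s m' s' (f : term K m s) (g : term K m' s') :
  htens (\pi_(ABHom K m s) f) (\pi_(ABHom K m' s') g)
    = \pi_(ABHom K (m + m') (s + s')) (ttens f g).
Proof. by rewrite /htens unlock; apply/Hom_eqP/eqv_tens; apply: repr_eqv. Qed.

Lemma hpi_add m s (f g : term K m s) :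
  \pi_(ABHom K m s) (tadd f g) = \pi_(ABHom K m s) f + \pi_(ABHom K m s) g.
Proof. by rewrite [RHS]haddE. Qed.

Lemma hpi_scale m s c (f : term K m s) :
  \pi_(ABHom K m s) (tscale c f) = c *: \pi_(ABHom K m s) f.
Proof. by rewrite [RHS]hscaleE. Qed.

Lemma hpi_zero m s : \pi_(ABHom K m s) (t0 K m s) = 0.
Proof. by []. Qed.

Lemma hcompDZl m n p c (x x' : ABHom K n p) (y : ABHom K m n) :
  hcomp (c *: x + x') y = c *: hcomp x y + hcomp x' y.
Proof.
elim/quotW: x => f; elim/quotW: x' => f'; elim/quotW: y => g.
rewrite -hpi_scale -hpi_add !hcompE -hpi_scale -hpi_add; apply/Hom_eqP.
by apply: eqv_trans (eqv_compDl _ _ _) _; apply: eqv_add (eqv_compZl _ _ _) _;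
  apply: eqv_refl.
Qed.

Lemma hcompDZr m n p c (x : ABHom K n p) (y y' : ABHom K m n) :
  hcomp x (c *: y + y') = c *: hcomp x y + hcomp x y'.
Proof.
elim/quotW: x => f; elim/quotW: y => g; elim/quotW: y' => g'.
rewrite -hpi_scale -hpi_add !hcompE -hpi_scale -hpi_add; apply/Hom_eqP.
by apply: eqv_trans (eqv_compDr _ _ _) _; apply: eqv_add (eqv_compZr _ _ _) _;
  apply: eqv_refl.
Qed.

Lemma htensDZl m s m' s' c (x x' : ABHom K m s) (y : ABHom K m' s') :
  htens (c *: x + x') y = c *: htens x y + htens x' y.
Proof.
elim/quotW: x => f; elim/quotW: x' => f'; elim/quotW: y => g.
rewrite -hpi_scale -hpi_add !htensE -hpi_scale -hpi_add; apply/Hom_eqP.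
by apply: eqv_trans (eqv_tensDl _ _ _) _; apply: eqv_add (eqv_tensZl _ _ _) _;
  apply: eqv_refl.
Qed.

Lemma htensDZr m s m' s' c (x : ABHom K m s) (y y' : ABHom K m' s') :
  htens x (c *: y + y') = c *: htens x y + htens x y'.
Proof.
elim/quotW: x => f; elim/quotW: y => g; elim/quotW: y' => g'.
rewrite -hpi_scale -hpi_add !htensE -hpi_scale -hpi_add; apply/Hom_eqP.
by apply: eqv_trans (eqv_tensDr _ _ _) _; apply: eqv_add (eqv_tensZr _ _ _) _;
  apply: eqv_refl.
Qed.

Lemma hcomp0l m n p (y : ABHom K m n) : hcomp (0 : ABHom K n p) y = 0.
Proof.
have := hcompDZl (-1) (0 : ABHom K n p) 0 y.
by rewrite scaler0 addr0 scaleN1r addNr.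
Qed.

Lemma hcomp0r m n p (x : ABHom K n p) : hcomp x (0 : ABHom K m n) = 0.
Proof.
have := hcompDZr (-1) x (0 : ABHom K m n) 0.
by rewrite scaler0 addr0 scaleN1r addNr.
Qed.

Lemma htens0l m s m' s' (y : ABHom K m' s') : htens (0 : ABHom K m s) y = 0.
Proof.
have := htensDZl (-1) (0 : ABHom K m s) 0 y.
by rewrite scaler0 addr0 scaleN1r addNr.
Qed.

Lemma htens0r m s m' s' (x : ABHom K m s) : htens x (0 : ABHom K m' s') = 0.
Proof.
have := htensDZr (-1) x (0 : ABHom K m' s') 0.
by rewrite scaler0 addr0 scaleN1r addNr.
Qed.

(** Packing the endpoints with the morphism turns the axioms of a strict
    monoidal category, which hold only up to casts between Hom-modules, into
    plain equalities. *)
Record mor := Mor { mdom : nat; mcod : nat; mval : ABHom K mdom mcod }.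

Definition mtens (f g : mor) : mor := Mor (htens (mval f) (mval g)).

(* The value on pairs that are not composable is junk. *)
Definition mcomp (f g : mor) : mor :=
  match mcod g =P mdom f with
  | ReflectT e => Mor (hcomp (mval f) (ecast i (ABHom K (mdom g) i) e (mval g)))
  | ReflectF _ => f
  end.

Definition mid n : mor := Mor (\pi_(ABHom K n n) (tId K n)).

Lemma Mor_cast m s m' s' (em : m = m') (es : s = s') (x : ABHom K m s) :
  Mor (cast2 em es x) = Mor x.
Proof. by case: m' / em; case: s' / es. Qed.

Lemma Mor_pi_cast m s m' s' (em : m = m') (es : s = s') (x : term K m s) :
  Mor (\pi_(ABHom K m' s') (cast2 em es x)) = Mor (\pi_(ABHom K m s) x).
Proof. by case: m' / em; case: s' / es. Qed.

Lemma mcompE m n p (x : ABHom K n p) (y : ABHom K m n) :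
  mcomp (Mor x) (Mor y) = Mor (hcomp x y).
Proof.
by rewrite /mcomp /=; case: eqP => // e; rewrite (eq_irrelevance e erefl).
Qed.

Lemma mtensE m s m' s' (x : ABHom K m s) (y : ABHom K m' s') :
  mtens (Mor x) (Mor y) = Mor (htens x y).
Proof. by []. Qed.

Lemma Mor_inj m s (x y : ABHom K m s) : Mor x = Mor y -> x = y.
Proof.
move=> e.
pose F (f : mor) : ABHom K m s :=
  match mdom f =P m, mcod f =P s with
  | ReflectT em, ReflectT es => cast2 em es (mval f)
  | _, _ => 0 end.
have FE z : F (Mor z) = z.
  rewrite /F /=; case: eqP => // em; case: eqP => // es.
  by rewrite (eq_irrelevance em erefl) (eq_irrelevance es erefl).
by rewrite -[x]FE e FE.
Qed.

Lemma mcomp_dom f g : mcod g = mdom f -> mdom (mcomp f g) = mdom g.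
Proof.
by case: f => n p x; case: g => m n' y /= e; subst n'; rewrite mcompE.
Qed.

Lemma mcomp_cod f g : mcod g = mdom f -> mcod (mcomp f g) = mcod f.
Proof.
by case: f => n p x; case: g => m n' y /= e; subst n'; rewrite mcompE.
Qed.

Lemma mcompA f g h : mcod g = mdom f -> mcod h = mdom g ->
  mcomp f (mcomp g h) = mcomp (mcomp f g) h.
Proof.
case: f => p q x; case: g => n p' y; case: h => m n' z /= e1 e2; subst.
rewrite !mcompE; congr Mor.
elim/quotW: x => f; elim/quotW: y => g; elim/quotW: z => h.
by rewrite !hcompE; apply/Hom_eqP/eqv_compA.
Qed.

Lemma mcomp1l n f : mcod f = n -> mcomp (mid n) f = f.
Proof.
case: f => m s x /= e; subst; rewrite mcompE; congr Mor.
by elim/quotW: x => f; rewrite !hcompE; apply/Hom_eqP/eqv_idl.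
Qed.

Lemma mcomp1r n f : mdom f = n -> mcomp f (mid n) = f.
Proof.
case: f => m s x /= e; subst; rewrite mcompE; congr Mor.
by elim/quotW: x => f; rewrite !hcompE; apply/Hom_eqP/eqv_idr.
Qed.

Lemma mtens_id m n : mtens (mid m) (mid n) = mid (m + n).
Proof.
by rewrite mtensE htensE; congr Mor; apply/Hom_eqP/eqv_tens_id.
Qed.

Lemma mtensA f g h : mtens f (mtens g h) = mtens (mtens f g) h.
Proof.
case: f => m s x; case: g => m' s' y; case: h => m'' s'' z.
rewrite !mtensE.
elim/quotW: x => f; elim/quotW: y => g; elim/quotW: z => h.
rewrite !htensE -(Mor_pi_cast (addnA m m' m'') (addnA s s' s'')); congr Mor.
exact/Hom_eqP/eqv_tensA.
Qed.

Lemma mtens0l f : mtens (mid 0) f = f.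
Proof.
case: f => m s x; elim/quotW: x => f; rewrite mtensE htensE; congr Mor.
exact/Hom_eqP/eqv_unitl.
Qed.

Lemma mtens0r f : mtens f (mid 0) = f.
Proof.
case: f => m s x; elim/quotW: x => f; rewrite mtensE htensE.
by rewrite -(Mor_pi_cast (addn0 m) (addn0 s)); congr Mor;
  apply/Hom_eqP/eqv_unitr.
Qed.

Lemma minterchange f g f' g' : mcod g = mdom f -> mcod g' = mdom f' ->
  mtens (mcomp f g) (mcomp f' g') = mcomp (mtens f f') (mtens g g').
Proof.
case: f => n p x; case: g => m n1 y; case: f' => n' p' x'; case: g' => m' n1' y'.
move=> /= e1 e2; subst; rewrite !mcompE /mtens /=; congr Mor.
elim/quotW: x => f; elim/quotW: y => g; elim/quotW: x' => f'; elim/quotW: y' => g'.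
by rewrite !(hcompE, htensE); apply/Hom_eqP/eqv_interchange.
Qed.

End Category.

(** * Words of layers *)

Variant gen := gU | gA | gS | gX.

Definition gdom g := match g with gU => 0 | gA => 2 | gS => 2 | gX => 1 end%N.
Definition gcod g := match g with gU => 2 | gA => 0 | gS => 2 | gX => 1 end%N.
Definition isX g := if g is gX then true else false.

(** A word is read from the bottom of the picture upwards; the layer (g, p)
    is the generator g with p identity strands on its left. The number of
    strands on its right is not recorded, so that positions remain plain
    numbers. *)
Definition layer := (gen * nat)%type.

Definition nxt (M : nat) (x : layer) : nat := (M - gdom x.1 + gcod x.1)%N.
Definition fits (M : nat) (x : layer) : bool := (x.2 + gdom x.1 <= M)%N.
Definition nxts (M : nat) (l : seq layer) : nat := foldl nxt M l.

Fixpoint valid (M : nat) (l : seq layer) : bool :=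
  if l is x :: l' then fits M x && valid (nxt M x) l' else true.

Definition shift (k : nat) (l : seq layer) : seq layer :=
  [seq (x.1, k + x.2)%N | x <- l].

Fixpoint layers m s (d : diag m s) : seq layer :=
  match d with
  | dId _ => [::]
  | dU => [:: (gU, 0%N)]
  | dA => [:: (gA, 0%N)]
  | dS => [:: (gS, 0%N)]
  | dX => [:: (gX, 0%N)]
  | dcomp _ _ _ g h => layers h ++ layers g
  | dtens m _ _ _ g h => shift m (layers h) ++ layers g
  end.

Lemma nxts_cat M a b : nxts M (a ++ b) = nxts (nxts M a) b.
Proof. exact: foldl_cat. Qed.

Lemma valid_cat M a b : valid M (a ++ b) = valid M a && valid (nxts M a) b.
Proof. by elim: a M => //= x a IH M; rewrite IH andbA. Qed.

Lemma shift_cat k a b : shift k (a ++ b) = shift k a ++ shift k b.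
Proof. exact: map_cat. Qed.

Lemma shift0 l : shift 0 l = l.
Proof. by rewrite /shift; elim: l => //= -[g p] l ->. Qed.

Lemma shiftD i j l : shift i (shift j l) = shift (i + j) l.
Proof. by rewrite /shift -map_comp; apply: eq_map => x /=; rewrite addnA. Qed.

Lemma valid_shift k M l : valid M l -> valid (k + M) (shift k l).
Proof.
elim: l M => //= -[g p] l IH M /andP[]; rewrite /fits /nxt /= => h v.
rewrite [X in valid X _](_ : _ = k + (M - gdom g + gcod g))%N; last lia.
by rewrite IH // andbT; lia.
Qed.

Lemma nxts_shift k M l : valid M l -> nxts (k + M) (shift k l) = (k + nxts M l)%N.
Proof.
elim: l M => //= -[g p] l IH M /andP[]; rewrite /fits /nxt /= => h v.
rewrite [X in nxts X _](_ : _ = k + (M - gdom g + gcod g))%N; last lia.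
exact: IH.
Qed.

Lemma valid_wide k M l : valid M l -> valid (M + k) l.
Proof.
elim: l M => //= -[g p] l IH M /andP[]; rewrite /fits /nxt /= => h v.
rewrite [X in valid X _](_ : _ = M - gdom g + gcod g + k)%N; last lia.
by rewrite IH // andbT; lia.
Qed.

Lemma nxts_wide k M l : valid M l -> nxts (M + k) l = (nxts M l + k)%N.
Proof.
elim: l M => //= -[g p] l IH M /andP[]; rewrite /fits /nxt /= => h v.
rewrite [X in nxts X _](_ : _ = M - gdom g + gcod g + k)%N; last lia.
exact: IH.
Qed.

Lemma layers_valid m s (d : diag m s) : valid m (layers d).
Proof.
suff: valid m (layers d) && (nxts m (layers d) == s) by case/andP.
elim: d => //= [m1 n p g /andP[vg /eqP ng] h /andP[vh /eqP nh]
  |m1 s1 m2 s2 g /andP[vg /eqP ng] h /andP[vh /eqP nh]].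
- by rewrite valid_cat nxts_cat vh nh vg ng eqxx.
- rewrite valid_cat nxts_cat valid_shift // nxts_shift // nh.
  by rewrite valid_wide // nxts_wide // ng eqxx.
Qed.

Lemma nxts_layers m s (d : diag m s) : nxts m (layers d) = s.
Proof.
elim: d => //= [m1 n p g ng h nh|m1 s1 m2 s2 g ng h nh].
- by rewrite nxts_cat nh ng.
- by rewrite nxts_cat nxts_shift ?layers_valid // nh nxts_wide ?layers_valid // ng.
Qed.

Lemma layers_cast m s m' s' (em : m = m') (es : s = s') (d : diag m s) :
  layers (cast2 em es d) = layers d.
Proof. by case: m' / em; case: s' / es. Qed.

Lemma word_exists M l : valid M l -> exists d : diag M (nxts M l), layers d = l.
Proof.
elim: l M => [|[g p] l IH] M /=; first by exists (dId M).
case/andP=> h /IH[d dE]; rewrite /fits /= in h.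
have [G GE] : exists G : diag (gdom g) (gcod g), layers G = [:: (g, 0%N)].
  by case: g {h d dE} => /=; [exists dU | exists dA | exists dS | exists dX].
pose q := (M - p - gdom g)%N.
have em : (p + (gdom g + q) = M)%N by rewrite /q; lia.
have es : (p + (gcod g + q) = nxt M (g, p))%N by rewrite /nxt /q /=; lia.
exists (dcomp d (cast2 em es (dtens (dId p) (dtens G (dId q))))).
by rewrite /= layers_cast /= GE dE /= addn0.
Qed.

Section Run.
Context (K : comPzRingType).
Local Notation mor := (mor K).
Local Notation mid := (@mid K).

Definition genmor (g : gen) : mor :=
  match g with
  | gU => Mor (\pi_(ABHom K 0 2) (tU K))
  | gA => Mor (\pi_(ABHom K 2 0) (tA K))
  | gS => Mor (\pi_(ABHom K 2 2) (tS K))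
  | gX => Mor (\pi_(ABHom K 1 1) (tX K))
  end.

Definition lay (M : nat) (x : layer) : mor :=
  mtens (mid x.2) (mtens (genmor x.1) (mid (M - x.2 - gdom x.1))).

Fixpoint run (M : nat) (l : seq layer) : mor :=
  if l is x :: l' then mcomp (run (nxt M x) l') (lay M x) else mid M.

Lemma genmor_dom g : mdom (genmor g) = gdom g. Proof. by case: g. Qed.
Lemma genmor_cod g : mcod (genmor g) = gcod g. Proof. by case: g. Qed.

Lemma lay_dom M x : fits M x -> mdom (lay M x) = M.
Proof. by rewrite /fits /= genmor_dom; lia. Qed.

Lemma lay_cod M x : fits M x -> mcod (lay M x) = nxt M x.
Proof. by rewrite /fits /nxt /= genmor_cod; lia. Qed.

Lemma run_dims M l : valid M l -> mdom (run M l) = M /\ mcod (run M l) = nxts M l.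
Proof.
elim: l M => //= x l IH M /andP[h /IH[e1 e2]].
by rewrite mcomp_dom ?mcomp_cod ?e1 ?lay_cod ?lay_dom.
Qed.

Lemma run_dom M l : valid M l -> mdom (run M l) = M.
Proof. by case/run_dims. Qed.

Lemma run_cod M l : valid M l -> mcod (run M l) = nxts M l.
Proof. by case/run_dims. Qed.

Lemma run_cat M a b : valid M a -> valid (nxts M a) b ->
  run M (a ++ b) = mcomp (run (nxts M a) b) (run M a).
Proof.
elim: a M => [|x a IH] M /=; first by move=> _ v; rewrite mcomp1r ?run_dom.
case/andP=> h va vb; rewrite IH // mcompA ?run_dom ?run_cod ?lay_cod //.
Qed.

Lemma run1 M x : fits M x -> run M [:: x] = lay M x.
Proof. by move=> h /=; rewrite mcomp1l ?lay_cod. Qed.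

Lemma run_shift k M l : valid M l -> run (k + M) (shift k l) = mtens (mid k) (run M l).
Proof.
elim: l M => [|[g p] l IH] M /=; first by rewrite mtens_id.
case/andP=> h v; rewrite -[X in mtens X _](mcomp1l (n := k)) //.
rewrite minterchange ?run_dom ?lay_cod // -IH //; congr mcomp.
  by congr run; move: h; rewrite /fits /nxt /=; lia.
rewrite /lay /= [RHS]mtensA mtens_id; congr (mtens _ (mtens _ (mid _))); lia.
Qed.

Lemma run_wide k M l : valid M l -> run (M + k) l = mtens (run M l) (mid k).
Proof.
elim: l M => [|[g p] l IH] M /=; first by rewrite mtens_id.
case/andP=> h v; rewrite -[X in mtens _ X](mcomp1l (n := k)) //.
rewrite minterchange ?run_dom ?lay_cod // -IH //; congr mcomp.
  by congr run; move: h; rewrite /fits /nxt /=; lia.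
rewrite /lay /= -!mtensA mtens_id; congr (mtens _ (mtens _ (mid _))).
by move: h; rewrite /fits /=; lia.
Qed.

Lemma run_layers m s (d : diag m s) : Mor (hom_of K d) = run m (layers d).
Proof.
rewrite /hom_of; elim: d => //=.
- by rewrite mcomp1l //= /lay /= mtens0l mtens0r.
- by rewrite mcomp1l //= /lay /= mtens0l mtens0r.
- by rewrite mcomp1l //= /lay /= mtens0l mtens0r.
- by rewrite mcomp1l //= /lay /= mtens0l mtens0r.
- move=> m1 n p g Eg h Eh; rewrite -hcompE -mcompE Eg Eh.
  by rewrite run_cat ?nxts_layers ?layers_valid.
- move=> m1 s1 m2 s2 g Eg h Eh; rewrite -htensE -mtensE Eg Eh.
  rewrite run_cat ?valid_shift ?layers_valid //; last first.
    by rewrite nxts_shift ?layers_valid // nxts_layers valid_wide ?layers_valid.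
  rewrite nxts_shift ?layers_valid // nxts_layers run_shift ?layers_valid //.
  rewrite run_wide ?layers_valid // -minterchange //.
  + by rewrite mcomp1r ?mcomp1l ?run_cod ?run_dom ?layers_valid ?nxts_layers.
  + by rewrite run_dom ?layers_valid.
  + by rewrite run_cod ?layers_valid ?nxts_layers.
Qed.

End Run.

(** * Rewriting dot-free words *)

Local Open Scope nat_scope.

Notation lU p := (gU, p).
Notation lA p := (gA, p).
Notation lS p := (gS, p).
Notation lX p := (gX, p).

(** [l ~> l'] says that on any number of strands for which the word l makes
    sense so does l', and both then represent the same morphism. Leaving the
    number of strands implicit makes this relation compatible with contexts
    without side conditions; it is not symmetric, as l' may fit on fewer
    strands. The quantification over K is what allows results of coherence to
    be read off in one ring and used in another. *)
Variant reduces (l l' : seq layer) : Prop :=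
  Reduces of forall M, valid M l -> [/\ valid M l', nxts M l = nxts M l'
                                      & forall K, run K M l = run K M l'].
Notation "l ~> l'" := (reduces l l') (at level 70, no associativity).

Lemma redP l l' M : l ~> l' -> valid M l ->
  [/\ valid M l', nxts M l = nxts M l' & forall K, run K M l = run K M l'].
Proof. by case=> h; apply: h. Qed.

Lemma red_refl l : l ~> l.
Proof. by split=> M v. Qed.

Lemma red_trans l2 l1 l3 : l1 ~> l2 -> l2 ~> l3 -> l1 ~> l3.
Proof.
move=> h1 h2; split=> M v.
have [v2 -> e2] := redP h1 v; have [v3 -> e3] := redP h2 v2.
by split=> // K; rewrite e2.
Qed.

Lemma red_ctx a b l l' : l ~> l' -> a ++ l ++ b ~> a ++ l' ++ b.
Proof.
move=> h; split=> M; rewrite !valid_cat => /and3P[va vl vb].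
have [v' e r] := redP h vl; rewrite !nxts_cat -e va v' vb; split=> // K.
by rewrite !run_cat ?valid_cat ?va ?vl ?v' ?vb -?e ?r.
Qed.

Lemma red_catl a l l' : l ~> l' -> a ++ l ~> a ++ l'.
Proof. by move/(@red_ctx a [::] _ _); rewrite !cats0. Qed.

Lemma red_catr b l l' : l ~> l' -> l ++ b ~> l' ++ b.
Proof. exact: (@red_ctx [::] b). Qed.

Lemma red_cons x l l' : l ~> l' -> x :: l ~> x :: l'.
Proof. exact: (@red_catl [:: x]). Qed.

Lemma red_at a b x y r : x ~> y -> a ++ y ++ b ~> r -> a ++ x ++ b ~> r.
Proof. by move=> /(@red_ctx a b _ _); apply: red_trans. Qed.

Lemma red_sym l l' : l ~> l' -> (forall M, valid M l' -> valid M l) -> l' ~> l.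
Proof.
by move=> h hv; split=> M v'; have v := hv _ v'; have [_ -> e] := redP h v; split.
Qed.

Lemma red_shift k l l' : l ~> l' ->
  (forall M, valid M (shift k l) -> exists2 N, M = k + N & valid N l) ->
  shift k l ~> shift k l'.
Proof.
move=> h hv; split=> M /hv[N -> v]; have [v' e r] := redP h v.
rewrite !nxts_shift ?valid_shift // e; split=> // K.
by rewrite !run_shift // r.
Qed.

(** A relation valid on its m strands is valid anywhere in a larger picture. *)
Lemma red_local m p l l' :
    valid m l -> valid m l' -> nxts m l = nxts m l' ->
    (forall K, run K m l = run K m l') ->
    (forall M, valid M (shift p l) -> p + m <= M) ->
  shift p l ~> shift p l'.
Proof.
move=> v v' e r hv; split=> M vM.
have [k ->] : exists k, M = p + (m + k).
  by exists (M - (p + m)); rewrite addnA subnKC ?hv.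
rewrite !nxts_shift ?(valid_wide _ v) ?(valid_wide _ v') // !nxts_wide // e.
split=> //; first by rewrite valid_shift ?valid_wide.
by move=> K; rewrite !run_shift ?valid_wide // !run_wide // r.
Qed.

Lemma lay_at K p m (g : gen) q : m = p + (gdom g + q) ->
  lay K m (g, p) = mtens (mid K p) (mtens (genmor K g) (mid K q)).
Proof. by move=> ->; rewrite /lay /=; congr (mtens _ (mtens _ (mid _ _))); lia. Qed.

Ltac run_small :=
  rewrite /run /nxt /lay /= ?mtens0l ?mtens0r ?mcomp1l //;
  rewrite /mid /genmor ?mtensE ?htensE ?mcompE ?hcompE.

Ltac local_rule m p l l' :=
  let H := fresh in
  have H : shift p l ~> shift p l';
  [ apply: (@red_local m) => //;
    [ | by move=> M /=; rewrite /fits /nxt /=; lia ] => K; run_small; congr Mor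
  | by move: H; rewrite /shift /= ?addn0 ?addn1; apply ].

Lemma red_SS p : [:: lS p; lS p] ~> [::].
Proof. by local_rule 2 p [:: lS 0; lS 0] (Nil layer); apply/Hom_eqP/rel_SS. Qed.

Lemma red_braid p : [:: lS p; lS p.+1; lS p] ~> [:: lS p.+1; lS p; lS p.+1].
Proof. by local_rule 3 p [:: lS 0; lS 1; lS 0] [:: lS 1; lS 0; lS 1]; apply/Hom_eqP/rel_braid. Qed.

Lemma red_braid' p : [:: lS p.+1; lS p; lS p.+1] ~> [:: lS p; lS p.+1; lS p].
Proof.
by apply: (red_sym (red_braid p)) => M /=; rewrite /fits /nxt /=; lia.
Qed.

Lemma red_zigzag1 p : [:: lU p; lA p.+1] ~> [::].
Proof. by local_rule 1 p [:: lU 0; lA 1] (Nil layer); apply/Hom_eqP/rel_zigzag1. Qed.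

Lemma red_zigzag2 p : [:: lU p.+1; lA p] ~> [::].
Proof. by local_rule 1 p [:: lU 1; lA 0] (Nil layer); apply/Hom_eqP/rel_zigzag2. Qed.

Lemma red_US p : [:: lU p; lS p] ~> [:: lU p].
Proof. by local_rule 0 p [:: lU 0; lS 0] [:: lU 0]; apply/Hom_eqP/eqv_sym/rel_SU. Qed.

Lemma red_SA p : [:: lS p; lA p] ~> [:: lA p].
Proof. by local_rule 2 p [:: lS 0; lA 0] [:: lA 0]; apply/Hom_eqP/eqv_sym/rel_AS. Qed.

Lemma red_SA_slide p : [:: lS p.+1; lA p] ~> [:: lS p; lA p.+1].
Proof. by local_rule 3 p [:: lS 1; lA 0] [:: lS 0; lA 1]; apply/Hom_eqP/rel_AS_slide. Qed.

Lemma red_SA_slide' p : [:: lS p; lA p.+1] ~> [:: lS p.+1; lA p].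
Proof.
by apply: (red_sym (red_SA_slide p)) => M /=; rewrite /fits /nxt /=; lia.
Qed.

Lemma red_US_slide p : [:: lU p.+1; lS p] ~> [:: lU p; lS p.+1].
Proof. by local_rule 1 p [:: lU 1; lS 0] [:: lU 0; lS 1]; apply/Hom_eqP/rel_SU_slide. Qed.

Lemma red_US_slide' p : [:: lU p; lS p.+1] ~> [:: lU p.+1; lS p].
Proof.
by apply: (red_sym (red_US_slide p)) => M /=; rewrite /fits /nxt /=; lia.
Qed.

(** Layers acting on disjoint groups of strands commute. *)
Lemma red_far g h p q : p + gdom g <= q ->
  [:: (h, q); (g, p)] ~> [:: (g, p); (h, q - gdom g + gcod g)].
Proof.
move=> pq; split=> M /=; rewrite /fits /nxt /= => H.
have [k qE] : exists k, q = p + gdom g + k by exists (q - (p + gdom g)); lia.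
have [r ME] : exists r, M = p + gdom g + k + gdom h + r.
  by exists (M - (p + gdom g + k + gdom h)); lia.
subst q M; split; [lia | lia | move=> K].
rewrite (_ : p + gdom g + k - gdom g + gcod g = p + gcod g + k); last lia.
rewrite !mcomp1l ?lay_cod // /fits /nxt /=; try lia.
set M := p + gdom g + k + gdom h + r.
rewrite (@lay_at K (p + gdom g + k) M h r) /M; last lia.
rewrite (@lay_at K p (M - gdom h + gcod h) g (k + gcod h + r)) /M; last lia.
rewrite (@lay_at K p M g (k + gdom h + r)) /M; last lia.
rewrite (@lay_at K (p + gcod g + k) (M - gdom g + gcod g) h r) /M; last lia.
rewrite -!(mtens_id K) -!mtensA.
rewrite -!(minterchange (f := mid K p)) ?genmor_cod ?genmor_dom //=;
  rewrite ?genmor_cod ?genmor_dom //=; try lia.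
congr mtens; rewrite -!minterchange ?genmor_cod ?genmor_dom //=;
  rewrite ?genmor_cod ?genmor_dom //=; try lia.
by rewrite !mcomp1l ?mcomp1r ?genmor_cod ?genmor_dom.
Qed.

Lemma red_far' g h p q : p + gcod g <= q ->
  [:: (g, p); (h, q)] ~> [:: (h, q - gcod g + gdom g); (g, p)].
Proof.
move=> pq.
have := @red_far g h p (q - gcod g + gdom g).
rewrite (_ : q - gcod g + gdom g - gdom g + gcod g = q); last lia.
move=> H; apply: (red_sym (H _)); first lia.
by move=> M /=; rewrite /fits /nxt /=; lia.
Qed.

Local Open Scope nat_scope.

Lemma far_SS p q : p.+1 < q -> [:: lS q; lS p] ~> [:: lS p; lS q].
Proof.
move=> h; have H := @red_far gS gS p q; rewrite /= in H.
by rewrite -[in X in _ ~> X](_ : q - 2 + 2 = q); [apply: H|]; lia.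
Qed.

Lemma far_SS' p q : p.+1 < q -> [:: lS p; lS q] ~> [:: lS q; lS p].
Proof.
move=> h; have H := @red_far' gS gS p q; rewrite /= in H.
by rewrite -[in X in _ ~> X](_ : q - 2 + 2 = q); [apply: H|]; lia.
Qed.

Lemma far_SA p q : p <= q -> [:: lS q.+2; lA p] ~> [:: lA p; lS q].
Proof.
move=> h; have H := @red_far gA gS p q.+2; rewrite /= addn0 subn2 in H.
by apply: H; lia.
Qed.

Lemma far_AS p q : p <= q -> [:: lA p; lS q] ~> [:: lS q.+2; lA p].
Proof.
move=> h; have H := @red_far' gA gS p q; rewrite /= subn0 addn2 in H.
by apply: H; lia.
Qed.

Lemma far_AS' p q : p.+1 < q -> [:: lA q; lS p] ~> [:: lS p; lA q].
Proof.
move=> h; have H := @red_far gS gA p q; rewrite /= in H.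
by rewrite -[in X in _ ~> X](_ : q - 2 + 2 = q); [apply: H|]; lia.
Qed.

Lemma far_SA' p q : p.+1 < q -> [:: lS p; lA q] ~> [:: lA q; lS p].
Proof.
move=> h; have H := @red_far' gS gA p q; rewrite /= in H.
by rewrite -[in X in _ ~> X](_ : q - 2 + 2 = q); [apply: H|]; lia.
Qed.

Lemma far_AA p q : p <= q -> [:: lA q.+2; lA p] ~> [:: lA p; lA q].
Proof.
move=> h; have H := @red_far gA gA p q.+2; rewrite /= addn0 subn2 in H.
by apply: H; lia.
Qed.

Lemma far_AA' p q : p <= q -> [:: lA p; lA q] ~> [:: lA q.+2; lA p].
Proof.
move=> h; have H := @red_far' gA gA p q; rewrite /= subn0 addn2 in H.
by apply: H; lia.
Qed.

Lemma far_US p q : p.+1 < q -> [:: lU q; lS p] ~> [:: lS p; lU q].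
Proof.
move=> h; have H := @red_far gS gU p q; rewrite /= in H.
by rewrite -[in X in _ ~> X](_ : q - 2 + 2 = q); [apply: H|]; lia.
Qed.

Lemma far_US' p q : p <= q -> [:: lU p; lS q.+2] ~> [:: lS q; lU p].
Proof.
move=> h; have H := @red_far' gU gS p q.+2; rewrite /= addn0 subn2 in H.
by apply: H; lia.
Qed.

Lemma far_UA p q : p <= q -> [:: lU q.+2; lA p] ~> [:: lA p; lU q].
Proof.
move=> h; have H := @red_far gA gU p q.+2; rewrite /= addn0 subn2 in H.
by apply: H; lia.
Qed.

(** [mv a j] moves the strand at position j to the position a on its left. *)
Definition mv (a j : nat) : seq layer := [seq lS i | i <- rev (iota a (j - a))].

Lemma mvnn a : mv a a = [::]. Proof. by rewrite /mv subnn. Qed.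

Lemma mv_nil a j : j <= a -> mv a j = [::].
Proof. by move=> h; rewrite /mv (_ : j - a = 0) //; lia. Qed.

Lemma mvS a j : a <= j -> mv a j.+1 = lS j :: mv a j.
Proof. by move=> h; rewrite /mv subSn // -addn1 iotaD rev_cat /= subnKC. Qed.

Lemma mv_rcons a j : a < j -> mv a j = mv a.+1 j ++ [:: lS a].
Proof.
by move=> h; rewrite /mv -(subnSK h) /= rev_cons map_rcons cats1.
Qed.

Lemma mv_cat a b j : a <= b <= j -> mv a j = mv b j ++ mv a b.
Proof.
case/andP=> ab; elim: j => [|j IH]; first by case: b ab => // + _; case: a.
rewrite leq_eqVlt => /predU1P[->|]; first by rewrite mvnn.
by rewrite ltnS => bj; rewrite !mvS ?IH //; lia.
Qed.

Lemma mv_lt p a j : p.+1 < a -> lS p :: mv a j ~> mv a j ++ [:: lS p].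
Proof.
move=> h; elim: j => [|j IH]; first (by rewrite !mv_nil //; exact: red_refl).
case: (leqP a j) => aj; last (by rewrite mv_nil //; apply: red_refl).
rewrite mvS //.
apply: (red_at (a := [::]) (b := mv a j) (far_SS' _)); first lia.
exact: (red_cons _ IH).
Qed.

Lemma mv_gt p a j : j < p -> lS p :: mv a j ~> mv a j ++ [:: lS p].
Proof.
elim: j => [|j IH] h; first (by rewrite !mv_nil //; exact: red_refl).
case: (leqP a j) => aj; last (by rewrite mv_nil //; apply: red_refl).
rewrite mvS //.
apply: (red_at (a := [::]) (b := mv a j) (far_SS _)); first lia.
by apply: red_cons; apply: IH; lia.
Qed.

Lemma mv_mid p a j : a <= p -> p.+1 < j -> lS p :: mv a j ~> mv a j ++ [:: lS p.+1].
Proof.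
move=> ap; elim: j => // j IH; rewrite ltnS leq_eqVlt => /predU1P[<-|h].
  rewrite !mvS; try lia.
  apply: (red_at (a := [::]) (b := mv a p) (red_braid _)).
  rewrite /=; do 2 apply: red_cons; apply: mv_gt; lia.
rewrite mvS; last lia.
apply: (red_at (a := [::]) (b := mv a j) (far_SS' _)); first lia.
exact: (red_cons _ (IH h)).
Qed.

Lemma mv_cancel a j : a <= j -> lS j :: mv a j.+1 ~> mv a j.
Proof.
move=> h; rewrite mvS //.
by apply: (red_at (a := [::]) (b := mv a j) (red_SS _)); apply: red_refl.
Qed.

Lemma valid_mv M a j : (a < j -> j < M) -> valid M (mv a j).
Proof.
move=> h; have {h} : j <= a \/ j < M by case: (ltnP a j) => [/h ?|?]; [right|left].
elim: j M => [|j IH] M // h.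
case: (leqP a j) => aj; last by rewrite mv_nil.
rewrite mvS //= /fits /nxt /= subnK; last lia.
by rewrite IH; lia.
Qed.

Lemma nxts_mv M a j : valid M (mv a j) -> nxts M (mv a j) = M.
Proof.
elim: j => // j IH.
case: (leqP a j) => aj; last by rewrite mv_nil.
rewrite mvS //= /fits /nxt /= => /andP[h]; rewrite subnK; last lia.
exact: IH.
Qed.

(** The bottom strand 0 is capped with strand j, which first crosses over the
    strands between them. *)
Definition capw (j : nat) : seq layer := mv 1 j ++ [:: lA 0].

(** A perfect matching of M points is encoded by the partner j of the first
    point followed by the code of the induced matching of the other M - 2. *)
Definition nf (mu : seq nat) : seq layer := flatten [seq capw j | j <- mu].

Fixpoint vnf (M : nat) (mu : seq nat) : bool :=
  if mu is j :: mu' then (0 < j < M) && vnf (M - 2) mu' else M == 0.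

Lemma valid_capw M j : 0 < j < M -> valid M (capw j).
Proof.
move=> h; have v : valid M (mv 1 j) by apply: valid_mv; lia.
by rewrite valid_cat v nxts_mv //= /fits /=; lia.
Qed.

Lemma nxts_capw M j : 0 < j < M -> nxts M (capw j) = M - 2.
Proof.
move=> h; have v : valid M (mv 1 j) by apply: valid_mv; lia.
by rewrite nxts_cat nxts_mv //= /nxt /=; lia.
Qed.

Lemma valid_nf M mu : vnf M mu -> valid M (nf mu) /\ nxts M (nf mu) = 0.
Proof.
elim: mu M => [|j mu IH] M /=; first by move/eqP->.
case/andP=> h /IH[v e]; rewrite /nf /= -/(nf mu).
by rewrite valid_cat nxts_cat nxts_capw // valid_capw.
Qed.

(** Moving strand j to position 2 and a later strand to position 1 can be done
    in the other order. *)
Lemma mv_mv a i j : a < j -> a < i ->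
  mv a.+1 j ++ mv a i.+1 ~>
    if j <= i then mv a i.+1 ++ mv a.+2 j.+1 else mv a i ++ mv a.+2 j.
Proof.
move=> aj ai; elim: j aj => // j IH; rewrite ltnS leq_eqVlt => /predU1P[<-|aj].
  by rewrite mvnn ai mvnn cats0; apply: red_refl.
rewrite mvS //=; apply: red_trans (red_cons _ (IH aj)) _.
case: (ltngtP j i) => ji.
- rewrite /=.
  apply: red_trans (red_catr (mv a.+2 j.+1) (mv_mid _ _)) _; try lia.
  by rewrite -catA /= [mv _ j.+2]mvS; [apply: red_refl | lia].
- rewrite /=.
  apply: red_trans (red_catr (mv a.+2 j) (mv_gt _ _)) _; try lia.
  by rewrite -catA /= [mv _ j.+1]mvS; [apply: red_refl | lia].
- rewrite -ji /=.
  apply: red_trans (red_catr (mv a.+2 j.+1) (mv_cancel _)) _; try lia.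
  exact: red_refl.
Qed.

Lemma cap_S_far p j : j < p.+2 -> 0 < j -> lS p.+2 :: capw j ~> capw j ++ [:: lS p].
Proof.
move=> h j0; rewrite /capw.
apply: red_trans (red_catr _ (mv_gt _ h)) _.
by rewrite -!catA; apply: red_catl; apply: far_SA.
Qed.

Lemma cap_S_in p j : p.+2 < j -> lS p.+1 :: capw j ~> capw j ++ [:: lS p].
Proof.
move=> h; rewrite /capw.
apply: red_trans (red_catr _ (mv_mid _ h)) _ => //.
by rewrite -!catA; apply: red_catl; apply: far_SA.
Qed.

Lemma cap_S_cancel j : lS j.+1 :: capw j.+2 ~> capw j.+1.
Proof. exact: (red_catr [:: lA 0] (mv_cancel (a := 1) (j := j.+1) _)). Qed.

Lemma capwS j : capw j.+2 = lS j.+1 :: capw j.+1.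
Proof. by rewrite /capw mvS. Qed.

(** A strand crossing a cap from right to left can be pulled off it. *)
Lemma red_SSA p : [:: lS p.+1; lS p; lA p.+1] ~> [:: lA p].
Proof.
apply: (red_at (a := [:: lS p.+1]) (b := [::]) (red_SA_slide' _)).
by apply: (red_at (a := [::]) (b := [:: lA p]) (red_SS _)); exact: red_refl.
Qed.

Lemma S0_capw j : lS 0 :: capw j.+2 ~> mv 2 j.+2 ++ [:: lA 1].
Proof.
rewrite /capw (mv_rcons (a := 1)) // -catA.
apply: red_trans (red_catr _ (mv_lt _ _)) _ => //; rewrite -catA; apply: red_catl.
apply: (red_at (a := [:: lS 0]) (b := [::]) (red_SA_slide _)).
by apply: (red_at (a := [::]) (b := [:: lA 1]) (red_SS _)); exact: red_refl.
Qed.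

(** An innermost cap slides through the strand moved by [capw]. *)
Lemma A_mv_hi a p j : p <= a -> lA p :: mv a j ~> mv a.+2 j.+2 ++ [:: lA p].
Proof.
move=> pa; elim: j => [|j IH]; first (by rewrite !mv_nil //; exact: red_refl).
case: (leqP a j) => aj; last first.
  by rewrite !mv_nil //; apply: red_refl.
rewrite (mvS aj) (@mvS a.+2 j.+2) //.
apply: (red_at (a := [::]) (b := mv a j) (far_AS _)); first lia.
exact: (red_cons _ IH).
Qed.

Lemma A_mv_lo a p j : j < p -> lA p :: mv a j ~> mv a j ++ [:: lA p].
Proof.
elim: j => [|j IH] h; first (by rewrite !mv_nil //; exact: red_refl).
case: (leqP a j) => aj; last (by rewrite mv_nil //; apply: red_refl).
rewrite mvS //.
apply: (red_at (a := [::]) (b := mv a j) (far_AS' _)); first lia.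
by apply: red_cons; apply: IH; lia.
Qed.

Lemma mv_A_lo a p j : j < p -> mv a j ++ [:: lA p] ~> lA p :: mv a j.
Proof.
elim: j => [|j IH] h; first (by rewrite !mv_nil //; exact: red_refl).
case: (leqP a j) => aj; last (by rewrite mv_nil //; apply: red_refl).
rewrite mvS //=; apply: red_trans (red_cons _ (IH _)) _; first lia.
by apply: (red_at (a := [::]) (b := mv a j) (far_SA' _)); [lia | exact: red_refl].
Qed.

Lemma mv_A_hi a p j : p <= a -> mv a.+2 j.+2 ++ [:: lA p] ~> lA p :: mv a j.
Proof.
move=> pa; elim: j => [|j IH]; first (by rewrite !mv_nil //; exact: red_refl).
case: (leqP a j) => aj; last first.
  by rewrite !mv_nil //; apply: red_refl.
rewrite (mvS aj) (@mvS a.+2 j.+2) //; apply: red_trans (red_cons _ IH) _.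
by apply: (red_at (a := [::]) (b := mv a j) (far_SA _)); [lia | exact: red_refl].
Qed.

Lemma exchange i j : 0 < i -> 
  lS 0 :: capw j.+2 ++ capw i ~>
    if j.+1 < i.+1 then capw i.+2 ++ capw j.+1 else capw i.+1 ++ capw j.
Proof.
case: i => // i _.
apply: red_trans (red_catr (capw i.+1) (S0_capw j)) _.
rewrite {1}/capw -catA /=.
(* A_1 passes the strand moved by the second cap *)
apply: red_trans (red_catl _ (red_catr [:: lA 0] (A_mv_hi i.+1 (leqnn 1)))) _.
rewrite -catA /=.
(* the two nested caps are made adjacent *)
have nest : [:: lA 1; lA 0] ~> [:: lS 2; lS 1; lA 0; lA 0].
  apply: (@red_sym _ _ _); last first.
    by move=> M /=; rewrite /fits /nxt /=; lia.
  apply: (red_at (a := [:: lS 2; lS 1]) (b := [::]) (far_AA' (leqnn 0))).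
  by apply: (red_at (a := [::]) (b := [:: lA 0]) (red_SSA 1)); exact: red_refl.
apply: red_trans (red_catl _ (red_catl _ nest)) _.
have -> : mv 3 i.+3 ++ [:: lS 2; lS 1; lA 0; lA 0] = mv 1 i.+3 ++ [:: lA 0; lA 0].
  by rewrite (mv_rcons (a := 1)) // (mv_rcons (a := 2)) // -!catA.
rewrite catA; apply: red_trans (red_catr _ (mv_mv _ _)) _ => //.
rewrite !ltnS; case: leqP => h.
- rewrite -catA (_ : mv 3 j.+3 ++ [:: lA 0; lA 0] = (mv 3 j.+3 ++ [:: lA 0]) ++ [:: lA 0]).
    apply: red_trans (red_catl _ (red_catr _ (mv_A_hi _ _))) _ => //.
    by rewrite /capw -!catA; apply: red_refl.
  by rewrite -catA.
- rewrite -catA (_ : mv 3 j.+2 ++ [:: lA 0; lA 0] = (mv 3 j.+2 ++ [:: lA 0]) ++ [:: lA 0]).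
    apply: red_trans (red_catl _ (red_catr _ (mv_A_hi _ _))) _ => //.
    by rewrite /capw -!catA; apply: red_refl.
  by rewrite -catA.
Qed.

Definition isS (x : layer) := if x.1 is gS then true else false.

Lemma nf_S mu M p : vnf M mu -> p.+1 < M ->
  exists2 mu', vnf M mu' & lS p :: nf mu ~> nf mu'.
Proof.
elim: mu M p => [|j mu IH] M p /=; first by move/eqP->.
case/andP=> hj v hp; case: p hp => [|p] hp.
- case: j hj => [//|[|j]] hj.
    exists (1 :: mu); first by rewrite /= v; lia.
    exact: (red_catr (nf mu) (red_SA 0)).
  case: mu v {IH} => [|i mu] /= v; first lia.
  case/andP: v => hi v.
  have hx : lS 0 :: nf (j.+2 :: i :: mu) ~> nf ((if j.+1 < i.+1 then [:: i.+2; j.+1] else [:: i.+1; j]) ++ mu).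
    have := red_catr (nf mu) (exchange j (i := i) _).
    by rewrite /nf /= => /(_ ltac:(lia)); case: ifP => _ /=; rewrite !catA -?catA.
  eexists; last exact: hx.
  by case: ifP => h /=; rewrite v andbT; lia.
- case: (ltngtP j p.+1) => hjp.
  + case: p hp hjp => [|p] hp hjp; first lia.
    have [|mu' v' r] := IH (M - 2) p v; first lia.
    exists (j :: mu'); first by rewrite /= v'; lia.
    apply: red_trans (red_catr (nf mu) (cap_S_far _ _)) _ => //; first lia.
    by rewrite -catA; apply: red_catl.
  + case: (ltngtP j p.+2) => hjp'; first lia.
      have [|mu' v' r] := IH (M - 2) p v; first lia.
      exists (j :: mu'); first by rewrite /= v'; lia.
      apply: red_trans (red_catr (nf mu) (cap_S_in _)) _ => //.
      by rewrite -catA; apply: red_catl.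
    exists (p.+1 :: mu); first by rewrite /= v; lia.
    by rewrite hjp'; apply: (red_catr (nf mu) (cap_S_cancel _)).
  + exists (p.+2 :: mu); first by rewrite /= v; lia.
    by rewrite hjp /nf /= capwS; apply: red_refl.
Qed.

Lemma nf_Ss mu M l : all isS l -> valid M l -> vnf M mu ->
  exists2 mu', vnf M mu' & l ++ nf mu ~> nf mu'.
Proof.
move=> + + v; elim: l => [|[[] p] l IH] //=; first by exists mu => //; apply: red_refl.
move=> al /andP[hp vl]; rewrite /fits /nxt /= in hp vl.
have [|mu' v' r] := IH al; first by rewrite -[M](subnK (m := 2)) //; lia.
have [|mu'' v'' r'] := @nf_S mu' M p v'; first lia.
by exists mu'' => //; apply: red_trans (red_cons _ r) r'.
Qed.

Lemma valid_capw_inv M j : valid M (capw j) -> j < M.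
Proof.
rewrite valid_cat => /andP[v]; rewrite nxts_mv //= /fits /= andbT => h2.
case: j v => [|[|j]]; [lia|lia|].
by rewrite mvS //= /fits /nxt /= => /andP[]; lia.
Qed.

(** A cap to the left of the partner j of the first strand. *)
Lemma A_capw_hi p j : 0 < p <= j -> lA p :: capw j ~> capw j.+2 ++ [:: lA p.-1].
Proof.
case: p => // p /= pj; rewrite /capw [mv 1 j](@mv_cat 1 p.+1) ?pj //.
rewrite (@mv_cat 1 p.+3 j.+2) ?pj // -!catA.
apply: red_trans (red_catr _ (A_mv_hi _ (leqnn p.+1))) _.
rewrite -!catA; apply: red_catl.
have pull : lA p.+1 :: capw p.+1 ~>
    [:: lS p.+2; lS p.+1] ++ [:: lA p.+2] ++ capw p.+1.
  apply: (@red_sym _ (lA p.+1 :: capw p.+1)).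
    by apply: (red_at (a := [::]) (b := capw p.+1) (red_SSA p.+1)); apply: red_refl.
  move=> M /andP[h v]; have {}v : valid (M - 2) (capw p.+1) by rewrite -[M - 2]addn0.
  have hM := valid_capw_inv v; rewrite /fits /= in h.
  apply/and4P; rewrite /fits /nxt /=; split; try lia.
  by rewrite (_ : M - 2 + 2 - 2 + 2 - 2 + 0 = M - 2) //; lia.
apply: red_trans pull _.
rewrite (_ : mv 1 p.+3 = [:: lS p.+2; lS p.+1] ++ mv 1 p.+1); last by rewrite (@mvS 1 p.+2) // (@mvS 1 p.+1).
rewrite -catA; apply: red_catl; rewrite /capw.
apply: red_trans (red_catr _ (A_mv_lo _ (ltnSn _))) _.
rewrite -!catA; apply: red_catl; exact: (far_AA (leq0n p)).
Qed.

Lemma A_capw_lo p j : 0 < j < p -> lA p :: capw j ~> capw j ++ [:: lA p.-2].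
Proof.
case: p => [|[|p]]; [lia | lia |] => /andP[_ h] /=; rewrite /capw.
apply: red_trans (red_catr _ (A_mv_lo _ h)) _.
rewrite -!catA; apply: red_catl; exact: (far_AA (leq0n p)).
Qed.

Lemma nf_A mu M p : vnf M mu -> p <= M ->
  exists2 mu', vnf (M + 2) mu' & lA p :: nf mu ~> nf mu'.
Proof.
elim: mu M p => [|j mu IH] M p /=.
  move=> /eqP-> hp; exists [:: 1] => //.
  by rewrite (_ : p = 0); [exact: red_refl | lia].
case/andP=> hj v hp; case: p hp => [|p] hp.
  exists [:: 1, j & mu]; last exact: red_refl.
  by rewrite /= addnK v; lia.
case: (ltnP j p.+1) => hjp.
- have [|mu' v' r] := IH (M - 2) p.+1.-2 v; first lia.
  exists (j :: mu'); first by rewrite /= addnK -[M in vnf M](subnK (m := 2)) ?v'; lia.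
  apply: red_trans (red_catr (nf mu) (A_capw_lo _)) _ => //; first lia.
  by rewrite -catA; apply: red_catl.
- have [|mu' v' r] := IH (M - 2) p v; first lia.
  exists (j.+2 :: mu'); first by rewrite /= addnK -[M in vnf M](subnK (m := 2)) ?v'; lia.
  apply: red_trans (red_catr (nf mu) (A_capw_hi _)) _ => //.
  by rewrite -catA; apply: red_catl.
Qed.

Lemma U_mv_hi a p j : p <= a -> lU p :: mv a.+2 j.+2 ~> mv a j ++ [:: lU p].
Proof.
move=> pa; elim: j => [|j IH]; first (by rewrite !mv_nil //; exact: red_refl).
case: (leqP a j) => aj; last (by rewrite !mv_nil //; apply: red_refl).
rewrite (mvS aj) (@mvS a.+2 j.+2) //.
apply: (red_at (a := [::]) (b := mv a.+2 j.+2) (far_US' _)); first lia.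
exact: (red_cons _ IH).
Qed.

Lemma U_mv_lo a p j : j < p -> lU p :: mv a j ~> mv a j ++ [:: lU p].
Proof.
elim: j => [|j IH] h; first (by rewrite !mv_nil //; exact: red_refl).
case: (leqP a j) => aj; last (by rewrite mv_nil //; apply: red_refl).
rewrite mvS //.
apply: (red_at (a := [::]) (b := mv a j) (far_US _)); first lia.
by apply: red_cons; apply: IH; lia.
Qed.

(** A cup with neither end attached to the strand moved by [capw]. *)
Lemma U_capw_lo p j : 0 < j < p -> lU p :: capw j ~> capw j ++ [:: lU p.-2].
Proof.
case: p => [|[|p]]; [lia | lia |] => /andP[_ h] /=; rewrite /capw.
apply: red_trans (red_catr _ (U_mv_lo _ h)) _.
rewrite -!catA; apply: red_catl; exact: (far_UA (leq0n p)).
Qed.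

Lemma U_capw_hi p j : 0 < p <= j -> lU p :: capw j.+2 ~> capw j ++ [:: lU p.-1].
Proof.
case: p => // p /= pj; rewrite /capw [mv 1 j](@mv_cat 1 p.+1) ?pj //.
rewrite (@mv_cat 1 p.+3 j.+2) ?pj // -!catA.
apply: red_trans (red_catr _ (U_mv_hi _ (leqnn p.+1))) _.
rewrite -!catA; apply: red_catl.
rewrite (_ : mv 1 p.+3 = [:: lS p.+2; lS p.+1] ++ mv 1 p.+1); last by rewrite (@mvS 1 p.+2) // (@mvS 1 p.+1).
rewrite -catA.
apply: (red_at (a := [::]) (b := lS p.+1 :: mv 1 p.+1 ++ [:: lA 0]) (red_US_slide' _)).
apply: (red_at (a := [:: lU p.+2]) (b := mv 1 p.+1 ++ [:: lA 0]) (red_SS _)).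
apply: red_trans (red_catr [:: lA 0] (U_mv_lo 1 (ltnSn _))) _.
rewrite -!catA; apply: red_catl; exact: (far_UA (leq0n p)).
Qed.

Lemma iota0S p : iota 0 p.+1 = iota 0 p ++ [:: p].
Proof. by rewrite -[p.+1]addn1 iotaD. Qed.

(** A cup attached to the strand moved by [capw] is straightened: what remains
    is a permutation of the strands. *)
Lemma U_capw_end p : lU p.+1 :: capw p.+1 ~> [seq lS i | i <- iota 0 p].
Proof.
elim: p => [|p IH]; first exact: (red_zigzag2 0).
rewrite capwS.
apply: (red_at (a := [::]) (b := capw p.+1) (red_US_slide _)).
apply: red_trans (red_cons _ (cap_S_far _ _)) _ => //.
by rewrite iota0S map_cat; exact: (red_catr [:: lS p] IH).
Qed.

Lemma U0_capw j : lU 0 :: capw j.+2 ~> mv 0 j.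
Proof.
rewrite /capw (mv_rcons (a := 1)) // -catA.
apply: red_trans (red_catr _ (U_mv_hi _ (leqnn 0))) _.
rewrite -catA -[X in _ ~> X]cats0; apply: red_catl.
apply: (red_at (a := [:: lU 0]) (b := [::]) (red_SA_slide _)).
apply: (red_at (a := [::]) (b := [:: lA 1]) (red_US _)).
exact: red_zigzag1.
Qed.

(** A bubble with k dots, at the left of the picture. *)
Definition bub (k : nat) : seq layer := lU 0 :: nseq k (lX 0) ++ [:: lA 0].
Definition bubs (ks : seq nat) : seq layer := flatten [seq bub k | k <- ks].

Lemma bub_dims k M : valid M (bub k) /\ nxts M (bub k) = M.
Proof.
rewrite /bub /= /fits /nxt /= subn0.
elim: k => [|k [v e]] /=; first by rewrite /fits /nxt /=; split; lia.
by rewrite /fits /nxt /= (_ : M + 2 - 1 + 1 = M + 2) ?v ?e; [split; lia | lia].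
Qed.

Lemma bubs_cons k ks : bubs (k :: ks) = bub k ++ bubs ks. Proof. by []. Qed.

Lemma bubs_dims ks M : valid M (bubs ks) /\ nxts M (bubs ks) = M.
Proof.
elim: ks => [|k ks [v e]] //; rewrite bubs_cons.
by have [v' e'] := bub_dims k M; rewrite valid_cat nxts_cat v' e'.
Qed.

(** Closed pictures on the left commute with everything. *)
Lemma closed_comm c l : valid 0 c -> nxts 0 c = 0 -> c ++ l ~> l ++ c.
Proof.
move=> v0 e0; split=> M.
have v N : valid N c by rewrite -[N]add0n valid_wide.
have e N : nxts N c = N by rewrite -{1}[N]add0n nxts_wide // e0.
rewrite !valid_cat !nxts_cat !e !v andbT /= => vl; split=> // K.
rewrite !run_cat ?v ?e //.
have rc N : run K N c = mtens (run K 0 c) (mid K N).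
  by rewrite -{1}[N]add0n run_wide.
rewrite (rc M) (rc (nxts M l)).
set D := run K 0 c; set R := run K M l.
have [Dd Dc] : mdom D = 0 /\ mcod D = 0 by rewrite run_dom ?run_cod ?e0.
have [Rd Rc] : mdom R = M /\ mcod R = nxts M l by rewrite run_dom ?run_cod.
transitivity (mtens D R).
  rewrite -[R in LHS]mtens0l -minterchange ?Rd ?Dc //.
  by rewrite mcomp1l ?mcomp1r.
rewrite -[R in RHS]mtens0l -minterchange ?Rc ?Dd //.
by rewrite mcomp1l ?mcomp1r.
Qed.

Lemma bub_comm k l : bub k ++ l ~> l ++ bub k.
Proof. by have [] := bub_dims k 0; apply: closed_comm. Qed.

Lemma bubs_comm ks l : bubs ks ++ l ~> l ++ bubs ks.
Proof. by have [] := bubs_dims ks 0; apply: closed_comm. Qed.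

Lemma nf_U mu M p : vnf (M + 2) mu -> p <= M ->
  exists mu' b, vnf M mu' /\ lU p :: nf mu ~> nf mu' ++ bubs (nseq b 0).
Proof.
elim: mu M p => [|j mu IH] M p /=; first lia.
rewrite addnK; case/andP=> hj v hp; case: p hp => [|p] hp.
- case: j hj => [//|[|j]] hj.
    exists mu, 1; split=> //; exact: (bub_comm 0 (nf mu)).
  have [||mu' v' r] := @nf_Ss mu M (mv 0 j) _ _ v.
  + by rewrite all_map; apply/allP.
  + by apply: valid_mv; lia.
  exists mu', 0; split=> //; rewrite cats0.
  exact: red_trans (red_catr (nf mu) (U0_capw j)) r.
- have end_case : p < M -> exists (mu' : seq nat) (b : nat), vnf M mu' /\
    lU p.+1 :: nf (p.+1 :: mu) ~> nf mu' ++ bubs (nseq b 0).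
    move=> hpM.
    have [||mu' v' r] := @nf_Ss mu M [seq lS i | i <- iota 0 p] _ _ v.
    + by rewrite all_map; apply/allP.
    + elim: p {hp} hpM => // p IHp hpM; rewrite iota0S map_cat valid_cat.
      rewrite IHp; last lia.
      suff -> : nxts M [seq lS i | i <- iota 0 p] = M by rewrite /= /fits /=; lia.
      have : p < M by lia.
      elim: p {hpM IHp} => // p IHp hpM.
      by rewrite iota0S map_cat nxts_cat IHp /= /nxt /=; lia.
    exists mu', 0; split=> //; rewrite cats0.
    exact: red_trans (red_catr (nf mu) (U_capw_end p)) r.
  case: (ltngtP j p.+1) => hjp.
  + have [||mu' [b [v' r]]] := IH (M - 2) p.+1.-2.
    * by rewrite subnK //; lia.
    * lia.
    exists (j :: mu'), b; split; first by rewrite /= v'; lia.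
    apply: red_trans (red_catr (nf mu) (U_capw_lo _)) _ => //; first lia.
    by rewrite -catA /nf /= -catA; apply: red_catl.
  + case: (ltngtP j p.+2) => hjp'; first lia.
      case: j hj hjp hjp' => [|[|j]] hj hjp hjp'; [lia|lia|].
      have [||mu' [b [v' r]]] := IH (M - 2) p.
      * by rewrite subnK //; lia.
      * lia.
      exists (j :: mu'), b; split; first by rewrite /= v'; lia.
      apply: red_trans (red_catr (nf mu) (U_capw_hi _)) _; first lia.
      by rewrite -catA /nf /= -catA; apply: red_catl.
    have [|mu' [b [v' r]]] := end_case; first lia.
    exists mu', b; split=> //; apply: red_trans _ r.
    rewrite hjp' /nf /= capwS.
    exact: (red_at (a := [::]) (b := capw p.+1 ++ nf mu) (red_US _) (red_refl _)).
  + by rewrite hjp; apply: end_case; lia.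
Qed.

Lemma bubs_cat ks ks' : bubs (ks ++ ks') = bubs ks ++ bubs ks'.
Proof. by rewrite /bubs map_cat flatten_cat. Qed.

(** Straightening: without dots, every word with no top endpoints is a standard
    word for a matching together with undotted bubbles. *)
Lemma straighten l M : all (fun x => ~~ isX x.1) l -> valid M l -> nxts M l = 0 ->
  exists mu b, vnf M mu /\ l ~> nf mu ++ bubs (nseq b 0).
Proof.
elim: l M => [|[g p] l IH] M /=.
  by move=> _ _ ->; exists [::], 0; split=> //; apply: red_refl.
case/andP=> gX al /andP[h v] e; have [mu [b [vm r]]] := IH _ al v e.
have {}r := red_cons (g, p) r.
rewrite /fits /nxt /= in h vm; case: g h gX r vm {v e} => //= h _ r vm.
- rewrite subn0 in vm; rewrite addn0 in h.
  have [mu' [b' [v' r']]] := nf_U vm h.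
  exists mu', (b' + b); split=> //; rewrite nseqD bubs_cat catA.
  exact: red_trans r (red_catr (bubs (nseq b 0)) r').
- rewrite addn0 in vm; have [|mu' v' r'] := @nf_A mu (M - 2) p vm; first lia.
  exists mu', b; rewrite subnK in v'; last lia.
  by split=> //; apply: red_trans r (red_catr (bubs (nseq b 0)) r').
- rewrite subnK in vm; last lia.
  have [|mu' v' r'] := @nf_S mu M p vm; first lia.
  by exists mu', b; split=> //; apply: red_trans r (red_catr (bubs (nseq b 0)) r').
Qed.

(** * Moving dots, up to words with fewer dots *)

Definition dots (l : seq layer) : nat := count (fun x => isX x.1) l.

Lemma dots_cat a b : dots (a ++ b) = dots a + dots b.
Proof. exact: count_cat. Qed.

Lemma dots_shift k l : dots (shift k l) = dots l.
Proof. by rewrite /dots /shift count_map. Qed.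

Section Slides.
Context (K : comPzRingType).
Local Notation mor := (mor K).
Local Notation H := (ABHom K).

Lemma run_val M s l : valid M l -> nxts M l = s -> exists x : H M s, Mor x = run K M l.
Proof.
move=> v <-; have [d dE] := word_exists v.
by exists (hom_of K d); rewrite run_layers dE.
Qed.

(** Linear combinations of words with property P. *)
Inductive inspan (P : seq layer -> Prop) M s : H M s -> Prop :=
| inspan0 : inspan P 0%R
| inspanDZ c x y l : P l -> valid M l -> Mor x = run K M l -> inspan P y ->
    inspan P (c *: x + y)%R.

Lemma inspan_gen (P : seq layer -> Prop) M s (x : H M s) l :
  P l -> valid M l -> Mor x = run K M l -> inspan P x.
Proof.
move=> Pl v e; rewrite -[x]addr0 -[x]scale1r.
exact: inspanDZ Pl v e (inspan0 _ _ _).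
Qed.

Lemma inspanD P M s (x y : H M s) : inspan P x -> inspan P y -> inspan P (x + y)%R.
Proof.
move=> hx hy; elim: hx => [|c x0 z l Pl v e _ IH]; first by rewrite add0r.
by rewrite -addrA; apply: inspanDZ Pl v e IH.
Qed.

Lemma inspanZ P M s c (x : H M s) : inspan P x -> inspan P (c *: x)%R.
Proof.
elim=> [|c' x0 z l Pl v e _ IH]; first by rewrite scaler0; apply: inspan0.
by rewrite scalerDr scalerA; apply: inspanDZ Pl v e IH.
Qed.

Lemma inspan_bind P Q M s (x : H M s) : inspan P x ->
    (forall l (y : H M s), P l -> valid M l -> Mor y = run K M l -> inspan Q y) ->
  inspan Q x.
Proof.
move=> hx hPQ; elim: hx => [|c x0 z l Pl v e _ IH]; first exact: inspan0.
by apply: inspanD IH; apply/inspanZ/(hPQ l).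
Qed.

(** [slides b l l']: the word l' represents (-1)^b times the same morphism as
    l, up to a combination of words with fewer dots. *)
Definition sgn (b : bool) : K := ((-1) ^+ b)%R.

Definition close (q : nat) (b : bool) M (l l' : seq layer) : Prop :=
  forall s (x y : H M s), Mor x = run K M l -> Mor y = run K M l' ->
    inspan (fun l0 => dots l0 < q) (x - sgn b *: y)%R.

Variant slides (b : bool) (l l' : seq layer) : Prop :=
  Slides of dots l' = dots l & forall M, valid M l ->
    [/\ valid M l', nxts M l = nxts M l' & close (dots l) b M l l'].

Lemma slides_dots b l l' : slides b l l' -> dots l' = dots l.
Proof. by case. Qed.

Lemma slidesP b l l' M : slides b l l' -> valid M l ->
  [/\ valid M l', nxts M l = nxts M l' & close (dots l) b M l l'].
Proof. by case=> _ h; apply: h. Qed.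

Lemma red_slides l l' : dots l' = dots l -> l ~> l' -> slides false l l'.
Proof.
move=> d r; split=> // M v; have [v' e rr] := redP r v; split=> // s x y ex ey.
rewrite (Mor_inj (etrans ex (etrans (rr K) (esym ey)))) /sgn expr0 scale1r subrr.
exact: inspan0.
Qed.

Lemma slides_refl l : slides false l l.
Proof. by apply: red_slides; last exact: red_refl. Qed.

Lemma slides_trans b1 b2 l2 l1 l3 :
  slides b1 l1 l2 -> slides b2 l2 l3 -> slides (b1 (+) b2) l1 l3.
Proof.
move=> h1 h2; split; first by rewrite (slides_dots h2) (slides_dots h1).
move=> M v; have [v2 e2 c2] := slidesP h1 v; have [v3 e3 c3] := slidesP h2 v2.
split=> //; first by rewrite e2.
move=> s x z ex ez; have [y ey] : exists y : H M s, Mor y = run K M l2.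
  apply: run_val => //; rewrite -e2.
  by rewrite -(run_cod K v) -ex.
have -> : (x - sgn (b1 (+) b2) *: z = (x - sgn b1 *: y) + sgn b1 *: (y - sgn b2 *: z))%R.
  by rewrite scalerBr scalerA addrA subrK /sgn signr_addb.
apply: inspanD; first exact: c2 ex ey.
by rewrite -(slides_dots h1); apply: inspanZ; apply: c3 ey ez.
Qed.

Lemma inspan_ctx q a b M N N' s (xb : H N' s) (xa : H M N) (x : H N N') :
    valid M a -> Mor xa = run K M a -> valid N' b -> Mor xb = run K N' b ->
    inspan (fun l0 => dots l0 < q) x ->
  inspan (fun l0 => dots l0 < dots a + q + dots b) (hcomp (hcomp xb x) xa).
Proof.
move=> va ea vb eb.
have nN : nxts M a = N by rewrite -(run_cod K va) -ea.
elim=> [|c y z l dl v e _ IH]; first by rewrite hcomp0r hcomp0l; apply: inspan0.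
rewrite hcompDZr hcompDZl.
have nl : nxts N l = N' by rewrite -(run_cod K v) -e.
apply: (@inspanDZ _ _ _ _ _ _ (a ++ l ++ b)) => //; first by rewrite !dots_cat; lia.
- by rewrite !valid_cat va nN v nl.
- by rewrite !run_cat ?valid_cat ?nN ?v ?nl ?va // -eb -e -ea !mcompE.
Qed.

Lemma run_val_cod M s l (x : H M s) : valid M l -> Mor x = run K M l -> nxts M l = s.
Proof. by move=> v e; rewrite -(run_cod K v) -e. Qed.

Lemma slides_ctx u w b l l' : slides b l l' -> slides b (u ++ l ++ w) (u ++ l' ++ w).
Proof.
move=> h; have hd := slides_dots h; split; first by rewrite !dots_cat hd.
move=> M vM; have := vM; rewrite !valid_cat => /and3P[vu vl vw].
have [v' e c] := slidesP h vl; rewrite !nxts_cat -e vu v' vw; split=> //.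
move=> s x y ex ey; have := run_val_cod vM ex; rewrite !nxts_cat => ns.
have [xu eu] := run_val vu (erefl _).
have [xl el] := run_val vl (erefl _).
have [xl' el'] := run_val v' (esym e).
have [xw ew] := run_val vw ns.
move: ex ey; rewrite !run_cat ?valid_cat ?vu ?vl ?v' ?vw -?e //.
rewrite -eu -el -el' -ew !mcompE => /Mor_inj -> /Mor_inj ->.
have /(inspan_ctx vu eu vw ew) := c _ _ _ el el'.
rewrite -[(xl - _)%R]addrC -scaleNr hcompDZr hcompDZl scaleNr addrC.
by rewrite !dots_cat addnA.
Qed.

Lemma slides_catl u b l l' : slides b l l' -> slides b (u ++ l) (u ++ l').
Proof. by move=> /(slides_ctx u [::]); rewrite !cats0. Qed.

Lemma slides_catr w b l l' : slides b l l' -> slides b (l ++ w) (l' ++ w).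
Proof. exact: (slides_ctx [::] w). Qed.

Lemma slides_cons x b l l' : slides b l l' -> slides b (x :: l) (x :: l').
Proof. exact: (slides_catl [:: x]). Qed.

Lemma slides_sym b l l' : slides b l l' ->
  (forall M, valid M l' -> valid M l) -> slides b l' l.
Proof.
move=> h hv; split=> [|M v']; first by rewrite (slides_dots h).
have v := hv M v'; have [_ e c] := slidesP h v; split=> // s y x ey ex.
have := inspanZ (- sgn b)%R (c _ _ _ ex ey).
rewrite scalerBr !scaleNr opprK scalerA /sgn -signr_addb addbb expr0 scale1r.
by rewrite addrC (slides_dots h).
Qed.

(** Placing a relation into a larger picture. *)
Lemma inspan_local q p m s k (x : H m s) (z : H (p + (m + k)) (p + (s + k))) :
    inspan (fun l0 => dots l0 < q) x ->
    Mor z = mtens (mid K p) (mtens (Mor x) (mid K k)) ->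
  inspan (fun l0 => dots l0 < q) z.
Proof.
rewrite !mtensE => + /Mor_inj ->; elim=> [|c y t l dl v e _ IH].
  by rewrite /= htens0l htens0r; apply: inspan0.
rewrite /= htensDZl htensDZr; apply: (@inspanDZ _ _ _ _ _ _ (shift p l)) => //.
- by rewrite dots_shift.
- by rewrite valid_shift // valid_wide.
- by rewrite run_shift ?valid_wide // run_wide // -e.
Qed.

Lemma slides_local b m p l l' :
    valid m l -> valid m l' -> nxts m l = nxts m l' -> dots l' = dots l ->
    close (dots l) b m l l' ->
    (forall M, valid M (shift p l) -> p + m <= M) ->
  slides b (shift p l) (shift p l').
Proof.
move=> v v' e d c hv; split=> [|M vM]; first by rewrite !dots_shift.
have [k ME] : exists k, M = p + (m + k).
  by exists (M - (p + m)); rewrite addnA subnKC ?hv.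
subst M.
rewrite !nxts_shift ?(valid_wide _ v) ?(valid_wide _ v') // !nxts_wide // e.
rewrite valid_shift ?valid_wide //; split=> // s x y ex ey.
have := run_val_cod vM ex; rewrite nxts_shift ?valid_wide // nxts_wide // => se.
subst s; rewrite dots_shift.
have [xl el] := run_val v (erefl _).
have [xl' el'] := run_val v' (esym e).
apply: (inspan_local (c _ _ _ el el')).
move: ex ey; rewrite !run_shift ?valid_wide // !run_wide // -el -el' !mtensE.
move=> /Mor_inj -> /Mor_inj ->; congr Mor.
rewrite addrC -scaleNr /= -htensDZr; congr htens.
by rewrite -htensDZl addrC scaleNr.
Qed.

Lemma closeN M l l' :
    (forall s (x y : H M s), Mor x = run K M l -> Mor y = run K M l' -> x = (- y)%R) ->
  forall q, close q true M l l'.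
Proof.
move=> h q s x y ex ey; rewrite (h _ _ _ ex ey) /sgn expr1 scaleN1r subrr.
exact: inspan0.
Qed.

Lemma slides_SX p : slides false [:: lS p; lX p] [:: lX p.+1; lS p].
Proof.
have : slides false (shift p [:: lS 0; lX 0]) (shift p [:: lX 1; lS 0]).
  apply: (@slides_local _ 2) => //; last by move=> M /=; rewrite /fits /nxt /=; lia.
  move=> s x y ex ey; have se : s = 2 by rewrite -(run_val_cod (erefl : valid 2 [:: lS 0; lX 0]) ex).
  subst s.
  rewrite (_ : (x - _)%R = (1 *: \pi_(H 2 2) (tcomp (tU K) (tA K))
                     + ((-1) *: \pi_(H 2 2) (tId K 2) + 0))%R).
    apply: (@inspanDZ _ _ _ _ _ _ [:: lA 0; lU 0]) => //; first by run_small.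
    apply: (@inspanDZ _ _ _ _ _ _ [::]) => //; exact: inspan0.
  rewrite addr0 -!hpi_scale -hpi_add.
  have -> : x = \pi_(H 2 2) (tcomp (ttens (tX K) (tId K 1)) (tS K)).
    by apply: Mor_inj; rewrite ex; run_small.
  have -> : y = \pi_(H 2 2) (tcomp (tS K) (ttens (tId K 1) (tX K))).
    by apply: Mor_inj; rewrite ey; run_small.
  rewrite /sgn expr0 scale1r -scaleN1r -hpi_scale -hpi_add; apply/Hom_eqP.
  apply: eqv_trans (rel_XS K) _; apply: eqv_add; last exact: eqv_refl.
  exact/eqv_sym/eqv_scale1.
by rewrite /shift /= addn0 addn1.
Qed.

Lemma slides_rotate1 p : slides true [:: lU p; lX p.+1; lA p.+1] [:: lX p].
Proof.
have : slides true (shift p [:: lU 0; lX 1; lA 1]) (shift p [:: lX 0]).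
  apply: (@slides_local _ 1) => //; last by move=> M /=; rewrite /fits /nxt /=; lia.
  apply: closeN => s x y ex ey.
  have se : s = 1 by rewrite -(run_val_cod (erefl : valid 1 [:: lX 0]) ey).
  subst s.
  have -> : y = \pi_(H 1 1) (tX K) by apply: Mor_inj; rewrite ey; run_small.
  have -> : x = \pi_(H 1 1) (tcomp (tcomp (ttens (tId K 1) (tA K))
      (ttens (ttens (tId K 1) (tX K)) (tId K 1))) (ttens (tU K) (tId K 1))).
    apply: Mor_inj; rewrite ex /run /nxt /lay /= ?mtens0l ?mtens0r ?mcomp1l // mtensA.
    by rewrite /mid /genmor ?mtensE ?htensE ?mcompE ?hcompE.
  rewrite -scaleN1r -hpi_scale; apply/Hom_eqP; exact: rel_X_rotate1.
by rewrite /shift /= addn0 addn1.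
Qed.

Lemma slides_rotate2 p : slides true [:: lU p.+1; lX p.+1; lA p] [:: lX p].
Proof.
have : slides true (shift p [:: lU 1; lX 1; lA 0]) (shift p [:: lX 0]).
  apply: (@slides_local _ 1) => //; last by move=> M /=; rewrite /fits /nxt /=; lia.
  apply: closeN => s x y ex ey.
  have se : s = 1 by rewrite -(run_val_cod (erefl : valid 1 [:: lX 0]) ey).
  subst s.
  have -> : y = \pi_(H 1 1) (tX K) by apply: Mor_inj; rewrite ey; run_small.
  have -> : x = \pi_(H 1 1) (tcomp (tcomp (ttens (tA K) (tId K 1))
      (ttens (ttens (tId K 1) (tX K)) (tId K 1))) (ttens (tId K 1) (tU K))).
    apply: Mor_inj; rewrite ex /run /nxt /lay /= ?mtens0l ?mtens0r ?mcomp1l // mtensA.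
    by rewrite /mid /genmor ?mtensE ?htensE ?mcompE ?hcompE.
  rewrite -scaleN1r -hpi_scale; apply/Hom_eqP; exact: rel_X_rotate2.
by rewrite /shift /= addn0 addn1.
Qed.

End Slides.

(** * Moving dots, up to words with fewer dots *)
(*BEGIN*)
Definition xs (w : seq nat) : seq layer := [seq lX i | i <- w].

Lemma xs_cat w w' : xs (w ++ w') = xs w ++ xs w'. Proof. exact: map_cat. Qed.

Lemma dots_xs w : dots (xs w) = size w.
Proof. by rewrite /dots /xs count_map -size_filter filter_predT. Qed.

Lemma far_hX h p q : p < q -> [:: (h, q); lX p] ~> [:: lX p; (h, q)].
Proof.
move=> pq; have := @red_far gX h p q; rewrite /= subnK ?addn1; last lia.
exact.
Qed.

Lemma far_Xh h p q : p < q -> [:: lX p; (h, q)] ~> [:: (h, q); lX p].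
Proof.
move=> pq; have := @red_far' gX h p q; rewrite /= subnK ?addn1; last lia.
exact.
Qed.

Lemma far_gX g p i : p <= i -> [:: (g, p); lX (i + gcod g)] ~> [:: lX (i + gdom g); (g, p)].
Proof.
by move=> h; have := @red_far' g gX p (i + gcod g); rewrite addnK; apply; lia.
Qed.

Lemma far_Xg g p i : p <= i -> [:: lX (i + gdom g); (g, p)] ~> [:: (g, p); lX (i + gcod g)].
Proof.
by move=> h; have := @red_far g gX p (i + gdom g); rewrite addnK; apply; lia.
Qed.

Lemma red_XX i j : [:: lX i; lX j] ~> [:: lX j; lX i].
Proof.
case: (ltngtP i j) => h; first exact: far_Xh.
- exact: far_hX.
- by rewrite h; apply: red_refl.
Qed.

Lemma xs_rcons i w : lX i :: xs w ~> xs w ++ [:: lX i].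
Proof.
elim: w => [|j w IH]; first exact: red_refl.
apply: (red_at (a := [::]) (b := xs w) (red_XX i j)).
exact: (red_cons (lX j) IH).
Qed.

Lemma xs_rconsV i w : xs w ++ [:: lX i] ~> lX i :: xs w.
Proof.
elim: w => [|j w IH]; first exact: red_refl.
apply: red_trans (red_cons _ IH) _.
exact: (red_at (a := [::]) (b := xs w) (red_XX j i) (red_refl _)).
Qed.

Lemma xs_perm w w' : perm_eq w w' -> xs w ~> xs w'.
Proof.
elim: w w' => [|i w IH] w' pw.
  by move/perm_size/esym/size0nil: pw => ->; apply: red_refl.
have iw : i \in w' by rewrite -(perm_mem pw) mem_head.
case/splitPr: w' / iw pw => w1 w2 pw.
have {pw} pw : perm_eq w (w1 ++ w2).
  by rewrite -(perm_cons i) (permPl pw) perm_sym -cat1s perm_catCA.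
apply: red_trans (red_cons (lX i) (IH _ pw)) _.
rewrite !xs_cat; apply: red_trans (red_catr (xs w2) (xs_rcons i w1)) _.
by rewrite -catA; apply: red_refl.
Qed.

Definition sw (p i : nat) : nat :=
  if i == p then p.+1 else if i == p.+1 then p else i.

Definition up2 (p i : nat) : nat := if i < p then i else i.+2.
Definition dn2 (p i : nat) : nat := if i < p then i else i - 2.

Lemma A_xs p w : lA p :: xs w ~> xs (map (up2 p) w) ++ [:: lA p].
Proof.
elim: w => [|i w IH]; first exact: red_refl.
apply: red_trans (red_cons (lX (up2 p i)) IH).
rewrite /up2; case: ltnP => h.
- exact: (red_at (a := [::]) (b := xs w) (far_hX gA h) (red_refl _)).
- have := far_gX gA h; rewrite /= addn0 addn2 => r.
  exact: (red_at (a := [::]) (b := xs w) r (red_refl _)).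
Qed.

Lemma U_xs p w : all (fun i => (i != p) && (i != p.+1)) w ->
  lU p :: xs w ~> xs (map (dn2 p) w) ++ [:: lU p].
Proof.
elim: w => [|i w IH] /=; first by move=> _; exact: red_refl.
case/andP=> /andP[h1 h2] /IH{}IH.
apply: red_trans (red_cons (lX (dn2 p i)) IH).
rewrite /dn2; case: ltnP => h.
- exact: (red_at (a := [::]) (b := xs w) (far_hX gU h) (red_refl _)).
- have /(far_gX gU) : p <= i - 2 by lia.
  rewrite /= addn0 subnK; last lia.
  by move=> r; exact: (red_at (a := [::]) (b := xs w) r (red_refl _)).
Qed.

(** The partner of the point i in the matching coded by mu. *)
Fixpoint prt (mu : seq nat) (i : nat) : nat :=
  if mu is j :: mu' then
    if i == 0 then j else if i == j then 0
    else let k := prt mu' (if i < j then i - 1 else i - 2) in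
         if k.+1 < j then k.+1 else k.+2
  else 0.

Lemma prt_lt M mu i : vnf M mu -> i < M -> prt mu i < M.
Proof.
elim: mu M i => [|j mu IH] M i /=; first lia.
case/andP=> hj v hi; case: ifP => [_|/negbT i0]; first lia.
case: ifP => [_|/negbT ij]; first lia.
set u := if i < j then i - 1 else i - 2.
have uM : u < M - 2 by rewrite /u; case: ifP; lia.
by have := IH _ _ v uM; set k := prt mu u; case: ifP; lia.
Qed.

Lemma prt_neq M mu i : vnf M mu -> i < M -> prt mu i != i.
Proof.
elim: mu M i => [|j mu IH] M i /=; first lia.
case/andP=> hj v hi; case: ifP => [/eqP->|/negbT i0]; first lia.
case: ifP => [/eqP->|/negbT ij]; first lia.
set u := if i < j then i - 1 else i - 2.
have uM : u < M - 2 by rewrite /u; case: ifP; lia.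
have := IH _ _ v uM; set k := prt mu u.
by rewrite /u; case: (ltnP i j) => h; case: ifP; lia.
Qed.

Lemma prtK M mu i : vnf M mu -> i < M -> prt mu (prt mu i) = i.
Proof.
elim: mu M i => [|j mu IH] M i /=; first lia.
case/andP=> hj v hi; case: (eqVneq i 0) => [->|i0].
  by rewrite eqxx; case: eqP; lia.
case: (eqVneq i j) => [->|ij]; first by rewrite eqxx.
have [u uE] : exists u, (if i < j then i - 1 else i - 2) = u by eexists.
rewrite uE; have uM : u < M - 2 by rewrite -uE; case: ifP; lia.
have := IH _ _ v uM; move: (prt mu u) => k kK.
case: (ltnP k.+1 j) => h.
- have -> : (k.+1 == j) = false by lia.
  rewrite /= h subn1 /= kK -uE; case: (ltnP i j) => h'; case: ifP; lia.
- have -> : (k.+2 == j) = false by lia.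
  have -> : (k.+2 < j) = false by lia.
  rewrite /= subn2 /= kK -uE; case: (ltnP i j) => h'; case: ifP; lia.
Qed.

Section Slides.
Context (K : comPzRingType).
Local Notation slides := (slides K).

Lemma slides_at b1 b2 a b x y r : slides b1 x y -> slides b2 (a ++ y ++ b) r ->
  slides (b1 (+) b2) (a ++ x ++ b) r.
Proof. by move=> /(slides_ctx a b); apply: slides_trans. Qed.

Lemma red_slides_trans b l l1 l2 : l ~> l1 -> dots l1 = dots l -> slides b l1 l2 ->
  slides b l l2.
Proof. by move=> r d; have := red_slides K d r; apply: slides_trans. Qed.

Lemma slides_red_trans b l l1 l2 : slides b l l1 -> dots l2 = dots l1 -> l1 ~> l2 ->
  slides b l l2.
Proof.
by move=> s d r; have := slides_trans s (red_slides K d r); rewrite addbF.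
Qed.

Lemma slides_XS p : slides false [:: lX p; lS p] [:: lS p; lX p.+1].
Proof.
apply: (@red_slides_trans _ _ [:: lS p; lS p; lX p; lS p]) => //.
  apply: (@red_sym [:: lS p; lS p; lX p; lS p] [:: lX p; lS p]).
    exact: (red_at (a := [::]) (b := [:: lX p; lS p]) (red_SS p) (red_refl _)).
  by move=> M /=; rewrite /fits /nxt /=; lia.
apply: (slides_at (b1 := false) (a := [:: lS p]) (b := [:: lS p]) (slides_SX _ p)).
apply: red_slides => //.
exact: (red_at (a := [:: lS p; lX p.+1]) (b := [::]) (red_SS p) (red_refl _)).
Qed.

Lemma slides_XS1 p : slides false [:: lX p.+1; lS p] [:: lS p; lX p].
Proof.
by apply: slides_sym (slides_SX _ p) _ => M /=; rewrite /fits /nxt /=; lia.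
Qed.

Lemma slides_SX1 p : slides false [:: lS p; lX p.+1] [:: lX p; lS p].
Proof.
by apply: slides_sym (slides_XS p) _ => M /=; rewrite /fits /nxt /=; lia.
Qed.

Lemma slides_SXi p i : slides false [:: lS p; lX i] [:: lX (sw p i); lS p].
Proof.
rewrite /sw; case: eqP => [->|h1]; first exact: slides_SX.
case: eqP => [->|h2]; first exact: slides_SX1.
apply: red_slides => //; case: (ltnP i p) => h; first exact: far_hX.
have /(far_gX gS) : p <= i - 2 by lia.
by rewrite /= subnK; last lia.
Qed.

Lemma slides_XiS p i : slides false [:: lX i; lS p] [:: lS p; lX (sw p i)].
Proof.
rewrite /sw; case: eqP => [->|h1]; first exact: slides_XS.
case: eqP => [->|h2]; first exact: slides_XS1.
apply: red_slides => //; case: (ltnP i p) => h; first exact: far_Xh.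
have /(far_Xg gS) : p <= i - 2 by lia.
by rewrite /= subnK; last lia.
Qed.

Lemma slides_Sxs p w : slides false (lS p :: xs w) (xs (map (sw p) w) ++ [:: lS p]).
Proof.
elim: w => [|i w IH]; first exact: slides_refl.
apply: (slides_at (b1 := false) (a := [::]) (b := xs w) (slides_SXi p i)).
exact: (slides_cons (lX (sw p i)) IH).
Qed.

(** Where the strand at position i ends up under [mv a j]. *)
Definition mvpos (a j i : nat) : nat :=
  if i == j then a else if a <= i < j then i.+1 else i.

Lemma slides_Xmv a j i : a <= j ->
  slides false (lX i :: mv a j) (mv a j ++ [:: lX (mvpos a j i)]).
Proof.
elim: j i => [|j IH] i.
  rewrite leqn0 => /eqP->; rewrite mv_nil //.
  have -> : mvpos 0 0 i = i by rewrite /mvpos; case: eqP => [->|_] //; case: ifP; lia.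
  exact: slides_refl.
rewrite leq_eqVlt ltnS => /predU1P[->|aj].
  rewrite mvnn /mvpos (_ : (j < i < j.+1) = false); last lia.
  by case: eqP => [->|_]; apply: slides_refl.
rewrite mvS //.
apply: (slides_at (b1 := false) (a := [::]) (b := mv a j) (slides_XiS j i)).
rewrite (_ : mvpos a j.+1 i = mvpos a j (sw j i)).
  exact: (slides_cons (lS j) (IH _ aj)).
rewrite /mvpos /sw; case: (eqVneq i j) => [->|h1].
  have -> : (j == j.+1) = false by lia.
  have -> : (j.+1 == j) = false by lia.
  by case: ifP; case: ifP; lia.
case: (eqVneq i j.+1) => [_|h2]; first by rewrite /= eqxx.
by rewrite /= (negbTE h1); case: ifP => h3; case: ifP => h4 //; lia.
Qed.

Lemma slides_XA p : slides true [:: lX p; lA p] [:: lX p.+1; lA p].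
Proof.
have h : slides true ([:: lX p] ++ [:: lA p]) ([:: lU p.+1; lX p.+1; lA p] ++ [:: lA p]).
  apply/slides_catr/slides_sym; first exact: slides_rotate2.
  by move=> M /=; rewrite /fits /nxt /=; lia.
apply: slides_red_trans h _ _ => //.
apply: (red_at (a := [:: lU p.+1; lX p.+1]) (b := [::]) (far_AA' (leqnn p))).
apply: (red_at (a := [:: lU p.+1]) (b := [:: lA p]) (far_Xh gA (ltnSn p.+1))).
exact: (red_at (a := [::]) (b := [:: lX p.+1; lA p]) (red_zigzag1 p.+1) (red_refl _)).
Qed.

Lemma slides_UX p : slides true [:: lU p; lX p] [:: lU p; lX p.+1].
Proof.
have h : slides true ([:: lU p] ++ [:: lX p]) ([:: lU p] ++ [:: lU p; lX p.+1; lA p.+1]).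
  apply/slides_catl/slides_sym; first exact: slides_rotate1.
  by move=> M /=; rewrite /fits /nxt /=; lia.
apply: slides_red_trans h _ _ => //.
have UU : [:: lU p; lU p] ~> [:: lU p; lU p.+2].
  apply: (@red_sym [:: lU p; lU p.+2]); last first.
    by move=> M /=; rewrite /fits /nxt /=; lia.
  have := @red_far' gU gU p p.+2; rewrite /= subn2 addn0; apply; lia.
apply: (red_at (a := [::]) (b := [:: lX p.+1; lA p.+1]) UU).
apply: (red_at (a := [:: lU p]) (b := [:: lA p.+1]) (far_hX gU (ltnSn p.+1))).
exact: (red_at (a := [:: lU p; lX p.+1]) (b := [::]) (red_zigzag2 p.+1) (red_refl _)).
Qed.

Lemma slides_X0_capw j : 0 < j -> slides true (lX 0 :: capw j) (lX j :: capw j).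
Proof.
move=> j0; rewrite /capw.
have h0 : slides false (lX 0 :: mv 1 j ++ [:: lA 0]) (mv 1 j ++ [:: lX 0; lA 0]).
  have := slides_catr [:: lA 0] (slides_Xmv 0 j0).
  by rewrite -catA /mvpos /= (_ : (0 == j) = false) //; lia.
have h1 : slides false (lX j :: mv 1 j ++ [:: lA 0]) (mv 1 j ++ [:: lX 1; lA 0]).
  by have := slides_catr [:: lA 0] (slides_Xmv j j0); rewrite -catA /mvpos eqxx.
apply: (slides_trans (b1 := false) (b2 := true) h0).
apply: (slides_trans (b1 := true) (b2 := false)).
  exact: (slides_catl (mv 1 j) (slides_XA 0)).
apply: slides_sym h1 _ => M; rewrite valid_cat => /andP[v].
rewrite nxts_mv //= /fits /nxt /= => hM.
have vc : valid M (capw j) by rewrite valid_cat v nxts_mv //= /fits /=; lia.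
have jM := valid_capw_inv vc.
by rewrite -/(capw j) subnK ?vc; lia.
Qed.

Lemma slides_X_capw i j : i != 0 -> i != j -> 0 < j ->
  slides false (lX i :: capw j) (capw j ++ [:: lX (if i < j then i - 1 else i - 2)]).
Proof.
move=> i0 ij j0; rewrite /capw.
have := slides_catr [:: lA 0] (slides_Xmv i j0); rewrite -!catA => h.
apply: (slides_red_trans h); first by rewrite !dots_cat.
apply: red_catl; rewrite /mvpos (negbTE ij).
set k := if _ : bool then i - 1 else i - 2.
have -> : (if 0 < i < j then i.+1 else i) = k + 2.
  by rewrite /k; case: (ltnP i j) => h'; case: ifP; lia.
by have := @far_Xg gA 0 k; rewrite /= addn0; apply.
Qed.

(** A dot moves from one end of a strand of a matching to the other end. *)
Lemma slides_nf M mu i : vnf M mu -> i < M ->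
  slides true (lX i :: nf mu) (lX (prt mu i) :: nf mu).
Proof.
elim: mu M i => [|j mu IH] M i /=; first lia.
case/andP=> hj v hi; rewrite /nf /= -/(nf mu).
have v0 := valid_capw hj; have n0 := nxts_capw hj.
have j0 : 0 < j by lia.
have back : slides true (lX 0 :: capw j ++ nf mu) (lX j :: capw j ++ nf mu).
  exact: (slides_catr (nf mu) (slides_X0_capw j0)).
case: eqP => [->|/eqP i0]; first exact: back.
case: eqP => [->|/eqP ij].
  apply: slides_sym back _ => N; rewrite /= => /andP[]; rewrite /fits /nxt /= => hN.
  rewrite subnK; last lia.
  move=> vN; rewrite vN andbT; move: vN; rewrite valid_cat => /andP[vc _].
  by have := valid_capw_inv vc; lia.
set k := if i < j then i - 1 else i - 2; set k' := prt mu k.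
have kM : k < M - 2 by rewrite /k; case: ifP; lia.
apply: (slides_trans (b1 := false) (b2 := true)).
  exact: (slides_catr (nf mu) (slides_X_capw i0 ij j0)).
rewrite -catA; apply: (slides_trans (b1 := true) (b2 := false)).
  exact: (slides_catl (capw j) (IH _ _ v kM)).
set i' := if _ then k'.+1 else k'.+2.
have i'0 : i' != 0 by rewrite /i'; case: ifP.
have i'j : i' != j by rewrite /i'; case: ifP; lia.
have := slides_catr (nf mu) (slides_X_capw i'0 i'j j0).
rewrite (_ : (if i' < j then i' - 1 else i' - 2) = k'); last first.
  by rewrite /i'; case: (ltnP k'.+1 j) => h; case: ifP; lia.
rewrite -catA => h; apply: slides_sym h _.
move=> N; rewrite /= valid_cat => /andP[vc].
have jN := valid_capw_inv vc.
have jN' : 0 < j < N by lia.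
rewrite nxts_capw //= /fits /nxt /= !addn1 => /andP[hk vr].
have {}vr : valid (N - 2) (nf mu) by rewrite (_ : N - 2 = (N - 2 - 1).+1) //; lia.
rewrite (_ : (N - 1).+1 = N); last lia.
rewrite valid_cat vc nxts_capw // vr.
rewrite andbT /i'; move: hk jN; clearbody k'; case: ifP => _; clear; lia.
Qed.

End Slides.

(** * Moving dots, up to words with fewer dots *)
(*BEGIN*)
(** * Spanning, for words without top endpoints *)

Lemma nf_pair M mu p : vnf M mu -> p.+1 < M -> prt mu p = p.+1 ->
  exists2 mu', vnf (M - 2) mu' & nf mu ~> lA p :: nf mu'.
Proof.
elim: mu M p => [|j mu IH] M p /=; first lia.
case/andP=> hj v hp; case: (eqVneq p 0) => [->|p0].
  by move=> ->; exists mu => //; apply: red_refl.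
case: (eqVneq p j) => [//|pj].
have [u uE] : exists u, (if p < j then p - 1 else p - 2) = u by eexists.
rewrite uE => hk.
have uM : u < M - 2 by rewrite -uE; case: ifP; lia.
have jp1 : j != p.+1.
  apply/eqP=> jE; move: hk; case: ifP => h; first lia.
  by have := prt_lt v uM; lia.
have ku : prt mu u = u.+1.
  by move: hk; rewrite -uE; case: (ltnP p j) => h; case: ifP; lia.
have [|mu' v' r] := IH (M - 2) u v _ ku.
  by have := prt_lt v uM; lia.
have uM4 : u.+1 < M - 2 by have := prt_lt v uM; lia.
case: (ltnP p j) uE => h uE.
- exists (j - 2 :: mu').
    by rewrite /= v'; lia.
  rewrite /nf /= -/(nf mu) -/(nf mu').
  apply: red_trans (red_catl _ r) _.
  change (lA u :: nf mu') with ([:: lA u] ++ nf mu'); rewrite catA.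
  apply: (@red_catr (nf mu') (capw j ++ [:: lA u]) (lA p :: capw (j - 2))).
  apply: (@red_sym (lA p :: capw (j - 2))).
    have := @A_capw_hi p (j - 2); rewrite -subn1 uE (_ : (j - 2).+2 = j); last lia.
    by apply; lia.
  move=> N; rewrite valid_cat => /andP[vc].
  have jN := valid_capw_inv vc; rewrite nxts_capw; last lia.
  rewrite /= /fits /nxt /= andbT addn0 => hA.
  by rewrite valid_capw; lia.
- exists (j :: mu'); first by rewrite /= v'; lia.
  rewrite /nf /= -/(nf mu) -/(nf mu').
  apply: red_trans (red_catl _ r) _.
  change (lA u :: nf mu') with ([:: lA u] ++ nf mu'); rewrite catA.
  apply: (@red_catr (nf mu') (capw j ++ [:: lA u]) (lA p :: capw j)).
  apply: (@red_sym (lA p :: capw j)).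
    by have := @A_capw_lo p j; rewrite -subn2 uE; apply; lia.
  move=> N; rewrite valid_cat => /andP[vc].
  have jN := valid_capw_inv vc; rewrite nxts_capw; last lia.
  rewrite /= /fits /nxt /= andbT addn0 => hA.
  by rewrite valid_capw; lia.
Qed.

Lemma xs_nseq k p : nseq k (lX p) = xs (nseq k p).
Proof. by rewrite /xs map_nseq. Qed.

Lemma dots_cons x l : dots (x :: l) = isX x.1 + dots l. Proof. by []. Qed.
Lemma dots_nil : dots [::] = 0. Proof. by []. Qed.

Lemma dots_mv a j : dots (mv a j) = 0.
Proof. by rewrite /dots /mv count_map; apply/eqP; rewrite -leqn0 leqNgt -has_count; apply/hasPn. Qed.

Lemma dots_nf mu : dots (nf mu) = 0.
Proof.
elim: mu => //= j mu IH; rewrite /nf /= -/(nf mu) dots_cat IH /capw dots_cat dots_mv.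
by [].
Qed.

Lemma dots_bubs ks : dots (bubs ks) = sumn ks.
Proof.
elim: ks => // k ks IH; rewrite bubs_cons dots_cat IH [RHS]/=; congr addn.
by rewrite /bub xs_nseq !(dots_cat, dots_cons, dots_nil) dots_xs size_nseq /=; lia.
Qed.

Definition dotsE :=
  (dots_cat, dots_cons, dots_nil, dots_xs, dots_nf, dots_bubs, size_map, size_nseq).

Lemma valid_xs M w : all (fun i => i < M) w -> valid M (xs w) /\ nxts M (xs w) = M.
Proof.
elim: w => //= i w IH /andP[h /IH[v e]]; rewrite /fits /nxt /= subnK ?v ?e; last lia.
by split; lia.
Qed.

Lemma valid_xs_inv M w : valid M (xs w) -> all (fun i => i < M) w.
Proof.
elim: w => //= i w IH /andP[]; rewrite /fits /nxt /= => h.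
by rewrite subnK; last lia; move/IH->; lia.
Qed.

Section Spanning.
Context (K : comPzRingType).
Local Notation slides := (slides K).
Local Notation H := (ABHom K).

Lemma bub_right p k :
  slides false (lU p.+1 :: xs (nseq k p.+1) ++ [:: lA p.+1])
               (lU p :: xs (nseq k p) ++ [:: lA p]).
Proof.
set R := xs (nseq k p.+1) ++ [:: lA p.+1].
apply: (@red_slides_trans _ _ _ ([:: lU p.+1; lS p; lS p] ++ R)); [|by []|].
  apply: (@red_sym ([:: lU p.+1; lS p; lS p] ++ R)).
    exact: (red_at (a := [:: lU p.+1]) (b := R) (red_SS p) (red_refl _)).
  move=> M /= /andP[hf]; rewrite /fits /= in hf *; rewrite /nxt /= subn0 => vR.
  by rewrite !addnK vR; lia.
apply: (@red_slides_trans _ _ _ ([:: lU p; lS p.+1; lS p] ++ R)); [|by []|].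
  exact: (red_at (a := [::]) (b := lS p :: R) (red_US_slide p) (red_refl _)).
have mapsw : map (sw p) (nseq k p.+1) = nseq k p.
  by rewrite map_nseq /sw eqxx; case: eqP => //; lia.
have h1 := slides_ctx [:: lU p; lS p.+1] [:: lA p.+1] (slides_Sxs K p (nseq k p.+1)).
rewrite mapsw in h1; apply: (slides_trans (b1 := false) (b2 := false) h1).
have mapsw' : map (sw p.+1) (nseq k p) = nseq k p.
  by rewrite map_nseq /sw; case: eqP; [lia|]; case: eqP => //; lia.
have h2 := slides_ctx [:: lU p] [:: lS p; lA p.+1] (slides_Sxs K p.+1 (nseq k p)).
rewrite mapsw' in h2; rewrite -!catA in h2 *.
apply: (slides_trans (b1 := false) (b2 := false) h2).
apply: red_slides; first by rewrite !dotsE /=; lia.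
exact: (red_ctx (lU p :: xs (nseq k p)) [::] (red_SSA p)).
Qed.

Lemma bub_left p k : slides false (lU p :: xs (nseq k p) ++ [:: lA p]) (bub k).
Proof.
elim: p => [|p IH]; first by rewrite /bub xs_nseq; apply: slides_refl.
exact: (slides_trans (bub_right p k) IH).
Qed.

(** Rotating a bubble moves its dots to the other side, each with a sign. *)
Lemma bub_odd k : slides (odd k) (bub k) (bub k).
Proof.
have h1 : slides (odd k) (xs (nseq k 0) ++ [:: lA 0]) (xs (nseq k 1) ++ [:: lA 0]).
  elim: k => [|k IH]; first exact: slides_refl.
  have IH1 := slides_cons (lX 0) IH.
  rewrite [odd k.+1]/= -addbT; apply: (slides_trans IH1).
  apply: (@red_slides_trans _ _ _ (xs (nseq k 1) ++ [:: lX 0; lA 0])).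
  - by have := red_catr [:: lA 0] (xs_rcons 0 (nseq k 1)); rewrite -catA.
  - by rewrite !dotsE /=; lia.
  apply: (slides_red_trans (slides_catl _ (slides_XA K 0))).
  - by rewrite !dotsE /=; lia.
  - by have := red_catr [:: lA 0] (xs_rconsV 1 (nseq k 1)); rewrite -catA.
rewrite {1}/bub xs_nseq -[odd k]addbF.
apply: (slides_trans (slides_cons (lU 0) h1)).
apply: (@red_slides_trans _ _ _ ([:: lU 0; lS 0] ++ xs (nseq k 1) ++ [:: lA 0])); [|by []|].
  apply: (@red_catr (xs (nseq k 1) ++ [:: lA 0]) [:: lU 0] [:: lU 0; lS 0]).
  by apply: (red_sym (red_US 0)) => M /=; rewrite /fits /nxt /=; lia.
have := slides_ctx [:: lU 0] [:: lA 0] (slides_Sxs K 0 (nseq k 1)).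
rewrite map_nseq /= => h2; apply: (slides_red_trans h2).
- by rewrite /bub xs_nseq !dotsE /=; lia.
- rewrite /bub xs_nseq -catA.
  exact: (red_ctx (lU 0 :: xs (nseq k 0)) [::] (red_SA 0)).
Qed.

Lemma slides_move_dots M mu w (f : nat -> nat) : vnf M mu -> all (fun i => i < M) w ->
    (forall i, i \in w -> f i = i \/ f i = prt mu i) ->
  exists b, slides b (xs w ++ nf mu) (xs (map f w) ++ nf mu).
Proof.
move=> v; elim: w => [|i w IH] /=; first by exists false; apply: slides_refl.
case/andP=> hi /IH{}IH hf.
have [|b h] := IH; first by move=> k kw; apply: hf; rewrite inE kw orbT.
have {}h := slides_cons (lX i) h.
case: (hf i (mem_head _ _)) => ->; first by exists b.
exists (b (+) true); apply: (slides_trans h).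
apply: (@red_slides_trans _ _ _ (xs (map f w) ++ lX i :: nf mu)).
- by have := red_catr (nf mu) (xs_rcons i (map f w)); rewrite -catA.
- by rewrite !dotsE /=; lia.
apply: (slides_red_trans (slides_catl _ (slides_nf K v hi))).
- by rewrite !dotsE /=; lia.
- by have := red_catr (nf mu) (xs_rconsV (prt mu i) (map f w)); rewrite -catA.
Qed.

(** Standard words: the dots of each strand are gathered at the end selected by
    [okd], and the bubbles carry even numbers of dots. *)
Variable okd : seq nat -> nat -> bool.
Hypothesis okd_prt : forall M mu i, vnf M mu -> i < M -> okd mu i || okd mu (prt mu i).

Definition standard M (l : seq layer) : Prop :=
  exists mu w ks, [/\ vnf M mu, all (fun i => (i < M) && okd mu i) w
    & l = xs w ++ nf mu ++ bubs (map double ks)].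

Definition in_std M q (x : H M 0) : Prop :=
  inspan (fun l => standard M l /\ dots l <= q) x.

Definition good M l := forall x : H M 0, Mor x = run K M l -> in_std (dots l) x.

Definition closedw M l := valid M l /\ nxts M l = 0.

Lemma in_std_le M q q' (x : H M 0) : q <= q' -> in_std q x -> in_std q' x.
Proof.
move=> h hx; apply: (inspan_bind hx) => l y [sl dl] v e.
by apply: (inspan_gen _ v e); split=> //; lia.
Qed.

Lemma good_slides b M l l' : closedw M l -> slides b l l' -> good M l' ->
    (forall l0, closedw M l0 -> dots l0 < dots l -> good M l0) ->
  good M l.
Proof.
case=> v e s g' IH x ex; have [v' e' c] := slidesP s v.
have [y ey] : exists y : H M 0, Mor y = run K M l' by apply: run_val; rewrite -?e'.
rewrite -(subrK (sgn K b *: y)%R x); apply: inspanD.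
  apply: (inspan_bind (c _ _ _ ex ey)) => l0 z dl v0 e0.
  apply: (@in_std_le _ (dots l0)); first lia.
  exact: (IH l0 (conj v0 (run_val_cod v0 e0)) dl _ e0).
by apply: inspanZ; rewrite -(slides_dots s); apply: g'.
Qed.

Lemma good_red M l l' : closedw M l -> l ~> l' -> dots l' = dots l -> good M l' ->
  good M l.
Proof.
case=> v e r d g x ex; have [v' e' er] := redP r v.
by rewrite -d; apply: g; rewrite ex er.
Qed.

Lemma closed_slides b M l l' : closedw M l -> slides b l l' -> closedw M l'.
Proof. by case=> v e s; have [v' e' _] := slidesP s v; split; rewrite -?e'. Qed.

Lemma closed_red M l l' : closedw M l -> l ~> l' -> closedw M l'.
Proof. by case=> v e s; have [v' e' _] := redP s v; split; rewrite -?e'. Qed.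

Context (half_unit : exists h : K, (2%:R * h = 1)%R).

Section Step.
Context (q : nat).
Hypothesis IHq : forall M l, closedw M l -> dots l < q -> good M l.

Lemma good_step b M l l' : closedw M l -> dots l <= q -> slides b l l' -> good M l' ->
  good M l.
Proof.
move=> cl dl s g; apply: (good_slides cl s g) => l0 c0 d0; apply: IHq c0 _; lia.
Qed.

Lemma good_sort M w mu ks : closedw M (xs w ++ nf mu ++ bubs ks) -> vnf M mu ->
  size w + sumn ks <= q -> good M (xs w ++ nf mu ++ bubs ks).
Proof.
move=> cl v dq.
have dE : dots (xs w ++ nf mu ++ bubs ks) = size w + sumn ks.
  by rewrite !dots_cat dots_xs dots_nf dots_bubs.
have hw : all (fun i => i < M) w.
  by case: cl => /[!valid_cat] /andP[/valid_xs_inv].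
case: (boolP (all (fun k => ~~ odd k) ks)) => [ev|/allPn[k kks]].
  have kE : ks = map double (map half ks).
    rewrite -map_comp -[LHS]map_id; apply/eq_in_map => k /(allP ev).
    by rewrite /= -{2}[k]odd_double_half => /negbTE->.
  pose f i := if okd mu i then i else prt mu i.
  have [|b s] := @slides_move_dots M mu w f v hw.
    by move=> i _; rewrite /f; case: ifP => _; [left | right].
  have {}s := slides_catr (bubs ks) s; rewrite -!catA in s.
  apply: (good_step cl _ s); first by rewrite dE.
  have [v' e'] := closed_slides cl s.
  move=> x ex; apply: (inspan_gen _ v' ex); split=> //.
  exists mu, (map f w), (map half ks); rewrite -kE; split=> //.
  rewrite all_map; apply/allP=> i iw /=.
  have hi := allP hw i iw; have := okd_prt v hi; have := prt_lt v hi.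
  rewrite /f; case: (boolP (okd mu i)) => [o|_] /= h h2; first by rewrite hi o.
  by rewrite h h2.
rewrite negbK => ok.
case/splitPr: ks / kks cl dq dE => k1 k2 cl dq dE.
have s : slides true (xs w ++ nf mu ++ bubs (k1 ++ k :: k2)) (xs w ++ nf mu ++ bubs (k1 ++ k :: k2)).
  have := bub_odd k; rewrite ok => /(slides_ctx (xs w ++ nf mu ++ bubs k1) (bubs k2)).
  by rewrite bubs_cat bubs_cons -!catA.
move=> x ex; case: cl => vl el; have [_ _ c] := slidesP s vl.
have : in_std (dots (xs w ++ nf mu ++ bubs (k1 ++ k :: k2))) (x - sgn K true *: x)%R.
  apply: (inspan_bind (c _ _ _ ex ex)) => l0 z dl v0 e0.
  apply: (@in_std_le _ (dots l0)); first lia.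
  apply: (IHq (conj v0 (run_val_cod v0 e0)) _ e0); lia.
have [h h2] := half_unit; move/(inspanZ h).
rewrite /sgn expr1 scaleN1r opprK -mulr2n -scaler_nat scalerA mulrC h2 scale1r.
exact.
Qed.

Lemma good_layer M y l : closedw M (y :: l) -> standard (nxt M y) l ->
  dots (y :: l) <= q -> good M (y :: l).
Proof.
case: y => g p cl [mu [w [ks [vmu hw lE]]]] dq.
set B := bubs (map double ks) in lE.
have dl : dots l = size w + sumn (map double ks).
  by rewrite lE !dots_cat dots_xs dots_nf dots_bubs.
have hw' : all (fun i => i < nxt M (g, p)) w by apply: sub_all hw => i /andP[].
have hf : fits M (g, p) by case: cl => /andP[].
case: g => [||| ] in cl dq hw vmu hw' hf *; rewrite /nxt /fits /= in hw vmu hw' hf.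
- (* U *)
  rewrite subn0 in hw vmu hw'; rewrite addn0 in hf.
  have pM : p.+1 < M + 2 by lia.
  have dql : size w + sumn (map double ks) <= q by move: dq; rewrite -dl.
  case: (eqVneq (prt mu p) p.+1) => pp.
  + pose f i := if i == p.+1 then p else i.
    have [|b s] := @slides_move_dots (M + 2) mu w f vmu hw'.
      move=> i _; rewrite /f; case: eqP => [->|]; [right | by left].
      by rewrite -pp (prtK vmu) //; lia.
    have {}s := slides_cons (lU p) (slides_catr B s); rewrite -!catA -lE in s.
    apply: (good_step cl dq s); have {}cl := closed_slides cl s.
    have dE : dots (lU p :: xs (map f w) ++ nf mu ++ B) = size w + sumn (map double ks).
      by rewrite (slides_dots s) -dl.
    move: cl dE; set w' := map f w => cl dE.
    have w'p : p.+1 \notin w'.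
      by apply/mapP=> -[i _]; rewrite /f; case: eqP; lia.
    pose w0 := filter (predC1 p) w'; pose k := count_mem p w'.
    have pw : perm_eq w' (w0 ++ nseq k p).
      rewrite -(perm_filterC (predC1 p) w') perm_cat2l.
      have -> : filter (predC (predC1 p)) w' = nseq k p.
        have -> : filter (predC (predC1 p)) w' = filter (pred1 p) w'.
          by apply: eq_filter => z /=; rewrite negbK.
        by rewrite /k -size_filter; apply/all_pred1P/filter_all.
      exact: perm_refl.
    have {pp} [|mu' vmu' r] := nf_pair vmu _ pp; first lia.
    rewrite addnK in vmu'.
    have sE : size w0 + k = size w.
      by have := perm_size pw; rewrite size_cat size_nseq size_map.
    have rA : lU p :: xs w' ++ nf mu ++ B ~>
        xs (map (dn2 p) w0) ++ (lU p :: xs (nseq k p) ++ [:: lA p]) ++ nf mu' ++ B.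
      have r1 := red_catr (nf mu ++ B) (xs_perm pw).
      have r2 := red_catl (xs (w0 ++ nseq k p)) (red_catr B r).
      have := red_cons (lU p) (red_trans r1 r2); rewrite xs_cat -!catA => r3.
      apply: (red_trans r3).
      have aw0 : all (fun i => (i != p) && (i != p.+1)) w0.
        apply/allP=> i; rewrite mem_filter /= => /andP[-> iw]; apply: contra w'p => /eqP<-.
        by [].
      have := red_catr (xs (nseq k p) ++ (lA p :: nf mu') ++ B) (U_xs aw0).
      by rewrite -!catA /= -!catA => r5; exact: r5.
    apply: (good_red cl rA); first by rewrite dE /B !dotsE /= -sE !(add0n, addn0) addnA.
    have cl1 := closed_red cl rA.
    have s2 := slides_ctx (xs (map (dn2 p) w0)) (nf mu' ++ B) (bub_left p k).
    apply: (good_step cl1 _ s2).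
      by rewrite /B !dotsE /= !(add0n, addn0) addnA sE.
    have r4 : xs (map (dn2 p) w0) ++ bub k ++ nf mu' ++ B ~>
              xs (map (dn2 p) w0) ++ nf mu' ++ bubs (k :: map double ks).
      apply: red_catl; rewrite bubs_cons !catA; apply: red_catr; exact: bub_comm.
    have cl2 := closed_slides cl1 s2.
    apply: (good_red cl2 r4).
      by rewrite bubs_cons /B !dotsE /=; lia.
    apply: good_sort => //; first exact: (closed_red cl2 r4).
    by rewrite size_map /= addnA sE.
  + pose f i := if (i == p) || (i == p.+1) then prt mu i else i.
    have [|b s] := @slides_move_dots (M + 2) mu w f vmu hw'.
      by move=> i _; rewrite /f; case: ifP => _; [right | left].
    have {}s := slides_cons (lU p) (slides_catr B s); rewrite -!catA -lE in s.
    apply: (good_step cl dq s); have {}cl := closed_slides cl s.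
    have aw : all (fun i => (i != p) && (i != p.+1)) (map f w).
      rewrite all_map; apply/allP=> i iw /=; rewrite /f.
      have pn := @prt_neq _ _ p vmu; have pn1 := @prt_neq _ _ p.+1 vmu.
      have pk : prt mu p.+1 != p.
        apply/eqP=> e; have := prtK vmu pM; rewrite e => e2.
        by rewrite e2 eqxx in pp.
      by case: (eqVneq i p) => [->|h1] /=; [|case: (eqVneq i p.+1) => [->|h2] /=];
        rewrite ?pp ?pk ?pn ?pn1 ?h1 ?h2 //; lia.
    have [mu' [c [vmu' r]]] := nf_U vmu hf.
    have r1 : lU p :: xs (map f w) ++ nf mu ++ B ~>
        xs (map (dn2 p) (map f w)) ++ nf mu' ++ bubs (nseq c 0 ++ map double ks).
      have := red_catr (nf mu ++ B) (U_xs aw); rewrite -!catA => r1.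
      apply: (red_trans r1); apply: red_catl; rewrite bubs_cat.
      by have := red_catr B r; rewrite -!catA.
    have dd : dots (xs (map (dn2 p) (map f w)) ++ nf mu' ++ bubs (nseq c 0 ++ map double ks))
        = dots (lU p :: xs (map f w) ++ nf mu ++ B).
      by rewrite bubs_cat /B !dotsE /= sumn_nseq mul0n.
    apply: (good_red cl r1 dd); apply: good_sort => //; first exact: (closed_red cl r1).
    by rewrite !size_map sumn_cat sumn_nseq mul0n.
- (* A *)
  rewrite addn0 in hw vmu hw'.
  have pM : p <= M - 2 by lia.
  have [mu' vmu' r] := nf_A vmu pM; rewrite subnK in vmu'; last lia.
  have r1 : lA p :: l ~> xs (map (up2 p) w) ++ nf mu' ++ B.
    rewrite lE; have := red_catr (nf mu ++ B) (A_xs p w); rewrite -!catA => r1.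
    by apply: (red_trans r1); apply: red_catl; exact: (red_catr B r).
  apply: (good_red cl r1).
    by rewrite lE !dotsE.
  apply: good_sort => //; first exact: (closed_red cl r1).
  by rewrite size_map -dl.
- (* S *)
  rewrite subnK in hw vmu hw'; last lia.
  have pM : p.+1 < M by lia.
  have [mu' vmu' r] := nf_S vmu pM.
  have s := slides_catr (nf mu ++ B) (slides_Sxs K p w).
  rewrite -!catA in s; change (slides false (lS p :: xs w ++ nf mu ++ B) (xs (map (sw p) w) ++ lS p :: nf mu ++ B)) in s.
  rewrite -lE in s.
  apply: (good_step cl dq s); have {}cl := closed_slides cl s.
  have r1 : xs (map (sw p) w) ++ lS p :: nf mu ++ B ~> xs (map (sw p) w) ++ nf mu' ++ B.
    by apply: red_catl; exact: (red_catr B r).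
  apply: (good_red cl r1).
    by rewrite !dotsE /=; lia.
  apply: good_sort => //; first exact: (closed_red cl r1).
  by rewrite size_map -dl.
- (* X *)
  rewrite subnK in hw vmu hw'; last lia.
  rewrite lE in cl dq *; apply: (@good_sort M (p :: w)) => //.
  by move: dq; rewrite -lE dots_cons dl /=; lia.
Qed.

End Step.

Lemma words_span_step q : (forall M l, closedw M l -> dots l < q -> good M l) ->
  forall l M, closedw M l -> dots l <= q -> good M l.
Proof.
move=> IHq; elim=> [|y l IH] M [v e] dq x ex.
  rewrite /= in e; subst M.
  by apply: (@inspan_gen _ _ _ _ _ [::]) => //; split=> //; exists [::], [::], [::].
case/andP: v => hf v; rewrite /= in e.
have [z ez] : exists z : H (nxt M y) 0, Mor z = run K (nxt M y) l by apply: run_val.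
have hz : in_std (dots l) z by apply: IH => //; move: dq; rewrite /dots /=; lia.
have [t et] : exists t : H M (nxt M y), Mor t = run K M [:: y].
  by apply: run_val; rewrite //= hf.
have -> : x = hcomp z t by apply: Mor_inj; rewrite ex -mcompE ez et run1.
elim: hz => [|c u u' l0 [sl dl0] v0 e0 _ IHu]; first by rewrite hcomp0l; apply: inspan0.
rewrite hcompDZl; apply: inspanD IHu; apply: inspanZ.
have dle : dots (y :: l0) <= dots (y :: l) by rewrite /dots /= leq_add2l.
apply: (in_std_le dle); apply: (good_layer IHq) => //; last 2 first.
- exact: leq_trans dle dq.
- by rewrite -mcompE e0 et run1.
by split; rewrite /= ?hf // (run_val_cod v0 e0).
Qed.

(** Every morphism represented by a word without top endpoints is a combination
    of standard words with at most as many dots. *)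
Lemma words_span M l : closedw M l -> good M l.
Proof.
move=> cl; move: {2}(dots l) (leqnn (dots l)) => q; elim/ltn_ind: q M l cl => q IH M l cl dl.
apply: (words_span_step _ cl dl) => N l0 c0 d0; exact: (IH _ d0 _ _ c0).
Qed.

End Spanning.

(** * Tensors on infinite words *)

Local Open Scope nat_scope.

(** The action of a word, given an action of its layers. *)
Fixpoint act (V : Type) (o : gen -> nat -> V -> V) (l : seq layer) (v : V) : V :=
  if l is x :: l' then act o l' (o x.1 x.2 v) else v.

Lemma act_cat V (o : gen -> nat -> V -> V) a b v : act o (a ++ b) v = act o b (act o a v).
Proof. by elim: a v => /=. Qed.

Section Words.
Context (I : Type).
Implicit Types (w : nat -> I).

Definition del n w : nat -> I := fun k => if k < n then w k else w k.+2.
Definition ins n a w : nat -> I :=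
  fun k => if k < n then w k else if k < n.+2 then a else w (k - 2).
Definition tr i j w : nat -> I :=
  fun k => if k == i then w j else if k == j then w i else w k.
Definition set2 i j a w : nat -> I := fun k => if (k == i) || (k == j) then a else w k.

End Words.

Ltac iflia :=
  repeat match goal with
  | |- context [if ?b then _ else _] =>
      first [ rewrite (_ : b = true); [ | lia ] | rewrite (_ : b = false); [ | lia ] ]
  end.

Ltac wordeq :=
  let k := fresh "k" in apply: funext; intro k; rewrite /del /ins /tr /set2 /=;
  repeat (case: ifP => ?); try lia; try (by []); congr (_ _); lia.

Section Tensors.
Context (I : finType) (R : pzRingType).
Local Notation tensor := ((nat -> I) -> R).
Implicit Types (phi : tensor) (w : nat -> I).

Definition opU n phi : tensor := fun w => (if w n == w n.+1 then phi (del n w) else 0)%R.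
Definition opA n phi : tensor := fun w => (\sum_a phi (ins n a w))%R.
Definition opP i j phi : tensor := fun w => phi (tr i j w).
Definition opS n phi : tensor := opP n n.+1 phi.
Definition opE i j phi : tensor :=
  fun w => (if w i == w j then \sum_a phi (set2 i j a w) else 0)%R.
Definition opO i j phi : tensor := fun w => (opP i j phi w - opE i j phi w)%R.

Definition opB (g : gen) : nat -> tensor -> tensor :=
  match g with gU => opU | gA => opA | gS => opS | gX => fun _ => id end.

(** The layers without dots commute when they are far apart. *)
Lemma opB_comm g h n q phi : ~~ isX g -> ~~ isX h -> n <= q ->
  opB g n (opB h (q + gdom g) phi) = opB h (q + gcod g) (opB g n phi).
Proof.
case: g => // _; case: h => // _ nq; rewrite /= ?addn2 ?addn0;
  apply: funext => w; rewrite /opU /opA /opS /opP.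
- rewrite (_ : del n w q = w q.+2); last (by rewrite /del; iflia).
  rewrite (_ : del n w q.+1 = w q.+3); last (by rewrite /del; iflia).
  rewrite (_ : del q.+2 w n = w n); last (by rewrite /del; iflia).
  rewrite (_ : del q.+2 w n.+1 = w n.+1); last (by rewrite /del; iflia).
  rewrite (_ : del q (del n w) = del n (del q.+2 w)); last by wordeq.
  by case: ifP => _; case: ifP.
- case: ifP => h.
    apply: eq_bigr => a _.
    rewrite ifT; last (by rewrite /ins; iflia).
    by congr phi; wordeq.
  by rewrite big1 // => a _; rewrite ifF // /ins; iflia.
- rewrite (_ : tr q.+2 q.+3 w n = w n); last (by rewrite /tr; iflia).
  rewrite (_ : tr q.+2 q.+3 w n.+1 = w n.+1); last (by rewrite /tr; iflia).
  by case: ifP => _ //; congr phi; wordeq.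
- rewrite (eq_bigr (fun a => if w q == w q.+1 then phi (del q.+2 (ins n a w)) else 0)%R).
    case: ifP => _; last by rewrite big1.
    by apply: eq_bigr => a _; congr phi; wordeq.
  move=> a _; rewrite (_ : ins n a w q.+2 = w q); last (by rewrite /ins; iflia; congr w; lia).
  by rewrite (_ : ins n a w q.+3 = w q.+1) //; rewrite /ins; iflia; congr w; lia.
- rewrite exchange_big; apply: eq_bigr => a _; apply: eq_bigr => b _.
  by congr phi; wordeq.
- by apply: eq_bigr => a _; congr phi; wordeq.
- rewrite (_ : tr n n.+1 w q.+2 = w q.+2); last (by rewrite /tr; iflia).
  rewrite (_ : tr n n.+1 w q.+3 = w q.+3); last (by rewrite /tr; iflia).
  by case: ifP => _ //; congr phi; wordeq.
- by apply: eq_bigr => a _; congr phi; wordeq.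
- by congr phi; wordeq.
Qed.

(** The interaction [opO i j] of two strands with another layer. *)
Lemma opP_opO i j l k phi : i != j -> k != i -> k != j -> l != k ->
  opP i j (opO l k phi)
    = opO (if l == i then j else if l == j then i else l) k (opP i j phi).
Proof.
move=> ij ki kj lk; apply: funext => w; rewrite /opO /opP /opE.
set l' := if l == i then j else if l == j then i else l.
have -> : tr i j w l = w l' by rewrite /tr /l'; case: ifP => // _; case: ifP.
have -> : tr i j w k = w k by rewrite /tr; iflia.
have -> : tr l k (tr i j w) = tr i j (tr l' k w).
  by rewrite /l'; case: (eqVneq l i) => [->|?]; [|case: (eqVneq l j) => [->|?]]; wordeq.
case: ifP => _ //; congr (_ - _)%R; apply: eq_bigr => a _.
congr phi; rewrite /l'.
by case: (eqVneq l i) => [->|?]; [|case: (eqVneq l j) => [->|?]]; wordeq.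
Qed.

Lemma opS_opO n i q phi : n <= q -> i < q.+2 ->
  opS n (opO i q.+2 phi) = opO (sw n i) q.+2 (opS n phi).
Proof.
by move=> nq iq; rewrite /opS opP_opO ?[sw n i]/sw; last lia; try lia.
Qed.

Lemma opU_opO n i q phi : n <= q -> i < q ->
  opU n (opO i q phi) = opO (up2 n i) q.+2 (opU n phi).
Proof.
move=> nq iq; apply: funext => w; rewrite /opU /opO /opP /opE.
set u := up2 n i; have [un un1 uq] : [/\ u != n, u != n.+1 & u < q.+2].
  by rewrite /u /up2; case: ifP; split; lia.
rewrite (_ : tr u q.+2 w n = w n); last (by rewrite /tr; iflia).
rewrite (_ : tr u q.+2 w n.+1 = w n.+1); last (by rewrite /tr; iflia).
rewrite (_ : del n w i = w u); last (by rewrite /u /del /up2; case: ifP => ?; iflia).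
rewrite (_ : del n w q = w q.+2); last (by rewrite /del; iflia).
rewrite [in RHS](eq_bigr (fun a => if w n == w n.+1 then phi (del n (set2 u q.+2 a w)) else 0)%R);
  last (by move=> a _; rewrite /set2; iflia).
case: ifP => _; last by rewrite big1 // if_same subr0.
rewrite (_ : tr i q (del n w) = del n (tr u q.+2 w)); last (by rewrite /u /up2; case: (ltnP i n) => ?; wordeq).
congr (_ - _)%R; case: ifP => _ //; apply: eq_bigr => a _; congr phi.
by rewrite /u /up2; case: (ltnP i n) => ?; wordeq.
Qed.

Lemma opU_opO0 n q phi : n <= q ->
  (opO n q.+2 (opU n phi) \+ opO n.+1 q.+2 (opU n phi))%R = (fun _ => 0)%R.
Proof.
move=> nq; apply: funext => w; rewrite /= /opO /opP /opE /opU.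
have E1 : (\sum_a (if set2 n q.+2 a w n == set2 n q.+2 a w n.+1
    then phi (del n (set2 n q.+2 a w)) else 0))%R = phi (del n (tr n.+1 q.+2 w)).
  rewrite (bigD1 (w n.+1)) //= [X in (_ + X)%R]big1 ?addr0.
    rewrite /set2; iflia; rewrite ?eqxx; congr phi; wordeq.
  by move=> a /negbTE an; rewrite /set2; iflia; rewrite ?an.
have E2 : (\sum_a (if set2 n.+1 q.+2 a w n == set2 n.+1 q.+2 a w n.+1
    then phi (del n (set2 n.+1 q.+2 a w)) else 0))%R = phi (del n (tr n q.+2 w)).
  rewrite (bigD1 (w n)) //= [X in (_ + X)%R]big1 ?addr0.
    rewrite /set2; iflia; rewrite ?eqxx; congr phi; wordeq.
  by move=> a an; rewrite /set2; iflia; rewrite ?[w _ == _]eq_sym ?(negbTE an).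
rewrite E1 E2.
rewrite (_ : tr n q.+2 w n = w q.+2); last (by rewrite /tr; iflia).
rewrite (_ : tr n q.+2 w n.+1 = w n.+1); last (by rewrite /tr; iflia).
rewrite (_ : tr n.+1 q.+2 w n = w n); last (by rewrite /tr; iflia).
rewrite (_ : tr n.+1 q.+2 w n.+1 = w q.+2); last (by rewrite /tr; iflia).
rewrite [w q.+2 == _]eq_sym.
by rewrite addrACA -opprD [X in (_ - X)%R]addrC subrr.
Qed.

Lemma opA_opO n i q phi : n <= q -> i < q ->
  opA n (opO (up2 n i) q.+2 phi) = opO i q (opA n phi).
Proof.
move=> nq iq; apply: funext => w; rewrite /opA /opO /opP /opE.
set u := up2 n i; have [un un1 uq] : [/\ u != n, u != n.+1 & u < q.+2].
  by rewrite /u /up2; case: ifP; split; lia.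
rewrite sumrB; congr (_ - _)%R.
  by apply: eq_bigr => a _; congr phi; rewrite /u /up2; case: (ltnP i n) => ?; wordeq.
rewrite (eq_bigr (fun a => if w i == w q then \sum_b phi (set2 u q.+2 b (ins n a w)) else 0)%R).
  case: ifP => _; last by rewrite big1.
  rewrite exchange_big; apply: eq_bigr => a _; apply: eq_bigr => b _; congr phi.
  by rewrite /u /up2; case: (ltnP i n) => ?; wordeq.
move=> a _; rewrite (_ : ins n a w u = w i); last first.
  by rewrite /u /up2 /ins; case: (ltnP i n) => ?; iflia; congr w; lia.
by rewrite (_ : ins n a w q.+2 = w q) //; rewrite /ins; iflia; congr w; lia.
Qed.

Lemma opA_opO0 n q phi : n <= q ->
  opA n (opO n q.+2 phi \+ opO n.+1 q.+2 phi)%R = (fun _ => 0)%R.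
Proof.
move=> nq; apply: funext => w; rewrite /opA /= /opO /opP /opE.
have insn a : ins n a w n = a by rewrite /ins; iflia.
have insn1 a : ins n a w n.+1 = a by rewrite /ins; iflia.
have insq a : ins n a w q.+2 = w q by rewrite /ins; iflia; congr w; lia.
rewrite (eq_bigr (fun a => (phi (tr n q.+2 (ins n a w)) + phi (tr n.+1 q.+2 (ins n a w)))
   - ((if a == w q then \sum_b phi (set2 n q.+2 b (ins n a w)) else 0)
   + (if a == w q then \sum_b phi (set2 n.+1 q.+2 b (ins n a w)) else 0)))%R); last first.
  by move=> a _; rewrite insn insn1 insq addrACA -opprD.
rewrite sumrB !big_split /=.
rewrite -!big_mkcond /= !big_pred1_eq.
rewrite [X in (_ - X)%R]addrC; apply/eqP; rewrite subr_eq0; apply/eqP.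
by congr (_ + _)%R; apply: eq_bigr => a _; congr phi; wordeq.
Qed.

(** The infinitesimal braid relation, in the form in which it is used: total
    interactions with a third strand vanish on a contracted pair. *)
Lemma opE_opO0 i j k phi : i != j -> k != i -> k != j ->
  opE i j (opO i k phi \+ opO j k phi)%R = (fun _ => 0)%R.
Proof.
move=> ij ki kj; apply: funext => w; rewrite /opE /= /opO /opP /opE.
case: ifP => // _.
have s1 a : set2 i j a w i = a by rewrite /set2; iflia.
have s2 a : set2 i j a w j = a by rewrite /set2; iflia.
have s3 a : set2 i j a w k = w k by rewrite /set2; iflia.
rewrite (eq_bigr (fun a => (phi (tr i k (set2 i j a w)) + phi (tr j k (set2 i j a w)))
   - ((if a == w k then \sum_b phi (set2 i k b (set2 i j a w)) else 0)
   + (if a == w k then \sum_b phi (set2 j k b (set2 i j a w)) else 0)))%R); last first.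
  by move=> a _; rewrite s1 s2 s3 addrACA -opprD.
rewrite sumrB !big_split /=.
rewrite -!big_mkcond /= !big_pred1_eq.
rewrite [X in (_ - X)%R]addrC; apply/eqP; rewrite subr_eq0; apply/eqP.
by congr (_ + _)%R; apply: eq_bigr => a _; congr phi; wordeq.
Qed.

Lemma opO_opE0 i j k phi : i != j -> k != i -> k != j ->
  (opO i k (opE i j phi) \+ opO j k (opE i j phi))%R = (fun _ => 0)%R.
Proof.
move=> ij ki kj; apply: funext => w; rewrite /= /opO /opP /opE.
have E1 : (\sum_a (if set2 i k a w i == set2 i k a w j
    then \sum_b phi (set2 i j b (set2 i k a w)) else 0))%R
    = (\sum_b phi (set2 i j b (tr j k w)))%R.
  rewrite (bigD1 (w j)) //= [X in (_ + X)%R]big1 ?addr0.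
    rewrite /set2; iflia; rewrite ?eqxx; apply: eq_bigr => b _; congr phi; wordeq.
  by move=> a /negbTE an; rewrite /set2; iflia; rewrite ?an.
have E2 : (\sum_a (if set2 j k a w i == set2 j k a w j
    then \sum_b phi (set2 i j b (set2 j k a w)) else 0))%R
    = (\sum_b phi (set2 i j b (tr i k w)))%R.
  rewrite (bigD1 (w i)) //= [X in (_ + X)%R]big1 ?addr0.
    rewrite /set2; iflia; rewrite ?eqxx; apply: eq_bigr => b _; congr phi; wordeq.
  by move=> a an; rewrite /set2; iflia; rewrite ?[w _ == _]eq_sym ?(negbTE an).
rewrite E1 E2.
rewrite (_ : tr i k w i = w k); last (by rewrite /tr; iflia).
rewrite (_ : tr i k w j = w j); last (by rewrite /tr; iflia).
rewrite (_ : tr j k w i = w i); last (by rewrite /tr; iflia).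
rewrite (_ : tr j k w j = w k); last (by rewrite /tr; iflia).
rewrite [w k == _]eq_sym.
by rewrite addrACA -opprD [X in (_ - X)%R]addrC subrr.
Qed.

Lemma opE_opO i j l k phi : i != j -> k != i -> k != j -> l != k -> l != i -> l != j ->
  opE i j (opO l k phi) = opO l k (opE i j phi).
Proof.
move=> ij ki kj lk li lj; apply: funext => w; rewrite /opO /opP /opE.
rewrite (_ : tr l k w i = w i); last (by rewrite /tr; iflia).
rewrite (_ : tr l k w j = w j); last (by rewrite /tr; iflia).
rewrite (eq_bigr (fun a => phi (set2 i j a (tr l k w)) -
   (if w l == w k then \sum_b phi (set2 i j a (set2 l k b w)) else 0))%R); last first.
  move=> a _; rewrite (_ : set2 i j a w l = w l); last (by rewrite /set2; iflia).
  rewrite (_ : set2 i j a w k = w k); last (by rewrite /set2; iflia).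
  congr (_ - _)%R; first by congr phi; wordeq.
  by case: ifP => _ //; apply: eq_bigr => b _; congr phi; wordeq.
have E : (\sum_b (if set2 l k b w i == set2 l k b w j
      then \sum_a phi (set2 i j a (set2 l k b w)) else 0) =
    \sum_b (if w i == w j then \sum_a phi (set2 i j a (set2 l k b w)) else 0))%R.
  apply: eq_bigr => b _.
  rewrite (_ : set2 l k b w i = w i); last (by rewrite /set2; iflia).
  by rewrite (_ : set2 l k b w j = w j) //; rewrite /set2; iflia.
rewrite E; case: ifP => _; last by rewrite big1 // if_same subr0.
rewrite sumrB; congr (_ - _)%R; case: ifP => _; last by rewrite big1.
by rewrite exchange_big.
Qed.

End Tensors.

Section Representation.
Context (I : finType).
Local Notation tensor := ((nat -> I) -> rat).
Implicit Types (phi psi : tensor) (w : nat -> I).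

Definition tlin (a : rat) phi psi : tensor := fun w => (a * phi w + psi w)%R.
Definition islin (f : tensor -> tensor) : Prop :=
  forall a phi psi, f (tlin a phi psi) = tlin a (f phi) (f psi).

Lemma lin0 f : islin f -> f (fun _ => 0%R) = (fun _ => 0%R).
Proof.
move=> h; have := h (-1)%R (fun _ => 0%R) (fun _ => 0%R); rewrite /tlin.
rewrite (_ : (fun _ => _) = (fun _ : nat -> I => 0%R)); last first.
  by apply: funext => w; rewrite mulr0 addr0.
by move=> ->; apply: funext => w; rewrite mulN1r addNr.
Qed.

Lemma linD f phi psi : islin f ->
  f (fun w => phi w + psi w)%R = (fun w => f phi w + f psi w)%R.
Proof.
move=> h; have := h 1%R phi psi; rewrite /tlin => e.
rewrite (_ : (fun w => _) = (fun w => 1 * phi w + psi w)%R).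
  by rewrite e; apply: funext => w; rewrite mul1r.
by apply: funext => w; rewrite mul1r.
Qed.

Lemma linZ f a phi : islin f -> f (fun w => a * phi w)%R = (fun w => a * f phi w)%R.
Proof.
move=> h; have := h a phi (fun _ => 0%R); rewrite (lin0 h) /tlin => e.
rewrite (_ : (fun w => _) = (fun w => a * phi w + 0)%R).
  by rewrite e; apply: funext => w; rewrite addr0.
by apply: funext => w; rewrite addr0.
Qed.

Lemma lin_sum f (J : Type) (r : seq J) (P : pred J) (F : J -> tensor) : islin f ->
  f (fun w => \sum_(j <- r | P j) F j w)%R = (fun w => \sum_(j <- r | P j) f (F j) w)%R.
Proof.
move=> h; elim: r => [|j r IH].
  rewrite (_ : (fun w => _) = (fun _ => 0%R)) ?(lin0 h).
    by apply: funext => w; rewrite big_nil.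
  by apply: funext => w; rewrite big_nil.
case Pj: (P j); last first.
  rewrite (_ : (fun w => _) = (fun w => \sum_(j <- r | P j) F j w)%R) ?IH.
    by apply: funext => w; rewrite big_cons Pj.
  by apply: funext => w; rewrite big_cons Pj.
rewrite (_ : (fun w => _) = (fun w => F j w + \sum_(j <- r | P j) F j w)%R).
  by rewrite linD // IH; apply: funext => w; rewrite big_cons Pj.
by apply: funext => w; rewrite big_cons Pj.
Qed.

Lemma linB f phi psi : islin f ->
  f (fun w => phi w - psi w)%R = (fun w => f phi w - f psi w)%R.
Proof.
move=> h; have := linD phi (fun w => -1 * psi w)%R h; rewrite linZ // => e.
rewrite (_ : (fun w => _) = (fun w => phi w + -1 * psi w)%R).
  by rewrite e; apply: funext => w; rewrite mulN1r.
by apply: funext => w; rewrite mulN1r.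
Qed.

Lemma opU_lin n : islin (opU n).
Proof.
by move=> a p q; apply: funext => w; rewrite /opU /tlin; case: ifP => // _; rewrite mulr0 addr0.
Qed.

Lemma opA_lin n : islin (opA n).
Proof.
by move=> a p q; apply: funext => w; rewrite /opA /tlin big_split -mulr_sumr.
Qed.

Lemma opP_lin i j : islin (opP i j). Proof. by []. Qed.

Lemma opE_lin i j : islin (opE i j).
Proof.
move=> a p q; apply: funext => w; rewrite /opE /tlin; case: ifP => _.
  by rewrite big_split -mulr_sumr.
by rewrite mulr0 addr0.
Qed.

Lemma opO_lin i j : islin (opO i j).
Proof.
move=> a p q; apply: funext => w; rewrite /opO opP_lin opE_lin /tlin.
by rewrite mulrBr addrACA opprD.
Qed.

(** The dot acts as the Casimir tensor coupling its strand to all the strands on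
    its left, up to a constant that the relation between a dot and its rotation
    forces to be (N-1)/2, where N is the number of colours. *)
Definition casc : rat := ((#|I|%:R - 1) / 2%:R)%R.
Definition opX n phi : tensor := fun w => (casc * phi w + \sum_(i < n) opO i n phi w)%R.

Lemma opX_lin n : islin (opX n).
Proof.
move=> a p q; apply: funext => w; rewrite /opX /tlin.
under eq_bigr => i _ do rewrite opO_lin /tlin.
rewrite big_split -mulr_sumr /=; ring.
Qed.

Definition op (g : gen) : nat -> tensor -> tensor :=
  match g with gU => @opU I rat | gA => @opA I rat | gS => @opS I rat | gX => opX end.

Lemma op_lin g n : islin (op g n).
Proof.
by case: g; [apply: opU_lin | apply: opA_lin | apply: opP_lin | apply: opX_lin].
Qed.

Lemma sum_up2 n q (F : nat -> rat) : n <= q ->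
  (\sum_(i < q.+2) F i = \sum_(i < q) F (up2 n i) + (F n + F n.+1))%R.
Proof.
elim: q => [|q IH].
  by rewrite leqn0 => /eqP->; rewrite !big_ord_recr !big_ord0 /= !add0r.
rewrite leq_eqVlt => /predU1P[->|].
  rewrite !big_ord_recr /= -addrA; congr (_ + _)%R.
  rewrite {2}/up2 leqnn; congr (_ + _)%R.
  by apply: eq_bigr => i _; rewrite /up2 ifT //; apply: ltnW; rewrite ltnS ltn_ord.
rewrite ltnS => nq; rewrite big_ord_recr IH // [in RHS]big_ord_recr /=.
by rewrite addrAC; congr (_ + _ + _)%R; rewrite /up2 ltnNge nq.
Qed.

Lemma sum_sw n q (F : nat -> rat) : n <= q ->
  (\sum_(i < q.+2) F (sw n i) = \sum_(i < q.+2) F i)%R.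
Proof.
move=> nq; rewrite (sum_up2 (fun i => F (sw n i)) nq) (sum_up2 F nq) addrC [in RHS]addrC.
congr (_ + _)%R.
  have -> : sw n n = n.+1 by rewrite /sw eqxx.
  have -> : sw n n.+1 = n by rewrite /sw eqxx; case: eqP => //; lia.
  by rewrite addrC.
apply: eq_bigr => i _; congr F; rewrite /sw /up2.
by case: (ltnP i n) => h; iflia.
Qed.

Lemma opU_opX n q phi : n <= q -> opU n (opX q phi) = opX q.+2 (opU n phi).
Proof.
move=> nq; rewrite /opX linD ?linZ ?lin_sum; try exact: opU_lin.
apply: funext => w; congr (_ + _)%R; rewrite (sum_up2 (fun i => opO i q.+2 (opU n phi) w) nq).
have /(congr1 (fun f => f w)) /= -> := opU_opO0 phi nq; rewrite addr0.
by apply: eq_bigr => i _; rewrite opU_opO.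
Qed.

Lemma opA_opX n q phi : n <= q -> opA n (opX q.+2 phi) = opX q (opA n phi).
Proof.
move=> nq; rewrite /opX linD ?linZ ?lin_sum; try exact: opA_lin.
apply: funext => w; congr (_ + _)%R.
rewrite (sum_up2 (fun i => opA n (opO i q.+2 phi) w) nq).
have := opA_opO0 phi nq; rewrite [opA n _]linD; last exact: opA_lin.
move=> /(congr1 (fun f => f w)) /= ->; rewrite addr0.
by apply: eq_bigr => i _; rewrite opA_opO.
Qed.

Lemma opS_opX n q phi : n <= q -> opS n (opX q.+2 phi) = opX q.+2 (opS n phi).
Proof.
move=> nq; rewrite /opX linD ?linZ ?lin_sum; try exact: opP_lin.
apply: funext => w; congr (_ + _)%R.
rewrite -(sum_sw (fun i => opO i q.+2 (opS n phi) w) nq).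
by apply: eq_bigr => i _; rewrite opS_opO.
Qed.

Lemma opO_opU i j k phi : i < k -> j < k -> opO i j (opU k phi) = opU k (opO i j phi).
Proof.
move=> ik jk; apply: funext => w; rewrite /opO /opP /opE /opU.
rewrite (_ : tr i j w k = w k); last (by rewrite /tr; iflia).
rewrite (_ : tr i j w k.+1 = w k.+1); last (by rewrite /tr; iflia).
rewrite (_ : del k w i = w i); last (by rewrite /del; iflia).
rewrite (_ : del k w j = w j); last (by rewrite /del; iflia).
have E : (\sum_a (if set2 i j a w k == set2 i j a w k.+1 then phi (del k (set2 i j a w)) else 0)
   = \sum_a (if w k == w k.+1 then phi (set2 i j a (del k w)) else 0))%R.
  apply: eq_bigr => a _.
  rewrite (_ : set2 i j a w k = w k); last (by rewrite /set2; iflia).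
  rewrite (_ : set2 i j a w k.+1 = w k.+1); last (by rewrite /set2; iflia).
  by case: ifP => // _; congr phi; wordeq.
rewrite E; case: ifP => _; last by rewrite big1 // if_same subr0.
by congr (_ - _)%R; congr phi; wordeq.
Qed.

Lemma opO_opA i j k phi : i < k -> j < k -> opO i j (opA k phi) = opA k (opO i j phi).
Proof.
move=> ik jk; apply: funext => w; rewrite /opO /opP /opE /opA sumrB; congr (_ - _)%R.
  by apply: eq_bigr => a _; congr phi; wordeq.
have E : (\sum_b (if ins k b w i == ins k b w j then \sum_a phi (set2 i j a (ins k b w)) else 0)
   = \sum_b (if w i == w j then \sum_a phi (set2 i j a (ins k b w)) else 0))%R.
  apply: eq_bigr => b _.
  rewrite (_ : ins k b w i = w i); last (by rewrite /ins; iflia).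
  by rewrite (_ : ins k b w j = w j) //; rewrite /ins; iflia.
rewrite E; case: ifP => _; last by rewrite big1.
rewrite exchange_big; apply: eq_bigr => a _; apply: eq_bigr => b _.
by congr phi; wordeq.
Qed.

Lemma opO_opS i j k phi : i != j -> i < k -> j < k -> opO i j (opS k phi) = opS k (opO i j phi).
Proof.
move=> ij ik jk; rewrite /opS opP_opO //; try lia.
by rewrite ifF ?ifF //; lia.
Qed.

Lemma sumD2 k i j (F : nat -> rat) : i < k -> j < k -> i != j ->
  (\sum_(l < k) F l = (F i + F j) + \sum_(l < k | (nat_of_ord l != i) && (nat_of_ord l != j)) F l)%R.
Proof.
move=> ik jk ij; rewrite (bigD1 (Ordinal ik)) //= (bigD1 (Ordinal jk)) /=; last first.
  by rewrite -val_eqE /= eq_sym.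
by rewrite addrA; congr (_ + _)%R; apply: eq_bigl => l; rewrite -!val_eqE.
Qed.

Lemma opO_opX i j k phi : i != j -> i < k -> j < k -> opO i j (opX k phi) = opX k (opO i j phi).
Proof.
move=> ij ik jk.
have hP : opP i j (opX k phi) = opX k (opP i j phi).
  apply: funext => w; rewrite {1}/opX linD ?linZ ?lin_sum; try exact: opP_lin.
  congr (_ + _)%R.
  rewrite (sumD2 (fun l => opP i j (opO l k phi) w) ik jk ij).
  rewrite (sumD2 (fun l => opO l k (opP i j phi) w) ik jk ij).
  rewrite !opP_opO ?eqxx; try lia.
  rewrite (_ : (j == i) = false); last lia.
  rewrite [in LHS]addrC [in RHS]addrC [X in (_ + X)%R]addrC; congr (_ + _)%R.
  apply: eq_bigr => l /andP[/negbTE li /negbTE lj].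
  by rewrite opP_opO ?li ?lj //; have := ltn_ord l; lia.
have hE : opE i j (opX k phi) = opX k (opE i j phi).
  apply: funext => w; rewrite {1}/opX linD ?linZ ?lin_sum; try exact: opE_lin.
  congr (_ + _)%R.
  rewrite (sumD2 (fun l => opE i j (opO l k phi) w) ik jk ij).
  rewrite (sumD2 (fun l => opO l k (opE i j phi) w) ik jk ij).
  have := @opE_opO0 I rat i j k phi ij; rewrite [opE i j _]linD; last exact: opE_lin.
  move=> e1; have {e1} /(congr1 (fun f => f w)) /= -> : _ := e1 ltac:(lia) ltac:(lia).
  have /(congr1 (fun f => f w)) /= -> := @opO_opE0 I rat i j k phi ij ltac:(lia) ltac:(lia).
  congr (_ + _)%R; apply: eq_bigr => l /andP[li lj].
  by rewrite opE_opO //; have := ltn_ord l; lia.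
have e psi : opO i j psi = (fun w => opP i j psi w - opE i j psi w)%R by [].
by rewrite !e hP hE [in RHS]linB //; apply: opX_lin.
Qed.

Lemma opX_comm h n q phi : n < q ->
    (forall i, i < n -> opO i n (op h q phi) = op h q (opO i n phi)) ->
  opX n (op h q phi) = op h q (opX n phi).
Proof.
move=> nq hc; rewrite {2}/opX linD ?linZ ?lin_sum; try exact: op_lin.
rewrite /opX; apply: funext => w; congr (_ + _)%R.
by apply: eq_bigr => i _; rewrite hc.
Qed.

Lemma op_comm g h n q phi : n <= q ->
  op g n (op h (q + gdom g) phi) = op h (q + gcod g) (op g n phi).
Proof.
move=> nq; case gXE: (isX g); last case hXE: (isX h).
- case: g gXE => // _; rewrite /= addn1; apply: opX_comm; first lia.
  move=> i iq; case: h => /=; [apply: opO_opU | apply: opO_opA | apply: opO_opS | apply: opO_opX]; lia.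
- case: h hXE => // _; case: g gXE => // _; rewrite /= ?addn2 ?addn0.
  + exact: opU_opX.
  + exact: opA_opX.
  + exact: opS_opX.
- have := @opB_comm I rat g h n q phi; rewrite gXE hXE => /(_ isT isT nq).
  by case: g gXE => //; case: h hXE.
Qed.

Context (K : comPzRingType) (iota : {rmorphism K -> rat}).

Fixpoint T n m s (t : term K m s) : tensor -> tensor :=
  match t with
  | tId _ => id
  | tU => op gU n
  | tA => op gA n
  | tS => op gS n
  | tX => op gX n
  | tcomp _ _ _ f g => fun phi => T n f (T n g phi)
  | ttens m _ _ _ f g => fun phi => T n f (T (n + m) g phi)
  | t0 _ _ => fun _ _ => 0%R
  | tadd _ _ f g => fun phi w => (T n f phi w + T n g phi w)%R
  | tscale _ _ c f => fun phi w => (iota c * T n f phi w)%R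
  end.

Lemma T_lin n m s (t : term K m s) : islin (T n t).
Proof.
elim: t n => //=; try by [move=> *; apply: op_lin].
- by move=> *; apply: opU_lin.
- by move=> *; apply: opA_lin.
- by move=> *; apply: opX_lin.
- by move=> m1 n1 p1 f hf g hg n a p q; rewrite hg hf.
- by move=> m1 s1 m2 s2 f hf g hg n a p q; rewrite hg hf.
- by move=> m1 s1 n a p q; apply: funext => w; rewrite /tlin mulr0 addr0.
- move=> m1 s1 f hf g hg n a p q; apply: funext => w; rewrite hf hg /tlin.
  by rewrite mulrDr addrACA.
- move=> m1 s1 c f hf n a p q; apply: funext => w; rewrite hf /tlin.
  by rewrite mulrDr mulrCA.
Qed.

Lemma T_cast n m s m' s' (em : m = m') (es : s = s') (t : term K m s) :
  T n (cast2 em es t) = T n t.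
Proof. by case: m' / em; case: s' / es. Qed.

Lemma op_T g n q m s (t : term K m s) phi : n <= q ->
  op g n (T (q + gdom g) t phi) = T (q + gcod g) t (op g n phi).
Proof.
elim: t q phi => //=.
- by move=> q phi; apply: (@op_comm g gU).
- by move=> q phi; apply: (@op_comm g gA).
- by move=> q phi; apply: (@op_comm g gS).
- by move=> q phi; apply: (@op_comm g gX).
- by move=> m1 n1 p1 f hf h hh q phi nq; rewrite hf // hh.
- move=> m1 s1 m2 s2 f hf h hh q phi nq; rewrite hf //.
  by rewrite [q + gdom g + _]addnAC hh 1?[q + m1 + _]addnAC //; lia.
- by move=> m1 s1 q phi _; apply: lin0; apply: op_lin.
- by move=> m1 s1 f hf h hh q phi nq; rewrite linD ?hf ?hh //; apply: op_lin.
- by move=> m1 s1 c f hf q phi nq; rewrite linZ ?hf //; apply: op_lin.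
Qed.

Lemma T_comm m s (f : term K m s) m' s' (t : term K m' s') n q phi : n <= q ->
  T n f (T (q + m) t phi) = T (q + s) t (T n f phi).
Proof.
elim: f n q phi => //=.
- by move=> n q phi nq; apply: (@op_T gU).
- by move=> n q phi nq; apply: (@op_T gA).
- by move=> n q phi nq; apply: (@op_T gS).
- by move=> n q phi nq; apply: (@op_T gX).
- by move=> m1 n1 p1 f hf h hh n q phi nq; rewrite hh // hf.
- move=> m1 s1 m2 s2 f hf h hh n q phi nq.
  rewrite (_ : q + (m1 + m2) = (q + m1) + m2); last lia.
  rewrite hh; last lia.
  rewrite (_ : q + m1 + s2 = q + s2 + m1); last lia.
  rewrite hf; last lia.
  by rewrite (_ : q + s2 + s1 = q + (s1 + s2)) //; lia.
- by move=> m1 s1 n q phi _; rewrite lin0 //; apply: T_lin.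
- by move=> m1 s1 f hf h hh n q phi nq; rewrite linD ?hf ?hh //; apply: T_lin.
- by move=> m1 s1 c f hf n q phi nq; rewrite linZ ?hf //; apply: T_lin.
Qed.

End Representation.

Section Soundness.
Context (I : finType).
Local Notation tensor := ((nat -> I) -> rat).
Implicit Types (phi : tensor) (w : nat -> I).

Lemma opSS n phi : opS n (opS n phi) = phi.
Proof. by apply: funext => w; rewrite /opS /opP; congr phi; wordeq. Qed.

Lemma op_braid n phi :
  opS n (opS n.+1 (opS n phi)) = opS n.+1 (opS n (opS n.+1 phi)).
Proof. by apply: funext => w; rewrite /opS /opP; congr phi; wordeq. Qed.

Lemma op_zigzag1 n phi : opA n.+1 (opU n phi) = phi.
Proof.
apply: funext => w; rewrite /opA /opU (bigD1 (w n)) //= [X in (_ + X)%R]big1 ?addr0.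
  rewrite (_ : ins n.+1 (w n) w n = w n); last (by rewrite /ins; iflia).
  rewrite (_ : ins n.+1 (w n) w n.+1 = w n); last (by rewrite /ins; iflia).
  rewrite eqxx; congr phi; apply: funext => k; rewrite /del /ins.
  case: (ltngtP k n) => h; iflia => //; first by congr w; lia.
  by rewrite h.
move=> a an.
rewrite (_ : ins n.+1 a w n = w n); last (by rewrite /ins; iflia).
rewrite (_ : ins n.+1 a w n.+1 = a); last (by rewrite /ins; iflia).
by rewrite eq_sym (negbTE an).
Qed.

Lemma op_zigzag2 n phi : opA n (opU n.+1 phi) = phi.
Proof.
apply: funext => w; rewrite /opA /opU (bigD1 (w n)) //= [X in (_ + X)%R]big1 ?addr0.
  rewrite (_ : ins n (w n) w n.+1 = w n); last (by rewrite /ins; iflia).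
  rewrite (_ : ins n (w n) w n.+2 = w n); last (by rewrite /ins; iflia; congr w; lia).
  rewrite eqxx; congr phi; apply: funext => k; rewrite /del /ins.
  case: (ltngtP k n) => h; iflia => //; first by congr w; lia.
  by rewrite h; iflia.
move=> a an.
rewrite (_ : ins n a w n.+1 = a); last (by rewrite /ins; iflia).
rewrite (_ : ins n a w n.+2 = w n); last (by rewrite /ins; iflia; congr w; lia).
by rewrite (negbTE an).
Qed.

Lemma op_SU n phi : opS n (opU n phi) = opU n phi.
Proof.
apply: funext => w; rewrite /opS /opP /opU.
rewrite (_ : tr n n.+1 w n = w n.+1); last (by rewrite /tr; iflia).
rewrite (_ : tr n n.+1 w n.+1 = w n); last (by rewrite /tr; iflia).
by rewrite eq_sym; case: ifP => // _; congr phi; wordeq.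
Qed.

Lemma op_AS n phi : opA n (opS n phi) = opA n phi.
Proof.
by apply: funext => w; apply: eq_bigr => a _; rewrite /opS /opP; congr phi; wordeq.
Qed.

Lemma op_AS_slide n phi : opA n (opS n.+1 phi) = opA n.+1 (opS n phi).
Proof.
by apply: funext => w; apply: eq_bigr => a _; rewrite /opS /opP; congr phi; wordeq.
Qed.

Lemma op_SU_slide n phi : opS n (opU n.+1 phi) = opS n.+1 (opU n phi).
Proof.
apply: funext => w; rewrite /opS /opP /opU.
rewrite (_ : tr n n.+1 w n.+1 = w n); last (by rewrite /tr; iflia).
rewrite (_ : tr n n.+1 w n.+2 = w n.+2); last (by rewrite /tr; iflia).
rewrite (_ : tr n.+1 n.+2 w n = w n); last (by rewrite /tr; iflia).
rewrite (_ : tr n.+1 n.+2 w n.+1 = w n.+2); last (by rewrite /tr; iflia).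
by case: ifP => // _; congr phi; wordeq.
Qed.

Lemma op_UA n phi : opU n (opA n phi) = opE n n.+1 phi.
Proof.
apply: funext => w; rewrite /opU /opA /opE; case: ifP => // _.
by apply: eq_bigr => a _; congr phi; wordeq.
Qed.

Lemma op_XS n phi w :
  (opX n (opS n phi) w - opS n (opX n.+1 phi) w = opU n (opA n phi) w - phi w)%R.
Proof.
have [Z ZE] : exists Z, Z = opU n (opA n phi) by eexists.
rewrite -ZE.
have e : opS n (opX n.+1 phi) = (fun w => casc I * opS n phi w
     + (\sum_(i < n) opO i n (opS n phi) w + (phi w - Z w)))%R.
  rewrite {1}/opX linD ?linZ ?lin_sum; try exact: opP_lin.
  apply: funext => w'; rewrite big_ord_recr /=; congr (_ + (_ + _))%R.
    apply: eq_bigr => i _; have hi := ltn_ord i.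
    rewrite /opO /opS /opP /opE.
    rewrite (_ : tr n n.+1 w' i = w' i); last (by rewrite /tr; iflia).
    rewrite (_ : tr n n.+1 w' n.+1 = w' n); last (by rewrite /tr; iflia).
    congr (_ - _)%R; first by congr phi; wordeq.
    by case: ifP => // _; apply: eq_bigr => a _; congr phi; wordeq.
  rewrite ZE op_UA /opO /opS /opP /opE.
  rewrite (_ : tr n n.+1 w' n = w' n.+1); last (by rewrite /tr; iflia).
  rewrite (_ : tr n n.+1 w' n.+1 = w' n); last (by rewrite /tr; iflia).
  rewrite eq_sym; congr (_ - _)%R; first by congr phi; wordeq.
  by case: ifP => // _; apply: eq_bigr => a _; congr phi; wordeq.
rewrite e /opX; ring.
Qed.

Lemma opAO_U1 n i phi : i < n -> opA n.+1 (opO i n.+1 (opU n phi)) = (fun w => - opO i n phi w)%R.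
Proof.
move=> hi; apply: funext => w; rewrite /opA /opO sumrB opprB; congr (_ - _)%R.
  rewrite /opP /opU /opE.
  have E a : (if tr i n.+1 (ins n.+1 a w) n == tr i n.+1 (ins n.+1 a w) n.+1
     then phi (del n (tr i n.+1 (ins n.+1 a w))) else 0)%R =
     (if w i == w n then phi (set2 i n a w) else 0)%R.
    rewrite (_ : tr _ _ _ n = w n); last (by rewrite /tr /ins; iflia).
    rewrite (_ : tr _ _ _ n.+1 = w i); last (by rewrite /tr /ins; iflia).
    by rewrite eq_sym; case: ifP => // _; congr phi; wordeq.
  under eq_bigr => a _ do rewrite E.
  by case: ifP => // _; rewrite big1.
rewrite /opP /opU /opE.
have E a : (if ins n.+1 a w i == ins n.+1 a w n.+1
   then \sum_b (if set2 i n.+1 b (ins n.+1 a w) n == set2 i n.+1 b (ins n.+1 a w) n.+1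
                then phi (del n (set2 i n.+1 b (ins n.+1 a w))) else 0) else 0)%R =
   (if a == w i then phi (tr i n w) else 0)%R.
  rewrite (_ : ins n.+1 a w i = w i); last (by rewrite /ins; iflia).
  rewrite (_ : ins n.+1 a w n.+1 = a); last (by rewrite /ins; iflia).
  rewrite eq_sym; case: eqP => // ->.
  rewrite (bigD1 (w n)) //= [X in (_ + X)%R]big1 ?addr0.
    rewrite (_ : set2 _ _ _ _ n = w n); last (by rewrite /set2 /ins; iflia).
    rewrite (_ : set2 _ _ _ _ n.+1 = w n); last (by rewrite /set2; iflia).
    by rewrite eqxx; congr phi; wordeq.
  move=> b bn; rewrite (_ : set2 _ _ _ _ n = w n); last (by rewrite /set2 /ins; iflia).
  rewrite (_ : set2 _ _ _ _ n.+1 = b); last (by rewrite /set2; iflia).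
  by rewrite eq_sym (negbTE bn).
under eq_bigr => a _ do rewrite E.
by rewrite -big_mkcond big_pred1_eq.
Qed.

Lemma opAO_U2 n i phi : i < n -> opA n (opO i n.+1 (opU n.+1 phi)) = (fun w => - opO i n phi w)%R.
Proof.
move=> hi; apply: funext => w; rewrite /opA /opO sumrB opprB; congr (_ - _)%R.
  rewrite /opP /opU /opE.
  have E a : (if tr i n.+1 (ins n a w) n.+1 == tr i n.+1 (ins n a w) n.+2
     then phi (del n.+1 (tr i n.+1 (ins n a w))) else 0)%R =
     (if w i == w n then phi (set2 i n a w) else 0)%R.
    rewrite (_ : tr _ _ _ n.+1 = w i); last (by rewrite /tr /ins; iflia).
    rewrite (_ : tr _ _ _ n.+2 = w n); last (by rewrite /tr /ins; iflia; congr w; lia).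
    by case: ifP => // _; congr phi; wordeq.
  under eq_bigr => a _ do rewrite E.
  by case: ifP => // _; rewrite big1.
rewrite /opP /opU /opE.
have E a : (if ins n a w i == ins n a w n.+1
   then \sum_b (if set2 i n.+1 b (ins n a w) n.+1 == set2 i n.+1 b (ins n a w) n.+2
                then phi (del n.+1 (set2 i n.+1 b (ins n a w))) else 0) else 0)%R =
   (if a == w i then phi (tr i n w) else 0)%R.
  rewrite (_ : ins n a w i = w i); last (by rewrite /ins; iflia).
  rewrite (_ : ins n a w n.+1 = a); last (by rewrite /ins; iflia).
  rewrite eq_sym; case: eqP => // ->.
  rewrite (bigD1 (w n)) //= [X in (_ + X)%R]big1 ?addr0.
    rewrite (_ : set2 _ _ _ _ n.+1 = w n); last (by rewrite /set2; iflia).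
    rewrite (_ : set2 _ _ _ _ n.+2 = w n); last (by rewrite /set2 /ins; iflia; congr w; lia).
    by rewrite eqxx; congr phi; wordeq.
  move=> b bn; rewrite (_ : set2 _ _ _ _ n.+1 = b); last (by rewrite /set2; iflia).
  rewrite (_ : set2 _ _ _ _ n.+2 = w n); last (by rewrite /set2 /ins; iflia; congr w; lia).
  by rewrite (negbTE bn).
under eq_bigr => a _ do rewrite E.
by rewrite -big_mkcond big_pred1_eq.
Qed.

(* The interaction of the two legs of a cup produces the scalar 1 - N, which is
   compensated by the constant in [opX]. *)
Lemma opOU n phi : opO n n.+1 (opU n phi) = (fun w => (1 - #|I|%:R) * opU n phi w)%R.
Proof.
apply: funext => w; rewrite {1}/opO -[opP n n.+1 _]/(opS n _) op_SU mulrBl mul1r.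
congr (_ - _)%R; rewrite /opE; case: eqP => h; last first.
  by rewrite /opU; case: eqP => // _; rewrite mulr0.
rewrite (eq_bigr (fun=> opU n phi w)) ?sumr_const ?mulr_natl ?cardT //.
move=> a _; rewrite /opU (_ : set2 _ _ _ _ n = a); last (by rewrite /set2; iflia).
rewrite (_ : set2 _ _ _ _ n.+1 = a); last (by rewrite /set2; iflia).
by rewrite eqxx h eqxx; congr phi; wordeq.
Qed.

Lemma opAO n phi : opA n (opO n n.+1 phi) = (fun w => (1 - #|I|%:R) * opA n phi w)%R.
Proof.
apply: funext => w; rewrite {1}/opA /opO sumrB mulrBl mul1r; congr (_ - _)%R.
  exact: (congr1 (fun f => f w) (op_AS n phi)).
rewrite (eq_bigr (fun=> opA n phi w)) ?sumr_const ?mulr_natl ?cardT //.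
move=> a _; rewrite /opE (_ : ins _ _ _ n = a); last (by rewrite /ins; iflia).
rewrite (_ : ins _ _ _ n.+1 = a); last (by rewrite /ins; iflia).
by rewrite eqxx; apply: eq_bigr => b _; congr phi; wordeq.
Qed.

Lemma casc_double : (casc I + (1 - #|I|%:R) = - casc I)%R.
Proof. by rewrite /casc; lra. Qed.

Lemma op_rotate1 n phi : opA n.+1 (opX n.+1 (opU n phi)) = (fun w => - opX n phi w)%R.
Proof.
rewrite /opX linD ?linZ ?lin_sum; try exact: opA_lin.
apply: funext => w; rewrite big_ord_recr /= op_zigzag1 opOU linZ; last exact: opA_lin.
rewrite op_zigzag1.
rewrite (eq_bigr (fun i : 'I_n => - opO i n phi w)%R); last first.
  by move=> i _; rewrite opAO_U1 ?ltn_ord.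
rewrite sumrN; set S := (\sum_(i < n) _)%R; set p := phi w.
have : ((casc I + (1 - #|I|%:R)) * p = - casc I * p)%R by rewrite casc_double.
by rewrite mulrDl mulNr; move: (_ * p)%R (_ * p)%R => x y; lra.
Qed.

Lemma op_rotate2 n phi : opA n (opX n.+1 (opU n.+1 phi)) = (fun w => - opX n phi w)%R.
Proof.
rewrite /opX linD ?linZ ?lin_sum; try exact: opA_lin.
apply: funext => w; rewrite big_ord_recr /= op_zigzag2 opAO op_zigzag2.
rewrite (eq_bigr (fun i : 'I_n => - opO i n phi w)%R); last first.
  by move=> i _; rewrite opAO_U2 ?ltn_ord.
rewrite sumrN; set S := (\sum_(i < n) _)%R; set p := phi w.
have : ((casc I + (1 - #|I|%:R)) * p = - casc I * p)%R by rewrite casc_double.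
by rewrite mulrDl mulNr; move: (_ * p)%R (_ * p)%R => x y; lra.
Qed.

Context (K : comPzRingType) (iota : {rmorphism K -> rat}).
Local Notation T := (@T I K iota).

(** The operators respect all the relations of the affine Brauer category. *)
Lemma T_sound m s (f g : term K m s) : eqv f g -> forall n, T n f = T n g.
Proof.
elim=> {m s f g} //=.
- by move=> m s f g h _ h1 _ h2 n; rewrite h1.
- by move=> m n p f f' g g' _ h1 _ h2 k; rewrite h1 h2.
- by move=> m s m' s' f f' g g' _ h1 _ h2 k; rewrite h1 h2.
- by move=> m s f f' g g' _ h1 _ h2 k; rewrite h1 h2.
- by move=> m s c f f' _ h k; rewrite h.
- by move=> m s f g h n; apply: funext => phi; apply: funext => w; rewrite addrA.
- by move=> m s f g n; apply: funext => phi; apply: funext => w; rewrite addrC.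
- by move=> m s f n; apply: funext => phi; apply: funext => w; rewrite add0r.
- move=> m s f n; apply: funext => phi; apply: funext => w.
  by rewrite rmorphN1 mulN1r subrr.
- by move=> m s c c' f n; apply: funext => phi; apply: funext => w; rewrite rmorphM mulrA.
- by move=> m s f n; apply: funext => phi; apply: funext => w; rewrite rmorph1 mul1r.
- by move=> m s c f g n; apply: funext => phi; apply: funext => w; rewrite mulrDr.
- by move=> m s c c' f n; apply: funext => phi; apply: funext => w; rewrite rmorphD mulrDl.
- move=> m n p f g g' k; apply: funext => phi; rewrite linD //; exact: T_lin.
- move=> m n p c f g k; apply: funext => phi; rewrite linZ //; exact: T_lin.
- move=> m s m' s' f g g' k; apply: funext => phi; rewrite linD //; exact: T_lin.
- move=> m s m' s' c f g k; apply: funext => phi; rewrite linZ //; exact: T_lin.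
- move=> m n p m' n' p' f g f' g' k; apply: funext => phi.
  by rewrite T_comm.
- move=> m1 s1 m2 s2 m3 s3 f g h n; rewrite T_cast /=; apply: funext => phi.
  by rewrite addnA.
- by move=> m s f n; rewrite addn0.
- by move=> m s f n; rewrite T_cast.
- by move=> n; apply: funext => phi; apply: opSS.
- by move=> n; apply: funext => phi; rewrite addn1; apply: op_braid.
- by move=> n; apply: funext => phi; rewrite addn1; apply: op_zigzag1.
- by move=> n; apply: funext => phi; rewrite addn1; apply: op_zigzag2.
- by move=> n; apply: funext => phi; rewrite op_SU.
- by move=> n; apply: funext => phi; rewrite op_AS.
- by move=> n; apply: funext => phi; rewrite addn1; apply: op_AS_slide.
- by move=> n; apply: funext => phi; rewrite addn1; apply: op_SU_slide.
- move=> n; apply: funext => phi; apply: funext => w.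
  by rewrite !rmorphN1 !mulN1r addn1 op_XS.
- move=> n; apply: funext => phi; rewrite addn1 op_rotate1; apply: funext => w.
  by rewrite rmorphN1 mulN1r.
- move=> n; apply: funext => phi; rewrite addn1 op_rotate2; apply: funext => w.
  by rewrite rmorphN1 mulN1r.
Qed.

Lemma T_layers n m s (d : diag m s) : T n (term_of K d) = act (@op I) (shift n (layers d)).
Proof.
elim: d n => //=; try by [move=> n; rewrite addn0].
- by move=> m1 n1 p1 g hg h hh n; apply: funext => phi; rewrite hg hh shift_cat act_cat.
- move=> m1 s1 m2 s2 g hg h hh n; apply: funext => phi.
  by rewrite hg hh shift_cat act_cat shiftD.
Qed.

End Soundness.

(** * Colourings of a picture *)

(** The word u with its s letters from position n on replaced by the m letters
    of v. *)
Definition wput (I : Type) n s m (u : nat -> I) (v : 'I_m -> I) : nat -> I :=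
  fun k => if k < n then u k
           else if insub (k - n) is Some i then v i else u (k - m + s).

Lemma wput_lt I n s m (u : nat -> I) (v : 'I_m -> I) k : k < n -> wput n s u v k = u k.
Proof. by rewrite /wput => ->. Qed.

Lemma wput_mid I n s m (u : nat -> I) (v : 'I_m -> I) (i : 'I_m) :
  wput n s u v (n + i) = v i.
Proof.
by rewrite /wput ltnNge leq_addr /= (_ : n + i - n = i) ?valK //; lia.
Qed.

Lemma wput_ge I n s m (u : nat -> I) (v : 'I_m -> I) k : n + m <= k ->
  wput n s u v k = u (k - m + s).
Proof.
move=> h; rewrite /wput ifF; last lia.
by case: insubP => // i; lia.
Qed.

Lemma wput_spec I n s m (u : nat -> I) (v : 'I_m -> I) (w : nat -> I) :
    (forall k, k < n -> w k = u k) -> (forall i : 'I_m, w (n + i) = v i) ->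
    (forall k, n + m <= k -> w k = u (k - m + s)) ->
  wput n s u v = w.
Proof.
move=> h1 h2 h3; apply: funext => k; case: (ltnP k n) => hk.
  by rewrite wput_lt // h1.
case: (ltnP k (n + m)) => hk'; last by rewrite wput_ge // h3.
have hi : k - n < m by lia.
have -> : k = n + Ordinal hi by rewrite /=; lia.
by rewrite wput_mid h2.
Qed.

Section Colour.
Context (I : finType) (R : comPzRingType) (y : I -> R).
Local Notation tensor := ((nat -> I) -> R).
Implicit Types (phi : tensor) (u : nat -> I).

(** The action in which a dot multiplies by the weight of the colour of its
    strand. It forgets the last three relations, but counts dots. *)
Definition opZ (g : gen) (n : nat) (phi : tensor) : tensor :=
  if g is gX then fun u => (y (u n) * phi u)%R else opB g n phi.

Definition coloured m s (d : diag m s) (f : earc d -> I) : bool :=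
  [forall a, forall b, glued a b ==> (f a == f b)].

Definition dotwt m s (d : diag m s) (f : earc d -> I) : R :=
  (\prod_(x | is_dot x) y (f x))%R.

Lemma sum_ffun_unit (F : {ffun unit -> I} -> R) :
  (\sum_(f : {ffun unit -> I}) F f = \sum_a F [ffun=> a])%R.
Proof.
rewrite (reindex (fun a => [ffun=> a] : {ffun unit -> I})) //.
exists (fun f : {ffun unit -> I} => f tt) => [a _|f _]; first by rewrite ffunE.
by apply/ffunP => -[]; rewrite ffunE.
Qed.

Definition joinf (A B : finType) (f : A -> I) (g : B -> I) : {ffun A + B -> I} :=
  [ffun x => match x with inl a => f a | inr b => g b end].

Lemma sum_ffun_sum (A B : finType) (P : pred {ffun A + B -> I}) (F : {ffun A + B -> I} -> R) :
  (\sum_(f | P f) F f =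
   \sum_(f : {ffun A -> I}) \sum_(g : {ffun B -> I} | P (joinf f g)) F (joinf f g))%R.
Proof.
rewrite pair_big_dep /=.
rewrite (reindex (fun p : {ffun A -> I} * {ffun B -> I} => joinf p.1 p.2)) //=.
exists (fun f : {ffun A + B -> I} => ([ffun a => f (inl a)], [ffun b => f (inr b)])).
  by move=> [f g] _ /=; congr pair; apply/ffunP => a; rewrite !ffunE.
by move=> f _; apply/ffunP => -[a|b]; rewrite /joinf !ffunE.
Qed.

Lemma coloured_comp m n p (g : diag n p) (h : diag m n) (f1 : earc g -> I) (f2 : earc h -> I) :
  coloured (d := dcomp g h) (joinf f1 f2) =
  [&& coloured f1, coloured f2 & [forall i, f2 (top h i) == f1 (bot g i)]].
Proof.
apply/idP/and3P.
  move=> /forallP H; split.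
  - apply/forallP=> a; apply/forallP=> b; apply/implyP=> ab.
    by have /forallP/(_ (inl b))/implyP/(_ ab) := H (inl a); rewrite !ffunE.
  - apply/forallP=> a; apply/forallP=> b; apply/implyP=> ab.
    by have /forallP/(_ (inr b))/implyP/(_ ab) := H (inr a); rewrite !ffunE.
  - apply/forallP=> i; rewrite eq_sym.
    have /forallP/(_ (inr (top h i)))/implyP := H (inl (bot g i)).
    by rewrite !ffunE; apply; apply/existsP; exists i; rewrite !eqxx.
case=> /forallP H1 /forallP H2 /forallP H3.
apply/forallP=> -[a|a]; apply/forallP=> -[b|b]; apply/implyP=> /= ab; rewrite !ffunE.
- by have /forallP/(_ b)/implyP := H1 a; apply.
- by case/existsP: ab => i /andP[/eqP<- /eqP<-]; rewrite eq_sym.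
- by case/existsP: ab => i /andP[/eqP<- /eqP<-].
- by have /forallP/(_ b)/implyP := H2 a; apply.
Qed.

Lemma coloured_tens m s m' s' (g : diag m s) (h : diag m' s') (f1 : earc g -> I) (f2 : earc h -> I) :
  coloured (d := dtens g h) (joinf f1 f2) = coloured f1 && coloured f2.
Proof.
apply/idP/andP.
  move=> /forallP H; split.
  - apply/forallP=> a; apply/forallP=> b; apply/implyP=> ab.
    by have /forallP/(_ (inl b))/implyP/(_ ab) := H (inl a); rewrite !ffunE.
  - apply/forallP=> a; apply/forallP=> b; apply/implyP=> ab.
    by have /forallP/(_ (inr b))/implyP/(_ ab) := H (inr a); rewrite !ffunE.
case=> /forallP H1 /forallP H2.
apply/forallP=> -[a|a]; apply/forallP=> -[b|b]; apply/implyP=> //= ab; rewrite !ffunE.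
- by have /forallP/(_ b)/implyP := H1 a; apply.
- by have /forallP/(_ b)/implyP := H2 a; apply.
Qed.

Lemma dotwt_comp m n p (g : diag n p) (h : diag m n) (f1 : earc g -> I) (f2 : earc h -> I) :
  dotwt (d := dcomp g h) (joinf f1 f2) = (dotwt f1 * dotwt f2)%R.
Proof.
by rewrite /dotwt /= big_sumType; congr (_ * _)%R; apply: eq_bigr => x _; rewrite ffunE.
Qed.

Lemma dotwt_tens m s m' s' (g : diag m s) (h : diag m' s') (f1 : earc g -> I) (f2 : earc h -> I) :
  dotwt (d := dtens g h) (joinf f1 f2) = (dotwt f1 * dotwt f2)%R.
Proof.
by rewrite /dotwt /= big_sumType; congr (_ * _)%R; apply: eq_bigr => x _; rewrite ffunE.
Qed.

Definition topmatch m s (d : diag m s) (f : earc d -> I) n (u : nat -> I) : bool :=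
  [forall j, f (top d j) == u (n + j)].

(** State sum: the action of a picture sums over the ways to colour its strands
    compatibly with the colours of its top endpoints. *)
Lemma act_colour m s (d : diag m s) n phi u :
  act opZ (shift n (layers d)) phi u =
  (\sum_(f : {ffun earc d -> I} | coloured f && topmatch f n u)
      dotwt f * phi (wput n s u (fun i => f (bot d i))))%R.
Proof.
elim: d n phi u => [k||||||].
- move=> n phi u /=; rewrite (big_pred1 [ffun i : 'I_k => u (n + i)]).
    rewrite /dotwt big_pred0_eq mul1r; congr phi.
    apply/esym/wput_spec => //; first by move=> i; rewrite ffunE.
    by move=> i h; rewrite subnK //; lia.
  move=> f; apply/andP/eqP.
    by case=> _ /forallP h; apply/ffunP=> i; rewrite ffunE; apply/eqP/h.
  move=> ->; split; first by apply/forallP=> a; apply/forallP=> b.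
  by apply/forallP=> i; rewrite ffunE.
- move=> n phi u /=; rewrite addn0 big_mkcond sum_ffun_unit /opU.
  have E a : coloured (d := dU) [ffun=> a] && topmatch (d := dU) [ffun=> a] n u
      = (a == u n) && (a == u n.+1).
    apply/andP/andP.
      case=> _ /forallP h; have := h (@Ordinal 2 0 isT); have := h (@Ordinal 2 1 isT).
      by rewrite !ffunE addn0 addn1.
    case=> h1 h2; split; first by apply/forallP=> -[]; apply/forallP=> -[].
    apply/forallP=> -[[|[|//]] i]; rewrite !ffunE /= ?addn0 ?addn1 //.
  rewrite (bigD1 (u n)) //= [X in (_ + X)%R]big1 ?addr0; last first.
    by move=> a an; rewrite E (negbTE an).
  rewrite E eqxx /=; case: ifP => // _.
  rewrite /dotwt big_pred0_eq mul1r; congr phi; apply/esym/wput_spec.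
  + by move=> k h; rewrite /del h.
  + by case.
  + by move=> k h; rewrite /del ifF ?subn0 ?addn2 //; lia.
- move=> n phi u /=; rewrite addn0 big_mkcond sum_ffun_unit /opA; apply: eq_bigr => a _.
  rewrite ifT; last first.
    apply/andP; split; first by apply/forallP=> -[]; apply/forallP=> -[].
    by apply/forallP=> -[].
  rewrite /dotwt big_pred0_eq mul1r; congr phi; apply/esym/wput_spec.
  + by move=> k h; rewrite /ins h.
  + by case=> i hi; rewrite ffunE /ins /=; iflia.
  + by move=> k h; rewrite /ins; iflia; rewrite addn0.
- move=> n phi u /=; rewrite addn0.
  rewrite (big_pred1 [ffun i : 'I_2 => u (n + rev_ord i)]).
    rewrite /dotwt big_pred0_eq mul1r /opS /opP; congr phi; apply/esym/wput_spec.
    + by move=> k h; rewrite /tr; iflia.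
    + by case=> -[|[|//]] i; rewrite ffunE /tr /= ?addn0 ?addn1; iflia; rewrite ?addn0 ?addn1.
    + by move=> k h; rewrite /tr; iflia; rewrite subnK //; lia.
  move=> f; apply/andP/eqP.
    case=> _ /forallP h; apply/ffunP=> i; rewrite ffunE -[in LHS](rev_ordK i).
    exact/eqP/(h (rev_ord i)).
  move=> ->; split; first by apply/forallP=> a; apply/forallP=> b.
  by apply/forallP=> i; rewrite ffunE -[in X in _ == X](rev_ordK i).
- move=> n phi u /=; rewrite addn0 big_mkcond sum_ffun_unit.
  have E a : coloured (d := dX) [ffun=> a] && topmatch (d := dX) [ffun=> a] n u = (a == u n).
    apply/andP/idP.
      by case=> _ /forallP/(_ ord0); rewrite ffunE addn0.
    move=> h; split; first by apply/forallP=> -[]; apply/forallP=> -[].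
    by apply/forallP=> i; rewrite ffunE ord1 addn0.
  rewrite (bigD1 (u n)) //= [X in (_ + X)%R]big1 ?addr0; last first.
    by move=> a an; rewrite E (negbTE an).
  rewrite E eqxx /dotwt (big_pred1 tt) ?ffunE; last by case.
  congr (_ * _)%R; congr phi; apply/esym/wput_spec => //.
    by move=> i; rewrite ord1 addn0.
  by move=> k h; rewrite subnK //; lia.
- move=> m1 n1 p1 g hg h hh n phi u; rewrite [layers _]/= shift_cat act_cat hg.
  rewrite [RHS]sum_ffun_sum [LHS]big_mkcond; apply: eq_bigr => f1 _.
  rewrite hh big_distrr /=; case: ifP => hf1; last first.
    rewrite big_pred0 // => f2; rewrite coloured_comp.
    have -> : topmatch (d := dcomp g h) (joinf f1 f2) n u = topmatch f1 n u.
      by apply: eq_forallb => j; rewrite ffunE.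
    by move: hf1; case: (coloured f1) => //= ->; rewrite andbF.
  apply: eq_big => f2.
    rewrite coloured_comp.
    have -> : topmatch (d := dcomp g h) (joinf f1 f2) n u = topmatch f1 n u.
      by apply: eq_forallb => j; rewrite ffunE.
    case/andP: hf1 => -> ->; rewrite andbT; congr andb.
    by apply: eq_forallb => j; rewrite wput_mid.
  move=> _; rewrite dotwt_comp mulrA; congr (_ * _)%R; congr phi.
  apply/esym/wput_spec.
  + by move=> k hk; rewrite !wput_lt.
  + by move=> i; rewrite wput_mid ffunE.
  + by move=> k hk; rewrite !wput_ge ?addnK //; lia.
- move=> m1 s1 m2 s2 g hg h hh n phi u; rewrite [layers _]/= shift_cat act_cat shiftD hg.
  rewrite [RHS]sum_ffun_sum [LHS]big_mkcond; apply: eq_bigr => f1 _.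
  have topE f2 : topmatch (d := dtens g h) (joinf f1 f2) n u
      = topmatch f1 n u && topmatch f2 (n + s1) u.
    apply/forallP/andP.
      move=> H; split; apply/forallP=> j.
      - have := H (lshift s2 j); rewrite ffunE /=; case: split_ordP => k /eqP.
          by rewrite eq_lshift => /eqP->.
        by rewrite eq_lrshift.
      - have := H (rshift s1 j); rewrite ffunE /=; case: split_ordP => k /eqP.
          by rewrite eq_rlshift.
        by rewrite eq_rshift => /eqP->; rewrite addnA.
    case=> /forallP H1 /forallP H2 j; rewrite ffunE /=.
    case: split_ordP => k ->; first exact: H1.
    by have := H2 k; rewrite -addnA.
  rewrite hh big_distrr /=; case: ifP => hf1; last first.
    rewrite big_pred0 // => f2; rewrite coloured_tens topE.
    by move: hf1; case: (coloured f1) => //= ->; rewrite andbF.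
  apply: eq_big => f2.
    rewrite coloured_tens topE; case/andP: hf1 => -> -> /=; congr andb.
    apply: eq_forallb => j; rewrite wput_ge; last lia.
    by congr (_ == u _); lia.
  move=> _; rewrite dotwt_tens mulrA; congr (_ * _)%R; congr phi.
  apply/esym/wput_spec.
  + by move=> k hk; rewrite !wput_lt //; lia.
  + move=> i; rewrite ffunE /=; case: split_ordP => k -> /=.
      by rewrite wput_lt ?wput_mid //; have := ltn_ord k; lia.
    by rewrite addnA wput_mid.
  + by move=> k hk; rewrite !wput_ge; try lia; congr u; lia.
Qed.

End Colour.

Lemma glued_sym m s (d : diag m s) : symmetric (@glued m s d).
Proof.
elim: d => //=.
- move=> m1 n p g hg h hh [a|a] [b|b] //.
- move=> m1 s1 m2 s2 g hg h hh [a|a] [b|b] //.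
Qed.

Section Strands.
Context m s (d : diag m s).
Local Notation e := (@glued m s d).
Local Notation ss := (@same_strand m s d).
Implicit Types x z : earc d.

Lemma glued_csym : connect_sym e.
Proof. exact/sym_connect_sym/glued_sym. Qed.

Lemma same_strand_sym : symmetric (@same_strand m s d).
Proof. exact: glued_csym. Qed.

Lemma same_strandE x z : ss x z = (fingraph.root e x == fingraph.root e z).
Proof. by rewrite root_connect //; exact: glued_csym. Qed.

Lemma same_strand_refl x : ss x x.
Proof. exact: connect0. Qed.

Lemma same_strand_trans x t z : ss x t -> ss t z -> ss x z.
Proof. exact: connect_trans. Qed.

Lemma colouredP (I : eqType) (f : earc d -> I) x t :
  (forall a b, e a b -> f a = f b) -> ss x t -> f x = f t.
Proof.
move=> h /connectP[p]; elim: p x => [|z p IH] x /=; first by move=> _ ->.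
by case/andP=> /h-> hp hl; apply: IH.
Qed.

Section Weights.
Context (I : finType) (R : comPzRingType) (y : I -> R) (c0 : I).

Definition zc (w : 'I_m + 'I_s -> I) : R :=
  (\sum_(f : {ffun earc d -> I} | coloured f && [forall p, f (endpt d p) == w p]) dotwt y f)%R.

Definition allowed (w : 'I_m + 'I_s -> I) (x : earc d) (c : I) : bool :=
  [forall p, ss (endpt d p) x ==> (w p == c)].

Definition consistent (w : 'I_m + 'I_s -> I) : bool :=
  [forall p, forall q, ss (endpt d p) (endpt d q) ==> (w p == w q)].

Lemma zc_roots w :
  zc w = (\prod_(x | roots e x) \sum_(c | allowed w x c) y c ^+ @dots_on m s d x)%R.
Proof.
rewrite (big_distr_big_dep c0).
rewrite /zc (reindex_onto (fun h : {ffun earc d -> I} => [ffun x => h (fingraph.root e x)])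
  (fun f => [ffun x => if roots e x then f x else c0])) /=; last first.
  move=> f /andP[/forallP fc _]; apply/ffunP=> x; rewrite !ffunE.
  rewrite (roots_root glued_csym); apply/esym/colouredP; last first.
    exact: connect_root.
  by move=> a b ab; have /forallP/(_ b)/implyP/(_ ab)/eqP := fc a.
apply: eq_big => [h|h].
  apply/andP/idP.
    case=> /andP[_ /forallP hw] /eqP hE.
    apply/pfamilyP; split.
      by apply/supportP=> x xr; rewrite -hE ffunE ifN.
    move=> x xr; apply/forallP=> p; apply/implyP=> px.
    have := eqP (hw p); rewrite ffunE => <-.
    by move: px; rewrite same_strandE => /eqP->; rewrite (eqP xr).
  move/pfamilyP=> [/supportP hs hf]; split; [apply/andP; split|].
  - apply/forallP=> a; apply/forallP=> b; apply/implyP=> ab; rewrite !ffunE.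
    by have /(fingraph.rootP glued_csym) -> : connect e a b by apply: connect1.
  - apply/forallP=> p; rewrite ffunE.
    have := hf (fingraph.root e (endpt d p)) (roots_root glued_csym _).
    move/forallP/(_ p)/implyP; rewrite eq_sym; apply.
    exact: connect_root.
  - apply/eqP/ffunP=> x; rewrite !ffunE; case: ifP => xr; first by rewrite (eqP xr).
    by rewrite hs //; apply/negbT.
case/andP=> _ /eqP hE; rewrite /dotwt.
rewrite (partition_big (fingraph.root e) (roots e)) /=; last first.
  by move=> x _; apply: (roots_root glued_csym).
apply: eq_bigr => r rr; rewrite (eq_bigr (fun=> y (h r))); last first.
  by move=> x /andP[_ /eqP xr]; rewrite ffunE xr.
rewrite prodr_const; congr (_ ^+ _)%R; apply: eq_card => x.
rewrite !inE andbC; congr andb.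
by rewrite same_strandE (eqP rr) eq_sym.
Qed.

Definition isopen (x : earc d) : bool := [exists p, ss (endpt d p) x].

Definition psum (k : nat) : R := (\sum_c y c ^+ k)%R.

Lemma zc_prod w : zc w =
  ((\prod_(x | roots e x && isopen x) \sum_(c | allowed w x c) y c ^+ @dots_on m s d x)
    * \prod_(k <- bubble_dots d) psum k)%R.
Proof.
rewrite zc_roots (bigID isopen) /=; congr (_ * _)%R.
rewrite /bubble_dots big_map big_enum_cond /=; apply: eq_big => x.
  by rewrite andbT /bubble_reps !inE /isopen negb_exists.
case/andP=> _ xo; apply: eq_bigl => c; apply/forallP=> p; apply/implyP=> px.
by case/negP: xo; apply/existsP; exists p.
Qed.

Lemma allowed_open w x p : consistent w -> ss (endpt d p) x ->
  allowed w x =1 pred1 (w p).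
Proof.
move=> /forallP cw px c; apply/forallP/eqP.
  by move=> /(_ p)/implyP/(_ px)/eqP.
move=> -> q; apply/implyP=> qx.
have /forallP/(_ p)/implyP := cw q; apply.
by apply: same_strand_trans qx _; rewrite same_strand_sym.
Qed.

Lemma zc_inconsistent w : ~~ consistent w -> zc w = 0%R.
Proof.
case/forallPn=> p /forallPn[q]; rewrite negb_imply => /andP[pq wpq].
rewrite /zc big_pred0 // => f; apply/negP=> /andP[/forallP fc /forallP fw].
case/negP: wpq; rewrite -(eqP (fw p)) -(eqP (fw q)); apply/eqP.
apply: colouredP pq => a b ab.
by have /forallP/(_ b)/implyP/(_ ab)/eqP := fc a.
Qed.

(** Open strands contribute a monomial, which singles out the strands of one
    colour when the other colours have weight 1. *)
Lemma zc_consistent w : consistent w -> zc w =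
  ((\prod_(x | roots e x && isopen x)
       \prod_(c | allowed w x c) y c ^+ @dots_on m s d x)
    * \prod_(k <- bubble_dots d) psum k)%R.
Proof.
move=> cw; rewrite zc_prod; congr (_ * _)%R; apply: eq_bigr => x /andP[_ /existsP[p px]].
by rewrite !(big_pred1 (w p)) // => c; rewrite (allowed_open cw px).
Qed.

End Weights.

Lemma zc_dotfree (I : finType) (R : comPzRingType) (y : I -> R) (c0 : I) w :
  dot_free d -> bubble_free d -> zc y w = ((consistent w)%:R)%R.
Proof.
move=> /forallP df /eqP/card0_eq bf; case cw: (consistent w); last first.
  by rewrite zc_inconsistent ?cw.
rewrite (zc_consistent _ c0 cw) [X in (_ * X)%R]big1_seq ?mulr1; last first.
  move=> k /andP[_ /mapP[x]]; rewrite mem_enum => xb.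
  by have := bf x; rewrite /= xb.
rewrite big1 // => x _; rewrite big1 // => c _.
rewrite (_ : @dots_on m s d x = 0) // /dots_on; apply: eq_card0 => z.
by rewrite !inE (negbTE (df z)) andbF.
Qed.

End Strands.

(** Evaluating the action of a picture on an indicator function. *)
Definition indic (I : finType) (R : comPzRingType) m (v : 'I_m -> I) (x : nat -> I) : R :=
  ([forall i : 'I_m, x i == v i]%:R)%R.

Lemma act_zc (I : finType) (R : comPzRingType) (y : I -> R) m s (d : diag m s) u v :
  act (opZ y) (layers d) (indic R v) u =
  zc d y (fun p : 'I_m + 'I_s => match p with inl i => v i | inr j => u j end).
Proof.
rewrite -[layers d]shift0 act_colour /zc [LHS]big_mkcond [RHS]big_mkcond /=.
apply: eq_bigr => f _.
have E1 : [forall p, f (endpt d p) == match p with inl i => v i | inr j => u j end]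
    = topmatch f 0 u && [forall i, f (bot d i) == v i].
  apply/forallP/andP.
    by move=> h; split; apply/forallP=> i; [apply: (h (inr i)) | apply: (h (inl i))].
  by case=> /forallP h1 /forallP h2 [i|j]; [apply: h2 | apply: h1].
rewrite E1 andbA; case: ifP => //= _; rewrite /indic.
rewrite (_ : [forall i : 'I_m, _] = [forall i, f (bot d i) == v i]).
  by case: ifP => _; rewrite ?mulr1 ?mulr0.
by apply: eq_forallb => i; rewrite -[nat_of_ord i]add0n wput_mid.
Qed.

(** * Recovering a normally ordered picture from its strands *)

Lemma act_xs (I : finType) (R : comPzRingType) (y : I -> R) w phi u :
  act (opZ y) (xs w) phi u = ((\prod_(i <- w) y (u i)) * phi u)%R.
Proof.
elim: w phi => [|i w IH] phi; first by rewrite big_nil mul1r.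
by rewrite /= IH big_cons /= mulrCA mulrA.
Qed.

Lemma act_bub (I : finType) (R : comPzRingType) (y : I -> R) k phi u :
  act (opZ y) (bub k) phi u = (psum y k * phi u)%R.
Proof.
rewrite /bub xs_nseq -cat1s !act_cat /= /opA /psum big_distrl; apply: eq_bigr => a _.
rewrite act_xs big_nseq /opU.
rewrite (_ : ins 0 a u 0 = a) // (_ : ins 0 a u 1 = a) // eqxx.
rewrite (_ : del 0 (ins 0 a u) = u); last by apply: funext => j; rewrite /del /ins /= subn2.
by rewrite iter_mulr_1.
Qed.

Lemma act_bubs (I : finType) (R : comPzRingType) (y : I -> R) ks phi u :
  act (opZ y) (bubs ks) phi u = ((\prod_(k <- ks) psum y k) * phi u)%R.
Proof.
elim: ks phi => [|k ks IH] phi; first by rewrite big_nil mul1r.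
by rewrite bubs_cons act_cat IH act_bub big_cons mulrCA mulrA.
Qed.

Section PowerProducts.
Local Open Scope ring_scope.
Local Notation P s := (\prod_(k <- s) (1 + 'X^k) : {poly rat}).

Lemma prod1X_neq0 (s : seq nat) : P s != 0.
Proof.
elim: s => [|k s IH]; first by rewrite big_nil oner_neq0.
rewrite big_cons mulf_neq0 //; apply/eqP => /(congr1 (fun p => p.[1])).
by rewrite !hornerE expr1n.
Qed.

Lemma prod1X_horner0 (s : seq nat) : (P s).[0] = 2 ^+ count_mem 0%N s.
Proof.
elim: s => [|k s IH]; first by rewrite big_nil !hornerE.
rewrite big_cons hornerM IH !hornerE /= exprD expr0n; congr (_ * _).
by case: k.
Qed.

Lemma prod1X_low k (s : seq nat) j : (0 < k)%N -> all (leq k) s -> (j <= k)%N ->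
  (P s)`_j = (if j == 0%N then 1%N else if j == k then count_mem k s else 0%N)%:R.
Proof.
move=> k0 + jk; elim: s => [|t s IH] /=.
  by move=> _; rewrite big_nil coef1; case: (j == 0)%N; case: (j == k).
case/andP=> kt hs; rewrite big_cons mulrDl mul1r coefD IH // coefXnM.
case: (ltnP j t) => jt.
  rewrite addr0; congr _%:R; case: (eqVneq j k) => // jk'.
  by rewrite -jk' [_ == j](_ : _ = false) //; apply/eqP; lia.
have jE : j = k by lia.
have tE : t = k by lia.
rewrite tE jE subnn eqxx; have -> : (k == 0)%N = false by lia.
have Q0 : (P s)`_0 = 1.
  elim: s hs {IH} => [|u s IH] /=; first by rewrite big_nil coef1.
  case/andP=> ku hs; rewrite big_cons mulrDl mul1r coefD IH // coefXnM.
  by rewrite (leq_trans k0 ku) addr0.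
by rewrite Q0 add1n -natr1.
Qed.

Lemma prod1X_count k (s t : seq nat) : all (leq k) s -> all (leq k) t -> P s = P t ->
  count_mem k s = count_mem k t.
Proof.
case: (posnP k) => [->|k0] hs ht e.
  have : (P s).[0] = (P t).[0] by rewrite e.
  by rewrite !prod1X_horner0; apply: (@ieexprIn _ 2); rewrite // lt0r.
have := congr1 (fun p : {poly rat} => p`_k) e.
rewrite /= !(prod1X_low k0) // eqxx (_ : (k == 0)%N = false); last lia.
by move/eqP; rewrite eqr_nat => /eqP.
Qed.

(** The multiset of exponents can be read off the product. *)
Lemma prod1X_inj (s t : seq nat) : P s = P t -> perm_eq s t.
Proof.
have [n] := ubnP (size s + size t)%N; elim: n s t => // n IH s t hn e.
case: (posnP (size (s ++ t))) => [/size0nil|st0].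
  by case: s {hn e} => //= ->.
have [k kst kmin] : exists2 k, k \in s ++ t & all (leq k) (s ++ t).
  case: (s ++ t) st0 => // x r _.
  have xin : x \in x :: r by apply: mem_head.
  elim: r x {xin} => [|z r IHr] x; first by exists x; rewrite /= ?mem_head ?leqnn.
  have [k kin kall] := IHr (minn x z).
  exists k.
    by move: kin; rewrite !inE; case/orP=> [/eqP->|->]; rewrite ?orbT //;
      rewrite /minn; case: ifP; rewrite eqxx ?orbT.
  by move: kall => /= /andP[]; rewrite leq_min => /andP[-> ->] ->.
move: kmin; rewrite all_cat => /andP[hs ht].
have ce := prod1X_count hs ht e.
have ks : k \in s.
  move: kst; rewrite mem_cat => /orP[//|kt].
  by rewrite -has_pred1 has_count ce -has_count has_pred1.
have kt : k \in t by rewrite -has_pred1 has_count -ce -has_count has_pred1.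
have ps := perm_to_rem ks; have pt := perm_to_rem kt.
apply: (perm_trans ps); rewrite perm_sym; apply: (perm_trans pt).
rewrite perm_cons perm_sym; apply: IH.
  by move: hn; rewrite (perm_size ps) (perm_size pt) /=; lia.
move: e; rewrite (perm_big _ ps) (perm_big _ pt) !big_cons /=.
apply: mulfI; have := prod1X_neq0 [:: k].
by rewrite big_cons big_nil mulr1.
Qed.

End PowerProducts.

Section Recover.
Context (m s : nat) (D d : diag m s) (lab : 'I_m + 'I_s -> nat) (ks : seq nat).

(* The state sums of D are those of an undotted diagram d without bubbles, lab
   dots at the endpoints, and bubbles with the numbers of dots ks. *)
Hypothesis DE : forall (I : finType) (R : comPzRingType) (y : I -> R) (c0 : I) w,
  zc D y w = ((\prod_(k <- ks) psum y k) * (\prod_p y (w p) ^+ lab p)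
              * (consistent d w)%:R)%R.

Local Open Scope ring_scope.

Lemma recover_consistent (w : 'I_m + 'I_s -> bool) : consistent D w = consistent d w.
Proof.
have psum1 k : psum (fun _ : bool => 1 : rat) k = 2%:R.
  rewrite /psum (eq_bigr (fun=> 1)) ?sumr_const ?card_bool // => c _.
  by rewrite expr1n.
have prod_neq0 (r : seq nat) : \prod_(k <- r) psum (fun _ : bool => 1 : rat) k != 0.
  by elim: r => [|k r IH]; rewrite ?big_nil ?big_cons ?mulf_neq0 ?psum1.
have e := DE (fun _ : bool => 1 : rat) true w.
case cD: (consistent D w); case cd: (consistent d w) => //.
- move: e; rewrite cd mulr0 (zc_consistent _ true cD) => /eqP.
  rewrite mulf_eq0 (negbTE (prod_neq0 _)) orbF big1 ?oner_eq0 // => x _.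
  by rewrite big1 // => c _; rewrite expr1n.
- move: e; rewrite cd mulr1 zc_inconsistent ?cD // => /esym/eqP.
  rewrite mulf_eq0 (negbTE (prod_neq0 _)) /= big1 ?oner_eq0 // => p _.
  by rewrite expr1n.
Qed.

Lemma recover_strand p q :
  same_strand (endpt D p) (endpt D q) = same_strand (endpt d p) (endpt d q).
Proof.
apply/idP/idP => h.
- have : consistent D (fun q => same_strand (endpt d p) (endpt d q)).
    rewrite recover_consistent; apply/forallP=> a; apply/forallP=> b.
    apply/implyP=> ab; apply/eqP; apply/idP/idP => pa; first exact: same_strand_trans pa ab.
    by apply: same_strand_trans pa _; rewrite same_strand_sym.
  move/forallP/(_ p)/forallP/(_ q)/implyP/(_ h)/eqP <-.
  exact: same_strand_refl.
- have : consistent d (fun q => same_strand (endpt D p) (endpt D q)).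
    rewrite -recover_consistent; apply/forallP=> a; apply/forallP=> b.
    apply/implyP=> ab; apply/eqP; apply/idP/idP => pa; first exact: same_strand_trans pa ab.
    by apply: same_strand_trans pa _; rewrite same_strand_sym.
  move/forallP/(_ p)/forallP/(_ q)/implyP/(_ h)/eqP <-.
  exact: same_strand_refl.
Qed.

(* One colour counts dots, the other one has weight 1. *)
Definition mark (c : bool) : {poly rat} := if c then 'X else 1.

Lemma psum_mark k : psum mark k = 1 + 'X^k.
Proof. by rewrite /psum big_bool /= expr1n addrC. Qed.

Lemma zc_unmarked (d' : diag m s) : zc d' mark (fun _ => false)
  = \prod_(k <- bubble_dots d') (1 + 'X^k).
Proof.
rewrite (zc_consistent _ true); last first.
  by apply/forallP=> p; apply/forallP=> q; apply/implyP.
rewrite big1 ?mul1r; first by apply: eq_bigr => k _; rewrite psum_mark.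
move=> x /andP[_ /existsP[p px]]; rewrite big1 // => c.
rewrite (allowed_open _ px) => [/eqP ->|]; first by rewrite expr1n.
by apply/forallP=> q; apply/forallP=> q'; apply/implyP.
Qed.

Lemma recover_prod : \prod_(k <- bubble_dots D) (1 + 'X^k)
  = \prod_(k <- ks) (1 + 'X^k) :> {poly rat}.
Proof.
have cf : consistent d (fun _ => false).
  by apply/forallP=> p; apply/forallP=> q; apply/implyP.
rewrite -zc_unmarked (DE _ true) cf mulr1 [X in _ * X]big1 ?mulr1; first by apply: eq_bigr => k _; rewrite psum_mark.
by move=> p _; rewrite expr1n.
Qed.

Lemma recover_bubbles : perm_eq (bubble_dots D) ks.
Proof. exact/prod1X_inj/recover_prod. Qed.

Lemma recover_dots p : dots_on (endpt D p)
  = (\sum_(q | same_strand (endpt d p) (endpt d q)) lab q)%N.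
Proof.
pose w q := same_strand (endpt d p) (endpt d q).
have cw : consistent D w.
  rewrite recover_consistent; apply/forallP=> a; apply/forallP=> b.
  apply/implyP=> ab; apply/eqP; apply/idP/idP => pa; first exact: same_strand_trans pa ab.
  by apply: same_strand_trans pa _; rewrite same_strand_sym.
have := DE mark true w; rewrite -recover_consistent cw mulr1 (zc_consistent _ true cw).
rewrite (eq_bigr (fun k => 1 + 'X^k)) => [|k _]; last exact: psum_mark.
rewrite [in RHS](eq_bigr (fun k => 1 + 'X^k)) => [|k _]; last exact: psum_mark.
rewrite recover_prod mulrC => /(mulfI (prod1X_neq0 ks)).
have -> : \prod_q mark (w q) ^+ lab q = 'X^(\sum_(q | w q) lab q) :> {poly rat}.
  rewrite [RHS](big_morph _ (exprD 'X) (expr0 _)) [RHS]big_mkcond /=; apply: eq_bigr => q _.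
  by rewrite /mark; case: (w q); rewrite // expr1n.
pose r := fingraph.root (@glued _ _ D) (endpt D p).
have pr : same_strand (endpt D p) r by apply: connect_root.
have rr : roots (@glued _ _ D) r by apply: (roots_root (@glued_csym _ _ D)).
have ro : isopen (d := D) r by apply/existsP; exists p.
rewrite (bigD1 r) /=; last by rewrite rr ro.
rewrite [X in _ * X]big1 ?mulr1; last first.
  move=> x /andP[/andP[xr /existsP[q qx]] xnr]; rewrite (big_pred1 (w q)); last first.
    exact: allowed_open cw qx.
  rewrite /mark ifF ?expr1n //; apply/negP => pq; case/negP: xnr.
  have : same_strand (endpt D p) x.
    by apply: same_strand_trans qx; rewrite recover_strand.
  by rewrite same_strandE -/r (eqP xr) eq_sym.
rewrite (big_pred1 (w p)); last exact: allowed_open cw pr.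
rewrite /mark /w same_strand_refl => /(congr1 (fun t : {poly rat} => size t)).
rewrite !size_polyXn => -[<-]; apply: eq_card => x; rewrite !inE; congr andb.
by rewrite !same_strandE; have := pr; rewrite same_strandE => /eqP->.
Qed.

End Recover.

(** * Bending top endpoints to the bottom *)

Definition cvl (n s : nat) : seq layer := [seq lU i | i <- iota n s].
Definition evl (s : nat) : seq layer := [seq lA i | i <- rev (iota 0 s)].

Lemma evlS s : evl s.+1 = lA s :: evl s.
Proof. by rewrite /evl iota0S rev_cat. Qed.

Lemma cvlS n s : cvl n s.+1 = lU n :: cvl n.+1 s. Proof. by []. Qed.

Lemma cvl_rcons n s : cvl n s.+1 = cvl n s ++ [:: lU (n + s)].
Proof. by rewrite /cvl -addn1 iotaD map_cat. Qed.

Lemma shift_cvl k n s : shift k (cvl n s) = cvl (k + n) s.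
Proof.
elim: s n => // s IH n; rewrite cvlS -[shift _ _]/((gU, k + n) :: shift k (cvl n.+1 s)).
by rewrite IH addnS.
Qed.

Lemma dots_evl s : dots (evl s) = 0.
Proof. by elim: s => // s IH; rewrite evlS dots_cons IH. Qed.

Lemma dots_cvl n s : dots (cvl n s) = 0.
Proof. by elim: s n => // s IH n; rewrite cvlS dots_cons IH. Qed.

Lemma valid_shift_inv k M l : valid (k + M) (shift k l) -> valid M l.
Proof.
elim: l M => //= -[g p] l IH M /andP[]; rewrite /fits /nxt /= => h.
rewrite [X in valid X _](_ : _ = k + (M - gdom g + gcod g))%N; last lia.
by move/IH ->; lia.
Qed.

(** A word on the left m strands and a word on the others can be exchanged. *)
Lemma red_exchange m s l c : valid m l -> nxts m l = s ->
  shift m c ++ l ~> l ++ shift s c.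
Proof.
move=> vl nl; split=> M; rewrite valid_cat => /andP[vc vl'].
have mM : m <= M \/ c = [::].
  case: c vc {vl'} => [|x c]; first by right.
  by rewrite /= /fits /= => /andP[]; left; lia.
case: mM => [mM|cE]; last first.
  by subst c; rewrite /= cats0 in vl' *; split.
move: vc vl'; rewrite -(subnKC mM); move: (M - m) => k vc vl'.
have vc0 := valid_shift_inv vc.
rewrite valid_cat !nxts_cat valid_wide // nxts_wide // nl nxts_shift // valid_shift //.
rewrite nxts_shift // nxts_wide // nl; split=> // K.
rewrite !run_cat ?valid_shift ?valid_wide // ?nxts_shift ?nxts_wide ?nl ?valid_shift ?valid_wide //.
rewrite (run_wide K k vl) (run_wide K (nxts k c) vl) (run_shift K m vc0) (run_shift K s vc0).
rewrite -!minterchange ?run_dom ?run_cod //.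
by rewrite !mcomp1l ?mcomp1r ?run_dom ?run_cod ?nl.
Qed.

Lemma rev_iotaS n k : rev (iota n k.+1) = n + k :: rev (iota n k).
Proof. by rewrite -[k.+1]addn1 iotaD rev_cat. Qed.

(** Straightening the nested zigzags created by bending back and forth. *)
Lemma zigzags n s : cvl (n + s) s ++ [seq lA i | i <- rev (iota n s)] ~> [::].
Proof.
elim: s n => [|s IH] n; first exact: red_refl.
rewrite rev_iotaS /= -/(cvl _ _) addnS.
have far k p q : p <= q -> cvl q.+2 k ++ [:: lA p] ~> lA p :: cvl q k.
  elim: k q => [|k IHk] q pq; first exact: red_refl.
  rewrite !cvlS; apply: red_trans (red_cons _ (IHk q.+1 _)) _; first lia.
  exact: (red_at (a := [::]) (b := cvl q.+1 k) (far_UA pq) (red_refl _)).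
have r1 := red_cons (lU (n + s).+1) (red_catr [seq lA i | i <- rev (iota n s)] (far s _ _ (leqnn (n + s)))).
rewrite -catA /= in r1; apply: (red_trans r1).
apply: (red_at (a := [::]) (b := cvl (n + s) s ++ [seq lA i | i <- rev (iota n s)])
  (red_zigzag2 (n + s))).
exact: IH.
Qed.

Lemma zigzags' n s : cvl n s ++ [seq lA i | i <- rev (iota (n + s) s)] ~> [::].
Proof.
elim: s n => [|s IH] n; first exact: red_refl.
rewrite cvlS rev_iotaS /=.
have far k p q : p <= q -> cvl p k ++ [:: lA (q + k.*2)] ~> lA q :: cvl p k.
  elim: k p q => [|k IHk] p q pq; first by rewrite /= addn0; exact: red_refl.
  rewrite cvl_rcons -catA /=.
  have r1 : [:: lU (p + k); lA (q + k.+1.*2)] ~> [:: lA (q + k.*2); lU (p + k)].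
    have := @red_far' gU gA (p + k) (q + k.+1.*2); rewrite /= subn2 addn0 doubleS !addnS /=.
    by apply; lia.
  apply: red_trans (red_catl _ r1) _.
  rewrite -[_ :: [:: lU _]]/([:: lA (q + k.*2)] ++ [:: lU (p + k)]) catA.
  apply: (@red_catr [:: lU (p + k)] _ (lA q :: cvl p k)).
  exact: IHk.
have r1 := red_cons (lU n) (red_catr [seq lA i | i <- rev (iota (n + s.+1) s)] (far s _ _ (leqnn n.+1))).
have qE : n.+1 + s.*2 = n + s.+1 + s by rewrite -addnn; lia.
rewrite qE -catA /= in r1; apply: (red_trans r1).
apply: (red_at (a := [::]) (b := cvl n.+1 s ++ [seq lA i | i <- rev (iota (n + s.+1) s)])
  (red_zigzag1 n)).
by rewrite (_ : n + s.+1 = n.+1 + s); [exact: IH | lia].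
Qed.

Lemma unbend_bend m s l : valid m l -> nxts m l = s ->
  cvl m s ++ l ++ evl s ~> l.
Proof.
move=> vl nl; have := red_exchange (cvl 0 s) vl nl; rewrite !shift_cvl !addn0 => r.
rewrite catA; apply: (red_trans (red_catr (evl s) r)); rewrite -catA.
by have := red_catl l (zigzags 0 s); rewrite cats0.
Qed.

Lemma cvl_dims M n s : n <= M -> valid M (cvl n s) /\ nxts M (cvl n s) = M + s.*2.
Proof.
elim: s M n => [|s IH] M n h; first by rewrite /= addn0.
rewrite cvlS /= /fits /nxt /= subn0; have [|-> ->] := IH (M + 2) n.+1; first lia.
by split; lia.
Qed.

Lemma evl_dims s : valid (s + s) (evl s) /\ nxts (s + s) (evl s) = 0.
Proof.
elim: s => // s [v e]; rewrite evlS /= /fits /nxt /=.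
rewrite (_ : s.+1 + s.+1 - 2 + 0 = s + s); last lia.
by rewrite v e; split; lia.
Qed.

Lemma bend_dims m s l : valid m l -> nxts m l = s ->
  valid (m + s) (l ++ evl s) /\ nxts (m + s) (l ++ evl s) = 0.
Proof.
move=> v e; have [v' e'] := evl_dims s.
by rewrite valid_cat nxts_cat valid_wide // nxts_wide // e.
Qed.

Lemma unbend_dims m s l : valid (m + s) l -> nxts (m + s) l = 0 ->
  valid m (cvl m s ++ l) /\ nxts m (cvl m s ++ l) = s.
Proof.
move=> v e; have [v' e'] := cvl_dims s (leqnn m).
rewrite valid_cat nxts_cat v' e' -addnn addnA valid_wide // nxts_wide // e.
by [].
Qed.

Lemma bend_unbend K m s l : valid (m + s) l -> nxts (m + s) l = 0 ->
  run K (m + s) ((cvl m s ++ l) ++ evl s) = run K (m + s) l.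
Proof.
move=> vl nl; rewrite -catA.
have vB : valid (m + s) (cvl m s ++ shift (m + s) (evl s) ++ l).
  have [v' e'] := cvl_dims s (leq_addr s m).
  have [v2 e2] := evl_dims s.
  rewrite !valid_cat v' e' (_ : m + s + s.*2 = m + s + (s + s)); last by rewrite -addnn.
  by rewrite valid_shift // nxts_shift // e2 addn0.
have r1 := red_catl (cvl m s) (red_exchange (evl s) vl nl); rewrite shift0 in r1.
have [_ _ <-] := redP r1 vB.
have r2 : cvl m s ++ shift (m + s) (evl s) ++ l ~> l.
  rewrite catA; have := red_catr l (zigzags' m s).
  have -> // : [seq lA i | i <- rev (iota (m + s) s)] = shift (m + s) (evl s).
  by rewrite /shift /evl -map_comp -{1}[m + s]addn0 iotaDl -map_rev -map_comp.
by have [_ _ ->] := redP r2 vB.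
Qed.

(** * Matchings of undotted pictures *)

Definition nodots (l : seq layer) : bool := all (fun x => ~~ isX x.1) l.

Lemma dot_free_layers m s (d : diag m s) : dot_free d = nodots (layers d).
Proof.
rewrite /dot_free; elim: d => //=.
- by move=> n; apply/forallP.
- by apply/forallP.
- by apply/forallP.
- by apply/forallP.
- by apply/negbTE/forallPn; exists tt.
- move=> ? ? ? g hg h hh; rewrite /nodots all_cat -/(nodots _) -/(nodots _) -hg -hh.
  apply/forallP/andP => [H|[/forallP H1 /forallP H2] [a|a] //].
    by split; apply/forallP=> a; [apply: (H (inr a)) | apply: (H (inl a))].
- move=> m1 s1 m2 s2 g hg h hh; rewrite /nodots all_cat all_map.
  rewrite -[all (preim _ _) _]/(nodots _) -/(nodots _) -hg -hh.
  apply/forallP/andP => [H|[/forallP H1 /forallP H2] [a|a] //].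
    by split; apply/forallP=> a; [apply: (H (inr a)) | apply: (H (inl a))].
Qed.

Lemma nodots_evl s : nodots (evl s).
Proof. by rewrite /nodots all_map; apply/allP. Qed.

Lemma nodots_dots l : nodots l = (dots l == 0).
Proof. by rewrite /nodots (all_predC (fun x => isX x.1)) has_count -leqNgt leqn0. Qed.

Lemma act_nodots (I : finType) l phi : nodots l ->
  forall y : I -> rat, act (opZ y) l phi = act (@op I) l phi.
Proof.
move=> + y; elim: l phi => //= -[g p] l IH phi /andP[gX /IH->]; congr act.
by case: g gX.
Qed.

(** Words that are equal in the category over the rationals act equally. *)
Lemma run_act (I : finType) (y : I -> rat) M l l' :
    valid M l -> valid M l' -> nodots l -> nodots l' -> run rat M l = run rat M l' ->
  act (opZ y) l = act (opZ y) l'.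
Proof.
move=> v v' n n' e; apply: funext => phi; rewrite !act_nodots //.
have [d dE] := word_exists v; have [d' dE'] := word_exists v'.
have ns : nxts M l' = nxts M l by rewrite -(run_cod rat v) e run_cod.
have em : M = M by [].
pose d2 := cast2 em ns d'.
have dE2 : layers d2 = l' by rewrite layers_cast.
have := e; rewrite -{1}dE -dE2 -!run_layers => /Mor_inj/Hom_eqP h.
have := T_sound I idfun h 0; rewrite !T_layers !shift0 dE dE2.
by move=> /(congr1 (fun f => f phi)).
Qed.

Section NfAction.
Context (I : finType) (R : comPzRingType) (y : I -> R).
Implicit Types (v w : nat -> I) (phi : (nat -> I) -> R).

Lemma act_scale l c phi :
  act (opZ y) l (fun w => c * phi w)%R = (fun w => c * act (opZ y) l phi w)%R.
Proof.
elim: l phi => //= -[g p] l IH phi /=; rewrite -IH; congr act; apply: funext => w.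
case: g => /=.
- by rewrite /opU; case: ifP => // _; rewrite mulr0.
- by rewrite /opA mulr_sumr.
- by [].
- by rewrite mulrCA.
Qed.

Definition mvw j w : nat -> I :=
  fun k => if k == 0 then w 0 else if k < j then w k.+1 else if k == j then w 1 else w k.

Lemma act_mv j phi w : 0 < j -> act (opZ y) (mv 1 j) phi w = phi (mvw j w).
Proof.
elim: j phi => // j IH phi _; case: (posnP j) => [->|j0].
  by rewrite mvnn /=; congr phi; rewrite /mvw; apply: funext => -[|[|k]].
rewrite mvS //= IH // /opS /opP; congr phi; rewrite /mvw; apply: funext => k.
by rewrite /tr; case: (ltngtP k j) => h; iflia; rewrite ?h //; case: (ltngtP k j.+1) => h'; iflia => //; lia.
Qed.

Definition rem2 j v : nat -> I := fun k => if k.+1 < j then v k.+1 else v k.+2.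

Fixpoint mcons (mu : seq nat) v : bool :=
  if mu is j :: mu' then (v 0 == v j) && mcons mu' (rem2 j v) else true.

Definition indicN M v : (nat -> I) -> R := indic R (fun i : 'I_M => v i).

Lemma act_capw M j v w : 0 < j < M -> act (opZ y) (capw j) (indicN M v) w
  = ((v 0 == v j)%:R * indicN (M - 2) (rem2 j v) w)%R.
Proof.
move=> hj; rewrite /capw act_cat /= /opA.
have E a : act (opZ y) (mv 1 j) (indicN M v) (ins 0 a w) =
    (((a == v 0) && (a == v j))%:R * indicN (M - 2) (rem2 j v) w)%R.
  rewrite act_mv; last lia.
  rewrite /indicN /indic -natrM mulnb; congr (nat_of_bool _)%:R%R.
  apply/forallP/andP.
    move=> H; split.
      apply/andP; split.
        by have := H (@Ordinal M 0 ltac:(lia)).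
      have := H (@Ordinal M j ltac:(lia)); rewrite /= /mvw /ins.
      by iflia.
    apply/forallP=> i; have hi := ltn_ord i; rewrite /rem2; case: ltnP => hij.
      have := H (@Ordinal M i.+1 ltac:(lia)); rewrite /= /mvw /ins; iflia.
      by rewrite subn2.
    have := H (@Ordinal M i.+2 ltac:(lia)); rewrite /= /mvw /ins; iflia.
    by rewrite subn2.
  case=> /andP[h0 hj'] /forallP H i; have hi := ltn_ord i.
  rewrite /mvw /ins; case: (eqVneq (nat_of_ord i) 0) => [->|i0] //=.
  case: (ltngtP i j) => hij.
  - have := H (@Ordinal (M - 2) (i - 1) ltac:(lia)); rewrite /= /rem2; iflia.
    rewrite (_ : (i - 1).+1 = i); last lia.
    by rewrite subSS.
  - have := H (@Ordinal (M - 2) (i - 2) ltac:(lia)); rewrite /= /rem2; iflia.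
    by move=> /eqP->; apply/eqP; congr v; lia.
  - by rewrite hij; iflia.
under eq_bigr => a _ do rewrite E.
rewrite -big_distrl /=; congr (_ * _)%R.
rewrite (bigD1 (v 0)) //= eqxx /= big1 ?addr0 // => a /negbTE->.
by [].
Qed.

Lemma act_nf M mu v w : vnf M mu ->
  act (opZ y) (nf mu) (indicN M v) w = (mcons mu v)%:R%R.
Proof.
elim: mu M v => [|j mu IH] M v /=.
  move=> /eqP->; rewrite /indicN /indic (_ : [forall i, _] = true) //.
  by apply/forallP; case.
case/andP=> hj vm; rewrite /nf /= act_cat.
have -> : act (opZ y) (capw j) (indicN M v) =
   (fun w => (v 0 == v j)%:R * indicN (M - 2) (rem2 j v) w)%R.
  by apply: funext => w'; apply: act_capw.
by rewrite act_scale (IH _ _ vm) -natrM mulnb.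
Qed.

Definition mpos m s (p : 'I_m + 'I_s) : nat :=
  match p with inl i => i | inr k => m + (s - k.+1) end.

Lemma act_evl s phi (g : (nat -> I) -> R) (t : nat -> I) u :
    (forall x x', (forall k, k < s -> x k = x' k) -> g x = g x') ->
    (forall x, phi x = (g x * [forall i : 'I_s, x (s + i) == t i]%:R)%R) ->
  act (opZ y) (evl s) phi u = g (fun k => t (s - k.+1)).
Proof.
elim: s phi g t => [|s IH] phi g t hg hphi.
  rewrite /= hphi (_ : [forall i, _] = true) ?mulr1; last by apply/forallP; case.
  exact: hg.
rewrite evlS /=.
rewrite (IH _ (fun x => g (fun k => if k == s then t 0 else x k)) (fun i => t i.+1)).
- apply: hg => k hk; case: eqP => [->|ks]; first by rewrite subnn.
  by congr t; lia.
- move=> x x' h; apply: hg => k hk; case: eqP => // ks; apply: h; lia.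
- move=> x; rewrite /opA (bigD1 (t 0)) //= [X in (_ + X)%R]big1 ?addr0.
    rewrite hphi; congr (_ * (nat_of_bool _)%:R)%R.
      by apply: hg => k hk; rewrite /ins; case: eqP => [->|ks]; iflia.
    apply/forallP/forallP => H i; have hi := ltn_ord i.
      have := H (lift ord0 i); rewrite /ins /= /bump /=; iflia.
      by rewrite add1n (_ : s.+1 + i.+1 - 2 = s + i) //; lia.
    case: (unliftP ord0 i) => [k ->|->].
      have := H k; rewrite /ins /= /bump /=; iflia.
      by rewrite add1n (_ : s.+1 + k.+1 - 2 = s + k) //; lia.
    by rewrite /ins /=; iflia.
  move=> a an; rewrite hphi (_ : [forall i, _] = false) ?mulr0 //.
  apply/forallP=> /(_ ord0); rewrite /ins /=; iflia.
  by rewrite (negbTE an).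
Qed.

Lemma bend_zc m s (d : diag m s) v u :
  act (opZ y) (layers d ++ evl s) (indicN (m + s) v) u = zc d y (fun p => v (mpos p)).
Proof.
rewrite act_cat.
pose g x := act (opZ y) (layers d) (indicN m v) x.
rewrite (@act_evl s _ g (fun i => v (m + i))).
- rewrite /g /indicN act_zc; congr zc; apply: funext => -[i|k] //=.
- move=> x x' h; rewrite /g /indicN !act_zc; congr zc; apply: funext => -[i|k] //.
  by apply: h; apply: ltn_ord.
- move=> x; rewrite /g -[layers d]shift0 !act_colour big_distrl /=; apply: eq_bigr => f _.
  rewrite -mulrA; congr (_ * _)%R; rewrite /indicN /indic -natrM mulnb.
  congr (nat_of_bool _)%:R%R; apply/forallP/andP.
    move=> H; split; apply/forallP=> i; have hi := ltn_ord i.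
      by have := H (lshift s i).
    have := H (rshift m i); rewrite /= wput_ge; last lia.
    by rewrite (_ : m + i - m + s = s + i) //; lia.
  case=> /forallP H1 /forallP H2 i; case: (split_ordP i) => k ->; first exact: H1.
  rewrite /= wput_ge; last lia.
  by rewrite (_ : m + k - m + s = s + k); [apply: H2 | lia].
Qed.

End NfAction.

Lemma mcons_prt (I : finType) M mu (v : nat -> I) : vnf M mu ->
  mcons mu v = [forall i : 'I_M, v (prt mu i) == v i].
Proof.
elim: mu M v => [|j mu IH] M v /=.
  by move=> /eqP->; apply/esym/forallP; case.
case/andP=> hj vm; rewrite (IH _ _ vm).
have [M0 jM] : 0 < M /\ j < M by lia.
apply/andP/forallP.
  case=> /eqP h0 /forallP H i; have hi := ltn_ord i.
  case: (@eqP _ (i : nat) 0) => [->|/eqP i0]; first by rewrite h0.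
  case: (@eqP _ (i : nat) j) => [->|/eqP ij]; first by rewrite h0.
  have [u uE] : exists u, (if i < j then i - 1 else i - 2) = u by eexists.
  have uM : u < M - 2 by rewrite -uE; case: ifP; lia.
  have := H (Ordinal uM); rewrite /= uE /rem2.
  have -> : (if u.+1 < j then v u.+1 else v u.+2) = v i.
    by rewrite -uE; case: (ltnP i j) => h; case: ifP => h'; congr v; lia.
  by case: ifP.
move=> H; split.
  by have := H (Ordinal M0); rewrite /= eq_sym.
apply/forallP=> u; have hu := ltn_ord u.
have [i iE] : exists i, (if u.+1 < j then u.+1 else u.+2) = i by eexists.
have iM : i < M by rewrite -iE; case: ifP; lia.
have := H (Ordinal iM); rewrite /=.
have -> : (i == 0) = false by rewrite -iE; case: ifP.
have -> : (i == j) = false by rewrite -iE; case: ifP; lia.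
have -> : (if i < j then i - 1 else i - 2) = u.
  by rewrite -iE; case: (ltnP u.+1 j) => h; case: ifP; lia.
have -> : v i = rem2 j v u by rewrite -iE /rem2; case: ifP.
by rewrite /rem2; case: ifP.
Qed.

(** A matching is determined by its partner function. *)
Lemma prt_inj M mu mu' : vnf M mu -> vnf M mu' ->
  (forall i, i < M -> prt mu i = prt mu' i) -> mu = mu'.
Proof.
elim: mu M mu' => [|j mu IH] M [|j' mu'] //=.
- by move=> /eqP->; lia.
- by move=> h /eqP hM; move: h; rewrite hM; lia.
case/andP=> hj v /andP[hj' v'] H.
have jj : j = j' by have := H 0; rewrite /=; apply; lia.
subst j'; congr cons; apply: (IH (M - 2)) => // u hu.
have [i iE] : exists i, (if u.+1 < j then u.+1 else u.+2) = i by eexists.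
have iM : i < M by rewrite -iE; case: ifP; lia.
have := H i iM.
have -> : (i == 0) = false by rewrite -iE; case: ifP.
have -> : (i == j) = false by rewrite -iE; case: ifP; lia.
have -> : (if i < j then i - 1 else i - 2) = u.
  by rewrite -iE; case: (ltnP u.+1 j) => h; case: ifP; lia.
by case: ifP => h1; case: ifP => h2; lia.
Qed.

Lemma mpos_lt m s (p : 'I_m + 'I_s) : mpos p < m + s.
Proof. by case: p => [i|k] /=; [have := ltn_ord i | have := ltn_ord k]; lia. Qed.

Lemma mpos_inj m s : injective (@mpos m s).
Proof.
move=> [i|k] [i'|k'] /= h.
- by congr inl; apply: val_inj.
- by have := ltn_ord i; have := ltn_ord k'; lia.
- by have := ltn_ord k; have := ltn_ord i'; lia.
- by congr inr; apply: val_inj => /=; have := ltn_ord k; have := ltn_ord k'; lia.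
Qed.

Lemma mpos_surj m s i : i < m + s -> exists p : 'I_m + 'I_s, mpos p = i.
Proof.
move=> h; case: (ltnP i m) => hi; first by exists (inl (Ordinal hi)).
have hk : m + s - i.+1 < s by lia.
by exists (inr (Ordinal hk)); rewrite /=; lia.
Qed.

Definition mval_of (I : Type) (c0 : I) m s (w : 'I_m + 'I_s -> I) (k : nat) : I :=
  if [pick p | mpos p == k] is Some p then w p else c0.

Lemma mval_ofE (I : Type) (c0 : I) m s (w : 'I_m + 'I_s -> I) p :
  mval_of c0 w (mpos p) = w p.
Proof.
rewrite /mval_of; case: pickP => [q /eqP/mpos_inj->//|/(_ p)].
by rewrite eqxx.
Qed.

(** The strands of an undotted picture can be read off its bent standard form. *)
Lemma zc_bent (I : finType) (y : I -> rat) m s (d : diag m s) mu b v :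
    dot_free d -> vnf (m + s) mu ->
    run rat (m + s) (layers d ++ evl s) = run rat (m + s) (nf mu ++ bubs (nseq b 0)) ->
  zc d y (fun p => v (mpos p)) = ((mcons mu v)%:R * #|I|%:R ^+ b)%R.
Proof.
move=> df vm e; have [vb _] := bend_dims (layers_valid d) (nxts_layers d).
have [vn en] := valid_nf vm; have [vbub _] := bubs_dims (nseq b 0) 0.
rewrite -(bend_zc y d v v).
have -> : act (opZ y) (layers d ++ evl s) = act (opZ y) (nf mu ++ bubs (nseq b 0)).
  apply: (run_act _ vb _ _ _ e).
  - by rewrite valid_cat vn en.
  - by rewrite /nodots all_cat -/(nodots _) -dot_free_layers df -/(nodots _) nodots_evl.
  - by rewrite nodots_dots dots_cat dots_nf dots_bubs sumn_nseq.
rewrite act_cat act_bubs (act_nf _ _ _ vm) mulrC; congr (_ * _)%R.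
rewrite big_nseq (_ : psum y 0 = #|I|%:R)%R ?iter_mulr_1 //.
by rewrite /psum (eq_bigr (fun=> 1%R)) ?sumr_const ?cardT // => c _; rewrite expr0.
Qed.

Lemma strands_nf m s (d : diag m s) mu : dot_free d -> vnf (m + s) mu ->
    run rat (m + s) (layers d ++ evl s) = run rat (m + s) (nf mu) ->
  bubble_free d /\ forall p q, same_strand (endpt d p) (endpt d q)
     = (mpos p == mpos q) || (mpos p == prt mu (mpos q)).
Proof.
move=> df vm e.
have zE I y v : zc d y (fun p => v (mpos p)) = (mcons (I := I) mu v)%:R%R :> rat.
  by rewrite (@zc_bent I y m s d mu 0 v df vm) ?mulr1 //= cats0.
have bf : bubble_free d.
  have mc : mcons mu (fun _ => true).
    by rewrite (mcons_prt _ vm); apply/forallP=> i; rewrite eqxx.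
  have := zE _ (fun=> 1%R) (fun=> true); rewrite mc (zc_consistent _ true); last first.
    by apply/forallP=> p; apply/forallP=> q; apply/implyP.
  rewrite big1 ?mul1r; last by move=> x _; rewrite big1 // => c _; rewrite expr1n.
  rewrite (eq_bigr (fun=> 2%:R%R)); last first.
    move=> k _; rewrite /psum (eq_bigr (fun=> 1%R)) ?sumr_const ?card_bool // => c _.
    by rewrite expr1n.
  rewrite big_const_seq count_predT iter_mulr_1 size_map -cardE /bubble_free.
  rewrite -[in RHS](expr0 2%:R%R) => /(@ieexprIn _ 2%:R%R) -> //.
split=> // p q; apply/idP/orP.
- move=> pq.
  pose v k : 'I_(m + s).+1 := inord (minn k (prt mu k)).
  have mc : mcons mu v.
    rewrite (mcons_prt _ vm); apply/forallP=> i; rewrite /v (prtK vm) //.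
    by rewrite minnC.
  have := zE _ (fun=> 1%R) v; rewrite mc (zc_dotfree _ ord0) //.
  case cw: (consistent d _) => // _.
  move/forallP: cw => /(_ p)/forallP/(_ q)/implyP/(_ pq)/eqP/(congr1 val).
  have hp := mpos_lt p; have hq := mpos_lt q.
  have hp' := prt_lt vm hp; have hq' := prt_lt vm hq.
  rewrite /v /= !inordK; try (by rewrite /minn; case: ifP; lia).
  have Kp := prtK vm hp; have Kq := prtK vm hq.
  move=> h; have [->|h1] := eqVneq (mpos p) (mpos q); first by left.
  right; have [->|<-] : mpos p = prt mu (mpos q) \/ prt mu (mpos p) = mpos q.
  + move: h; rewrite /minn; case: ifP => _; case: ifP => _ h; [lia|by left|by right|].
    by case/eqP: h1; rewrite -Kp h Kq.
  + by rewrite eqxx.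
  + by rewrite Kp.
- move=> h.
  pose w r := same_strand (endpt d p) (endpt d r).
  have cw : consistent d w.
    apply/forallP=> a; apply/forallP=> c; apply/implyP=> ac; apply/eqP.
    apply/idP/idP => pa; first exact: same_strand_trans pa ac.
    by apply: same_strand_trans pa _; rewrite same_strand_sym.
  have := zE _ (fun=> 1%R) (mval_of true w).
  rewrite (_ : (fun p => _) = w); last by apply: funext => r; rewrite mval_ofE.
  rewrite (zc_dotfree _ true) // cw; case mc: (mcons mu _) => // _.
  case: h => [/eqP/mpos_inj->|/eqP pq]; first exact: same_strand_refl.
  move: mc; rewrite (mcons_prt _ vm) => /forallP/(_ (Ordinal (mpos_lt q))) /=.
  rewrite -pq !mval_ofE => /eqP; rewrite -/(w q) => <-.
  exact: same_strand_refl.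
Qed.

Lemma exists_nf m s (d : diag m s) : dot_free d -> bubble_free d ->
  exists2 mu, vnf (m + s) mu & layers d ++ evl s ~> nf mu.
Proof.
move=> df bf; have [vb eb] := bend_dims (layers_valid d) (nxts_layers d).
have [|mu [b [vm r]]] := straighten _ vb eb.
  by rewrite all_cat -/(nodots _) -dot_free_layers df -/(nodots _) nodots_evl.
have [_ _ /(_ rat) e] := redP r vb.
have := @zc_bent bool (fun=> 1%R) m s d mu b (fun=> true) df vm e.
rewrite (mcons_prt _ vm) (zc_dotfree _ true) //.
rewrite (_ : consistent d _ = true); last by apply/forallP=> p; apply/forallP=> q; apply/implyP.
rewrite (_ : [forall i, _] = true); last by apply/forallP=> i; rewrite eqxx.
rewrite mul1r card_bool -[in LHS](expr0 2%:R%R) => /(@ieexprIn _ 2%:R%R) b0.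
by exists mu => //; move: r; rewrite -b0 // cats0.
Qed.

(** Undotted pictures without bubbles that match their endpoints in the same way
    represent the same morphism. *)
Lemma coherence m s (d d' : diag m s) :
    dot_free d -> bubble_free d -> dot_free d' -> bubble_free d' ->
    (forall p q, same_strand (endpt d p) (endpt d q) = same_strand (endpt d' p) (endpt d' q)) ->
  forall K, run K m (layers d) = run K m (layers d').
Proof.
move=> df bf df' bf' H K.
have [mu vm r] := exists_nf df bf; have [mu' vm' r'] := exists_nf df' bf'.
have [vb eb] := bend_dims (layers_valid d) (nxts_layers d).
have [vb' eb'] := bend_dims (layers_valid d') (nxts_layers d').
have [_ _ e] := redP r vb; have [_ _ e'] := redP r' vb'.
have [_ S] := strands_nf df vm (e rat); have [_ S'] := strands_nf df' vm' (e' rat).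
have mm : mu = mu'.
  apply: (prt_inj vm vm') => i hi.
  have [p pE] := mpos_surj hi; have [q qE] := mpos_surj (prt_lt vm hi).
  have := S q p; rewrite H S' qE pE eqxx orbT (negbTE (prt_neq vm hi)) /=.
  by move/eqP.
subst mu'.
have u := unbend_bend (layers_valid d) (nxts_layers d).
have u' := unbend_bend (layers_valid d') (nxts_layers d').
have [v1 n1] := cvl_dims s (leqnn m).
have vu : valid m (cvl m s ++ layers d ++ evl s).
  by rewrite valid_cat v1 n1 -addnn addnA -[layers d ++ _]cats0 cats0 valid_wide.
have vu' : valid m (cvl m s ++ layers d' ++ evl s).
  by rewrite valid_cat v1 n1 -addnn addnA valid_wide.
have [_ _ <-] := redP u vu; have [_ _ <-] := redP u' vu'.
have [_ _ ->] := redP (red_catl (cvl m s) r) vu.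
by have [_ _ ->] := redP (red_catl (cvl m s) r') vu'.
Qed.

(*BEGIN*)
(** * Normally ordered pictures *)

Lemma layers_dpow m (f : diag m m) n : layers (dpow f n) = flatten (nseq n (layers f)).
Proof.
elim: n => //= n IH; rewrite -/(dpow f n) IH.
by elim: n {IH} => [|n IH] /=; rewrite ?cats0 // -catA IH.
Qed.

Lemma layers_dot_at m (k : 'I_m) : layers (dot_at k) = xs [:: nat_of_ord k].
Proof. by rewrite /dot_at layers_cast /= /shift /= addn0. Qed.

Definition dotlist m (a : 'I_m -> nat) : seq nat :=
  flatten [seq nseq (a k) (nat_of_ord k) | k <- enum 'I_m].

Lemma layers_dot_row m (a : 'I_m -> nat) : layers (dot_row a) = xs (dotlist a).
Proof.
rewrite /dot_row /dotlist -[RHS]cat0s -[[::] in RHS]/(layers (dId m)).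
elim: (enum _) (dId m) => [|k e IH] f /=; first by rewrite cats0.
rewrite IH /= layers_dpow layers_dot_at xs_cat catA; congr ((_ ++ _) ++ _).
by rewrite -xs_nseq; elim: (a k) => //= n ->.
Qed.

Lemma layers_Delta k : layers (Delta k) = bub k.
Proof.
rewrite /= layers_dpow /bub /=; congr (_ :: _ ++ _).
by elim: k => //= k ->.
Qed.

Definition bks (k : seq nat) : seq nat :=
  foldr (fun i s => s ++ nseq (nth 0 k i) i.*2) [::] (iota 0 (size k)).

Lemma layers_bubble_row k : layers (bubble_row k) = bubs (bks k).
Proof.
rewrite /bubble_row /bks; elim: (iota 0 (size k)) => //= i e IH.
rewrite -/(layers _) IH bubs_cat; congr cat; rewrite layers_dpow layers_Delta.
by elim: (nth 0 k i) => //= n ->; rewrite bubs_cons.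
Qed.

Definition ndiag m s k (a : 'I_s -> nat) (d : diag m s) (b : 'I_m -> nat) : diag m s :=
  (bubble_row k ⊗ (dot_row a ∘ d ∘ dot_row b))%D.

Lemma layers_ndiag m s k a (d : diag m s) b : layers (ndiag k a d b) =
  xs (dotlist b) ++ layers d ++ xs (dotlist a) ++ bubs (bks k).
Proof.
rewrite [LHS]/= -!/(layers _) layers_bubble_row !layers_dot_row shift0.
by rewrite !catA.
Qed.

Lemma prod_dotlist (R : comPzRingType) m (a : 'I_m -> nat) (F : nat -> R) :
  (\prod_(i <- dotlist a) F i = \prod_k F (nat_of_ord k) ^+ a k)%R.
Proof.
rewrite /dotlist big_flatten big_map big_enum /=; apply: eq_bigr => k _.
by rewrite big_nseq iter_mulr_1.
Qed.

Definition label m s (a : 'I_s -> nat) (b : 'I_m -> nat) (p : 'I_m + 'I_s) : nat :=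
  match p with inl j => b j | inr i => a i end.

Section NDStates.
Context (m s : nat) (k : seq nat) (a : 'I_s -> nat) (d : diag m s) (b : 'I_m -> nat).
Local Notation D := (ndiag k a d b).

Lemma zc_ndiag (I : finType) (R : comPzRingType) (y : I -> R) (c0 : I) w :
    dot_free d -> bubble_free d ->
  zc D y w = ((\prod_(k <- bks k) psum y k) * (\prod_p y (w p) ^+ label a b p)
              * (consistent d w)%:R)%R.
Proof.
move=> df bf.
pose u j := if insub j is Some i then w (inr i) else c0.
have uE i : u (nat_of_ord i) = w (inr i) by rewrite /u valK.
have wE d' : zc d' y w = act (opZ y) (layers d') (indic R (fun i => w (inl i))) u.
  by rewrite act_zc; congr zc; apply: funext => -[|] //= i; rewrite uE.
rewrite wE layers_ndiag !act_cat act_bubs act_xs prod_dotlist -mulrA; congr (_ * _)%R.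
have -> : act (opZ y) (xs (dotlist b)) (indic R (fun i => w (inl i))) =
  (fun x => (\prod_j y (w (inl j)) ^+ b j) * indic R (fun i => w (inl i)) x)%R.
  apply: funext => x; rewrite act_xs prod_dotlist /indic.
  case: forallP => [H|_]; last by rewrite !mulr0.
  by congr (_ * _)%R; apply: eq_bigr => j _; rewrite (eqP (H j)).
rewrite act_scale -wE (zc_dotfree _ c0) // mulrA; congr (_ * _)%R.
rewrite big_sumType /= mulrC; congr (_ * _)%R.
by apply: eq_bigr => i _; rewrite uE.
Qed.

End NDStates.

Section NDData.
Context m s (k k' : seq nat) (a a' : 'I_s -> nat) (d d' : diag m s) (b b' : 'I_m -> nat).
Hypotheses (df : dot_free d) (bf : bubble_free d) (df' : dot_free d') (bf' : bubble_free d').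
Hypotheses (ha : forall i, left_of_cup d i -> a i = 0)
           (hb : forall j, right_of_cap d j || on_vertical d j -> b j = 0).
Hypotheses (ha' : forall i, left_of_cup d' i -> a' i = 0)
           (hb' : forall j, right_of_cap d' j || on_vertical d' j -> b' j = 0).

(** The end of each strand at which its dots are placed. *)
Definition dot_end (e : diag m s) (p : 'I_m + 'I_s) : bool :=
  match p with
  | inl j => ~~ (right_of_cap e j || on_vertical e j)
  | inr i => ~~ left_of_cup e i
  end.

Lemma dot_end_uniq e p q : dot_end e p -> q != p ->
  same_strand (endpt e p) (endpt e q) -> ~~ dot_end e q.
Proof.
case: p => [j|i]; case: q => [j'|i'] hp qp pq; apply/negPn; move: hp qp pq => /=.
- rewrite negb_or => /andP[h _] jj sj; apply/orP; left.
  case: (ltngtP j j') => [lt|lt|/val_inj e'].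
  + by apply/existsP; exists j; rewrite lt.
  + by case/negP: h; apply/existsP; exists j'; rewrite lt same_strand_sym.
  + by rewrite e' eqxx in jj.
- by rewrite negb_or => /andP[_ /negP h] _ sj; case: h; apply/existsP; exists i'.
- by move=> _ _ sj; apply/orP; right; apply/existsP; exists i; rewrite same_strand_sym.
- move=> h ii si; case: (ltngtP i i') => [lt|lt|/val_inj e'].
  + by case/negP: h; apply/existsP; exists i'; rewrite lt.
  + by apply/existsP; exists i; rewrite lt same_strand_sym.
  + by rewrite e' eqxx in ii.
Qed.

Lemma dot_end_label e (a0 : 'I_s -> nat) (b0 : 'I_m -> nat) p :
    (forall i, left_of_cup e i -> a0 i = 0) ->
    (forall j, right_of_cap e j || on_vertical e j -> b0 j = 0) ->
  label a0 b0 p = if dot_end e p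
    then \sum_(q | same_strand (endpt e p) (endpt e q)) label a0 b0 q else 0.
Proof.
move=> h0 h1; have z q : ~~ dot_end e q -> label a0 b0 q = 0.
  by case: q => [j|i] /=; rewrite negbK; [apply: h1 | apply: h0].
case: ifP => hp; last by apply: z; rewrite hp.
rewrite (bigD1 p) ?same_strand_refl //= big1 ?addn0 // => q /andP[pq qp].
by apply: z; apply: dot_end_uniq hp qp pq.
Qed.

Lemma labels_eq :
    (forall p q, same_strand (endpt d p) (endpt d q) = same_strand (endpt d' p) (endpt d' q)) ->
    (forall p, \sum_(q | same_strand (endpt d p) (endpt d q)) label a b q =
               \sum_(q | same_strand (endpt d' p) (endpt d' q)) label a' b' q) ->
  a = a' /\ b = b'.
Proof.
move=> ss hs; have de p : dot_end d p = dot_end d' p.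
  case: p => [j|i] /=; congr negb; [congr orb|]; apply: eq_existsb => x.
  + by rewrite (ss (inl x) (inl j)).
  + by rewrite (ss (inl j) (inr x)).
  + by rewrite (ss (inr i) (inr x)).
have lab p : label a b p = label a' b' p.
  by rewrite (dot_end_label _ ha hb) (dot_end_label _ ha' hb') de hs.
by split; apply: funext => i; [apply: (lab (inr i)) | apply: (lab (inl i))].
Qed.

Lemma dequiv_ndiag : dequiv (ndiag k a d b) (ndiag k' a' d' b') <->
  [/\ forall p q, same_strand (endpt d p) (endpt d q) = same_strand (endpt d' p) (endpt d' q),
      a = a', b = b' & perm_eq (bks k) (bks k')].
Proof.
have DE I R y c0 w := @zc_ndiag m s k a d b I R y c0 w df bf.
have DE' I R y c0 w := @zc_ndiag m s k' a' d' b' I R y c0 w df' bf'.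
split.
- case/and3P=> /forallP h1 /forallP h2 h3.
  have ss p q : same_strand (endpt d p) (endpt d q) = same_strand (endpt d' p) (endpt d' q).
    by rewrite -(recover_strand DE) -(recover_strand DE'); apply/eqP/(forallP (h1 p)).
  have [|ea eb] := labels_eq ss.
    by move=> p; rewrite -(recover_dots DE) -(recover_dots DE'); apply/eqP.
  split=> //; have := recover_bubbles DE; have := recover_bubbles DE' => q' q.
    by rewrite -(permPl q) -(permPr q').
- case=> ss ea eb pk; apply/and3P; split.
  + apply/forallP=> p; apply/forallP=> q.
    by rewrite (recover_strand DE) (recover_strand DE') ss.
  + apply/forallP=> p; rewrite (recover_dots DE) (recover_dots DE') ea eb.
    by apply/eqP/eq_bigl => q; rewrite ss.
  + have := recover_bubbles DE; have := recover_bubbles DE' => q' q.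
    by rewrite (permPl q) (permPr q').
Qed.

End NDData.

Lemma bubs_perm w w' : perm_eq w w' -> bubs w ~> bubs w'.
Proof.
elim: w w' => [|i w IH] w' pw.
  by move/perm_size/esym/size0nil: pw => ->; apply: red_refl.
have iw : i \in w' by rewrite -(perm_mem pw) mem_head.
case/splitPr: w' / iw pw => w1 w2 pw.
have {pw} pw : perm_eq w (w1 ++ w2).
  by rewrite -(perm_cons i) (permPl pw) perm_sym -cat1s perm_catCA.
rewrite bubs_cons bubs_cat bubs_cons; apply: red_trans (red_catl (bub i) (IH _ pw)) _.
rewrite bubs_cat catA; apply: red_trans (red_catr (bubs w2) (bub_comm i (bubs w1))) _.
by rewrite -catA; apply: red_refl.
Qed.

Lemma dotlist_lt m (a : 'I_m -> nat) : all (fun i => i < m) (dotlist a).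
Proof.
by apply/allP=> i /flattenP[l /mapP[k _ ->]]; rewrite mem_nseq => /andP[_ /eqP->].
Qed.

(** Equivalent normally ordered pictures represent the same morphism. *)
Lemma hom_of_ndiag K m s k k' a a' (d d' : diag m s) b b' :
    dot_free d -> bubble_free d -> dot_free d' -> bubble_free d' ->
    (forall p q, same_strand (endpt d p) (endpt d q) = same_strand (endpt d' p) (endpt d' q)) ->
    a = a' -> b = b' -> perm_eq (bks k) (bks k') ->
  hom_of K (ndiag k a d b) = hom_of K (ndiag k' a' d' b').
Proof.
move=> df bf df' bf' ss <- <- pk; apply: Mor_inj; rewrite !run_layers !layers_ndiag.
have [vb nb] := valid_xs (dotlist_lt b); have [va na] := valid_xs (dotlist_lt a).
have tail k0 : valid s (xs (dotlist a) ++ bubs (bks k0)).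
  by rewrite valid_cat va na; have [] := bubs_dims (bks k0) s.
have vd (e : diag m s) k0 : valid m (layers e ++ xs (dotlist a) ++ bubs (bks k0)).
  by rewrite valid_cat layers_valid nxts_layers tail.
rewrite !(run_cat K vb) ?nb //; congr mcomp; rewrite ?nb.
rewrite (run_cat K (layers_valid d)) ?(run_cat K (layers_valid d')) ?nxts_layers // (coherence df bf df' bf' ss K); congr mcomp.
have [_ _ ->//] := redP (red_catl (xs (dotlist a)) (bubs_perm pk)) (tail k).
Qed.

(*BEGIN*)
(** * Normally ordered pictures span *)

Section CupDots.
Context (K : comPzRingType).
Local Notation slides := (slides K).

Lemma cvl_X q s p : p < q -> cvl q s ++ [:: lX p] ~> lX p :: cvl q s.
Proof.
elim: s q => [|s IH] q pq; first exact: red_refl.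
rewrite !cvlS; apply: red_trans (red_cons _ (IH q.+1 _)) _; first lia.
exact: (red_at (a := [::]) (b := cvl q.+1 s) (far_hX gU pq) (red_refl _)).
Qed.

Lemma X_cvl q s i : q <= i -> lX i :: cvl q s ~> cvl q s ++ [:: lX (i + s.*2)].
Proof.
elim: s q i => [|s IH] q i qi; first by rewrite addn0; exact: red_refl.
rewrite !cvlS; have := far_Xg gU qi; rewrite /= addn0 => r.
apply: (red_at (a := [::]) (b := cvl q.+1 s) r).
rewrite doubleS -(addn2 s.*2) (addnC s.*2) addnA.
by apply: (red_cons (lU q)); apply: IH; lia.
Qed.

(** A dot on a leg of one of the nested cups passes to its other leg. *)
Lemma slides_cvl m s j : j < s ->
  slides true (cvl m s ++ [:: lX (m + j)]) (cvl m s ++ [:: lX (m + s.*2 - j.+1)]).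
Proof.
elim: s m j => // s IH m [|j] hj; rewrite cvlS.
- rewrite addn0; apply: (@red_slides_trans _ _ _ ([:: lU m; lX m] ++ cvl m.+1 s)).
  + exact: (red_cons (lU m) (cvl_X s (ltnSn m))).
  + by rewrite !dotsE /= dots_cvl.
  apply: (slides_red_trans (slides_catr (cvl m.+1 s) (slides_UX K m))).
  + by rewrite !dotsE /= dots_cvl.
  have := red_cons (lU m) (X_cvl s (leqnn m.+1)).
  by rewrite (_ : m.+1 + s.*2 = m + s.+1.*2 - 1); last lia.
- have := slides_cons (lU m) (IH m.+1 j hj).
  rewrite (_ : m + j.+1 = m.+1 + j); last lia.
  by rewrite (_ : m + s.+1.*2 - j.+2 = m.+1 + s.*2 - j.+1); last lia.
Qed.

Definition low m (w : seq nat) := [seq i <- w | i < m].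
Definition high m s (w : seq nat) := [seq m + s - i.+1 | i <- w & m <= i].

Lemma size_low_high m s w : size (low m w) + size (high m s w) = size w.
Proof.
rewrite /low /high size_map !size_filter -(count_predC (fun i => i < m)).
by congr addn; apply: eq_count => i /=; rewrite -leqNgt.
Qed.

Lemma slides_unbend m s mu w : vnf (m + s) mu -> all (fun i => i < m + s) w ->
  exists b, slides b (cvl m s ++ xs w ++ nf mu)
                     (xs (low m w) ++ cvl m s ++ nf mu ++ xs (high m s w)).
Proof.
move=> vm; have [vn en] := valid_nf vm.
elim: w => [|i w IH] /=.
  by exists false; rewrite /= cats0; apply: slides_refl.
case/andP=> hi hw; have [b h] := IH hw; rewrite /low /high /=; case: (ltnP i m) => im /=.
- exists b; apply: (@red_slides_trans _ _ _ (lX i :: cvl m s ++ xs w ++ nf mu)).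
  + have := @red_catr (xs w ++ nf mu) _ _ (cvl_X s im).
    by rewrite -catA.
  + by rewrite !dotsE /= ?dotsE dots_cvl; lia.
  exact: (slides_cons (lX i) h).
- have hk : i - m < s by lia.
  have h1 := slides_catr (xs w ++ nf mu) (slides_cvl m hk).
  rewrite (subnKC im) -!catA /= in h1; exists (true (+) b); apply: (slides_trans h1).
  have [k kE] : exists k, m + s - i.+1 = k by eexists.
  have -> : m + s.*2 - (i - m).+1 = m + s + k by lia.
  rewrite kE.
  have r : lX (m + s + k) :: nf mu ~> nf mu ++ [:: lX k].
    have := @red_exchange (m + s) 0 (nf mu) (xs [:: k]) vn en.
    exact.
  have r1 : cvl m s ++ lX (m + s + k) :: xs w ++ nf mu ~>
            (cvl m s ++ xs w ++ nf mu) ++ [:: lX k].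
    rewrite -!catA; apply: red_catl.
    apply: red_trans (red_catr (nf mu) (xs_rcons _ w)) _; rewrite -catA.
    exact: red_catl.
  apply: (red_slides_trans r1); first by rewrite !dotsE /= ?dotsE; lia.
  apply: (slides_red_trans (slides_catr [:: lX k] h)); first by rewrite /low /high !dotsE /= ?dotsE; lia.
  rewrite -!catA; do 3 apply: red_catl; exact: xs_rconsV.
Qed.

End CupDots.

Lemma perm_count w N : all (fun i => i < N) w ->
  perm_eq (flatten [seq nseq (count_mem i w) i | i <- iota 0 N]) w.
Proof.
move=> /allP hw; apply/allP=> x _ /=; apply/eqP.
rewrite count_flatten -map_comp sumnE big_map.
rewrite (eq_bigr (fun i => if i == x then count_mem i w else 0)); last first.
  move=> i _ /=; rewrite count_nseq /=; case: eqP => _; lia.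
case: (ltnP x N) => hx.
  rewrite (bigD1_seq x) ?mem_iota ?iota_uniq //= eqxx big1 ?addn0 // => i /negbTE->.
  by [].
rewrite big1_seq => [|i]; last by rewrite mem_iota add0n; case: eqP => // ->; lia.
by apply/esym/count_memPn; apply/negP=> /hw; lia.
Qed.

Lemma dotlist_count m w : all (fun i => i < m) w ->
  perm_eq (dotlist (fun i : 'I_m => count_mem (nat_of_ord i) w)) w.
Proof. by move=> /perm_count; rewrite -val_enum_ord -map_comp. Qed.

Lemma bks_exists ks : exists k, perm_eq (bks k) (map double ks).
Proof.
pose N := (\max_(i <- ks) i).+1; exists (mkseq (fun i => count_mem i ks) N).
have hN : all (fun i => i < N) ks.
  by apply/allP=> i iks; rewrite ltnS; apply: leq_bigmax_seq.
rewrite -(permPr (perm_map double (perm_count hN))) /bks size_mkseq.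
have : all (fun i => i < N) (iota 0 N) by apply/allP=> i; rewrite mem_iota.
elim: (iota 0 N) => //= i r IH /andP[hi /IH{}IH].
rewrite nth_mkseq // map_cat map_nseq perm_catC perm_cat2l; exact: IH.
Qed.

(*BEGIN*)
Definition okd m (mu : seq nat) (i : nat) : bool :=
  if i < m then i < prt mu i < m else (prt mu i < m) || (i < prt mu i).

Lemma okd_prt m M mu i : vnf M mu -> i < M -> okd m mu i || okd m mu (prt mu i).
Proof.
move=> v hi; rewrite /okd (prtK v hi); have := prt_neq v hi.
by case: (ltnP i m); case: (ltnP (prt mu i) m); case: (ltngtP i (prt mu i)) => //; lia.
Qed.

Lemma nd_word m s mu w ks : vnf (m + s) mu ->
    all (fun i => (i < m + s) && okd m mu i) w ->
  exists2 D : diag m s, normally_ordered D & forall K, run K m (layers D) =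
    run K m (xs (low m w) ++ cvl m s ++ nf mu ++ xs (high m s w) ++ bubs (map double ks)).
Proof.
move=> vm /allP hw; have [vn en] := valid_nf vm.
have [vd nd] := unbend_dims vn en.
have [d dE] : exists d : diag m s, layers d = cvl m s ++ nf mu.
  by have := word_exists vd; rewrite nd.
have df : dot_free d by rewrite dot_free_layers dE nodots_dots dots_cat dots_cvl dots_nf.
have [bf ss] := strands_nf df vm (etrans (congr1 (fun l => run rat (m + s) (l ++ evl s)) dE)
                                         (bend_unbend rat vn en)).
have lw : all (fun i => i < m) (low m w) by apply/allP=> i; rewrite mem_filter => /andP[].
have hiw : all (fun i => i < s) (high m s w).
  by apply/allP=> i /mapP[j]; rewrite mem_filter => /andP[mj /hw/andP[]] + _ ->; lia.
have [k kE] := bks_exists ks.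
pose b (j : 'I_m) := count_mem (nat_of_ord j) (low m w).
pose a (i : 'I_s) := count_mem (nat_of_ord i) (high m s w).
exists (ndiag k a d b).
- apply: NormallyOrdered => // [i|j].
  + case/existsP=> i' /andP[ii]; rewrite (ss (inr i) (inr i')) /= => h.
    apply/count_memPn/negP=> /mapP[j]; rewrite mem_filter => /andP[mj jw] ij.
    have /andP[jms] := hw j jw; rewrite /okd ltnNge mj /=.
    have hi := ltn_ord i; have hi' := ltn_ord i'.
    have jE : m + (s - i.+1) = j by lia.
    move: h; rewrite jE => /orP[/eqP|/eqP] e; first by lia.
    have : prt mu j = m + (s - i'.+1) by rewrite e (prtK vm) //; lia.
    by move=> ->; lia.
  + move=> h; apply/count_memPn/negP; rewrite mem_filter => /andP[jm jw].
    have /andP[jms] := hw _ jw; rewrite /okd jm => /andP[h1 h2].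
    have pE q : same_strand (bot d j) (endpt d q) -> mpos q = j \/ mpos q = prt mu j.
      rewrite (ss (inl j) q) /= => /orP[/eqP->|/eqP e]; first by left.
      by right; rewrite e (prtK vm) //; apply: mpos_lt.
    case/orP: h => /existsP[x].
    * case/andP=> xj; rewrite same_strand_sym => /(pE (inl x)) /=; lia.
    * by move=> /(pE (inr x)) /=; lia.
- move=> K; rewrite layers_ndiag dE.
  have r : xs (low m w) ++ cvl m s ++ nf mu ++ xs (high m s w) ++ bubs (map double ks) ~>
      xs (dotlist b) ++ (cvl m s ++ nf mu) ++ xs (dotlist a) ++ bubs (bks k).
    apply: red_trans (red_catr _ (xs_perm _)) (red_catl _ _).
      by rewrite perm_sym; apply: dotlist_count.
    rewrite -!catA; do 2 apply: red_catl.
    apply: red_trans (red_catr _ (xs_perm _)) (red_catl _ _).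
      by rewrite perm_sym; apply: dotlist_count.
    by apply: bubs_perm; rewrite perm_sym.
  have v : valid m (xs (low m w) ++ cvl m s ++ nf mu ++ xs (high m s w) ++ bubs (map double ks)).
    have [v1 e1] := valid_xs lw; have [v2 e2] := valid_xs hiw.
    rewrite valid_cat v1 e1 catA valid_cat vd nd valid_cat v2 e2.
    by have [] := bubs_dims (map double ks) s.
  by have [_ _ ->] := redP r v.
Qed.

Section Span.
Context (K : comPzRingType) (half_unit : exists h : K, (2%:R * h = 1)%R).
Local Notation H := (ABHom K).

Definition nd_span m s (x : H m s) : Prop :=
  inspan (fun l => exists2 D : diag m s, normally_ordered D & layers D = l) x.

Lemma nd_span_word l m s (x : H m s) : valid m l -> nxts m l = s ->
  Mor x = run K m l -> nd_span x.
Proof.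
move: {2}(dots l) (leqnn (dots l)) => q.
elim/ltn_ind: q l x => q IH l x lq v n ex.
have [vb nb] := bend_dims v n.
have [z ez] : exists z : H (m + s) 0, Mor z = run K (m + s) (l ++ evl s) by apply: run_val.
have [vc nc] := cvl_dims s (leqnn m).
have ncE : nxts m (cvl m s) = m + s + s by rewrite nc -addnn addnA.
have [t et] : exists t : H m (m + s + s), Mor t = run K m (cvl m s) by apply: run_val.
pose unb (z' : H (m + s) 0) : H m s := hcomp (htens z' (\pi_(H s s) (tId K s))) t.
have unbE z' l' : valid (m + s) l' -> Mor z' = run K (m + s) l' ->
    Mor (unb z') = run K m (cvl m s ++ l').
  move=> v' e'; have uE : Mor (unb z') = mcomp (mtens (Mor z') (mid K s)) (Mor t).
    by rewrite mtensE; exact: esym (mcompE _ _).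
  rewrite uE e' et.
  rewrite (run_cat K vc) ncE; first by rewrite (run_wide K s v').
  exact: valid_wide.
have -> : x = unb z.
  apply: Mor_inj; rewrite (unbE _ _ vb ez) ex.
  have vu : valid m (cvl m s ++ l ++ evl s) by rewrite valid_cat vc ncE valid_wide.
  by have [_ _ ->] := redP (unbend_bend v n) vu.
have hz := words_span (@okd_prt m) half_unit (conj vb nb) ez.
rewrite dots_cat dots_evl addn0 in hz.
rewrite /unb; elim: hz => [|c y y' l0 [[mu [w [ks [vm hw lE]]]] dl0] v0 e0 _ IHy].
  by rewrite htens0l hcomp0l; apply: inspan0.
rewrite htensDZl hcompDZl; apply: inspanD IHy; apply: inspanZ.
rewrite -/(unb y); have eu := unbE _ _ v0 e0.
have hw' : all (fun i => i < m + s) w by apply: sub_all hw => i /andP[].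
have [b sl] := slides_unbend K vm hw'.
have {}sl := slides_catr (bubs (map double ks)) sl; rewrite -!catA -lE in sl.
have vu : valid m (cvl m s ++ l0) by rewrite valid_cat vc ncE valid_wide.
have nu : nxts m (cvl m s ++ l0) = s by have := run_val_cod vu eu.
have [v2 n2 c2] := slidesP sl vu.
have [D ndD DE] := nd_word ks vm hw.
have ed : Mor (hom_of K D) = run K m (xs (low m w) ++ cvl m s ++ nf mu ++ xs (high m s w)
    ++ bubs (map double ks)) by rewrite run_layers DE.
rewrite -(subrK (sgn K b *: hom_of K D)%R (unb y)); apply: inspanD; last first.
  apply/inspanZ/(@inspan_gen _ _ _ _ _ (layers D)); first by exists D.
  - exact: layers_valid.
  - exact: run_layers.
apply: (inspan_bind (c2 _ _ _ eu ed)) => l1 z1 dl1 v1 e1.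
move: dl1; rewrite dots_cat dots_cvl add0n => dl1.
by apply: (IH (dots l1) _ l1) => //; [lia | have := run_val_cod v1 e1].
Qed.

(** Every morphism is a combination of pictures. *)
Lemma words_generate m s (x : H m s) : inspan (fun _ => True) x.
Proof.
have pic n p (d : diag n p) : inspan (fun _ => True) (hom_of K d).
  by apply: (@inspan_gen _ _ _ _ _ (layers d)) => //; [apply: layers_valid|apply: run_layers].
have word n p (z : H n p) l : valid n l -> Mor z = run K n l -> exists d, z = hom_of K d.
  move=> v e; have ns := run_val_cod v e.
  have [d dE] : exists d : diag n p, layers d = l by have := word_exists v; rewrite ns.
  by exists d; apply: Mor_inj; rewrite e run_layers dE.
elim/quotW: x => f; elim: f => {m s}.
- by move=> m; apply: (pic _ _ (dId m)).
- exact: (pic _ _ dU).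
- exact: (pic _ _ dA).
- exact: (pic _ _ dS).
- exact: (pic _ _ dX).
- move=> m n p f hf g hg; rewrite -hcompE.
  elim: hf => [|c y y' l _ v /(word _ _ _ _ v)[d ->] _ IHf].
    by rewrite hcomp0l; apply: inspan0.
  rewrite hcompDZl; apply: inspanD IHf; apply: inspanZ.
  elim: hg => [|c' z z' l' _ v' /(word _ _ _ _ v')[d' ->] _ IH].
    by rewrite hcomp0r; apply: inspan0.
  rewrite hcompDZr; apply: inspanD IH; apply: inspanZ.
  by rewrite hcompE; apply: (pic _ _ (dcomp d d')).
- move=> m s m' s' f hf g hg; rewrite -htensE.
  elim: hf => [|c y y' l _ v /(word _ _ _ _ v)[d ->] _ IHf].
    by rewrite htens0l; apply: inspan0.
  rewrite htensDZl; apply: inspanD IHf; apply: inspanZ.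
  elim: hg => [|c' z z' l' _ v' /(word _ _ _ _ v')[d' ->] _ IH].
    by rewrite htens0r; apply: inspan0.
  rewrite htensDZr; apply: inspanD IH; apply: inspanZ.
  by rewrite htensE; apply: (pic _ _ (dtens d d')).
- by move=> m s; rewrite hpi_zero; apply: inspan0.
- by move=> m s f hf g hg; rewrite hpi_add; apply: inspanD.
- by move=> m s c f hf; rewrite hpi_scale; apply: inspanZ.
Qed.

Lemma nd_spans m s (x : H m s) : nd_span x.
Proof.
apply: (inspan_bind (words_generate x)) => l y _ v e.
by apply: (nd_span_word v _ e); have := run_val_cod v e.
Qed.

End Span.

(*BEGIN*)
(** * The leading symbol of the representation *)

Section Symbol.
Context (B : finType) (y : B -> rat).
Let I := (B * bool)%type.
Local Notation tensor := ((nat -> I) -> rat).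
Implicit Types (w u : nat -> I).

Definition flip p u : nat -> I := fun k => if k == p then ((u k).1, ~~ (u k).2) else u k.

Definition sg (b : bool) : rat := (if b then 1 else -1)%R.

(** In leading order a dot multiplies by a weight and changes the second
    component of the colour: the matrix of its symbol is antisymmetric. *)
Definition hop (g : gen) (p : nat) (G : tensor) : tensor :=
  if g is gX then fun u => (sg (u p).2 * y (u p).1 * G (flip p u))%R
  else opB g p G.

Section Left.
Context (n : nat).
Implicit Types (be : {ffun 'I_n -> B}) (R : {set 'I_n}).

Definition lw R be u : nat -> I :=
  fun k => if insub k is Some i then (be i, i \notin R) else u (k - n).

Lemma lw_lt R be u (i : 'I_n) : lw R be u i = (be i, i \notin R).
Proof. by rewrite /lw valK. Qed.

Lemma lw_ge R be u k : lw R be u (n + k) = u k.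
Proof. by rewrite /lw insubF ?addKn //; lia. Qed.

Lemma lwP R be u w : (forall i : 'I_n, w i = (be i, i \notin R)) ->
  (forall k, w (n + k) = u k) -> w = lw R be u.
Proof.
move=> h1 h2; apply: funext => k; case: (ltnP k n) => hk.
  by have := h1 (Ordinal hk); rewrite -(lw_lt R be u).
by rewrite -(subnKC hk) h2 lw_ge.
Qed.

Definition mism be w : nat := #|[set i : 'I_n | w i != (be i, true)]|.

Lemma mism_lw R be u : mism be (lw R be u) = #|R|.
Proof.
by apply: eq_card => i; rewrite inE lw_lt xpair_eqE eqxx /= eqb_id negbK.
Qed.

Lemma mism_eq be w w' : (forall i : 'I_n, w' i = w i) -> mism be w' = mism be w.
Proof. by move=> h; apply: eq_card => i; rewrite !inE h. Qed.

Lemma mism_ge be w w' :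
  (forall i : 'I_n, w i != (be i, true) -> w' i != (be i, true)) -> mism be w <= mism be w'.
Proof. by move=> h; apply: subset_leq_card; apply/subsetP=> i; rewrite !inE => /h. Qed.

Lemma mism_one be w w' (j : 'I_n) : (forall i : 'I_n, i != j -> w' i = w i) ->
  mism be w <= (mism be w').+1.
Proof.
move=> h; have := subset_leq_card (_ : [set i : 'I_n | w i != (be i, true)] \subset
  j |: [set i : 'I_n | w' i != (be i, true)]).
rewrite cardsU1 => H; apply: leq_trans (H _) _; last by case: (_ \in _); rewrite ?add0n ?add1n.
by apply/subsetP=> i; rewrite !inE; case: (eqVneq i j) => //= ij; rewrite h.
Qed.

Definition agree R (be0 be : {ffun 'I_n -> B}) : bool :=
  [forall i, (i \notin R) ==> (be i == be0 i)].

(** A family of tensors whose left strands start at the colours (be i, true) and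
    must all be moved to (be i, false). Each dot moves at most one left strand,
    so that after q dots at most q of them have moved; [G] is the average of the
    tensors over the colours of these q strands. *)
Definition symbol q (Phi : {ffun 'I_n -> B} -> tensor) (G : tensor) : Prop :=
  (forall be w, q < mism be w -> Phi be w = 0%R) /\
  (forall R be0 u, #|R| = q ->
    (\sum_(be | agree R be0 be) (\prod_(i in R) y (be i)) * Phi be (lw R be u)
       = q`!%:R * G u)%R).

Lemma symbol_nodot q Phi G g p : ~~ isX g -> symbol q Phi G ->
  symbol q (fun be => opB g (n + p) (Phi be)) (opB g p G).
Proof.
case: g => // _ [h0 h1]; split=> /=.
- move=> be w hq; rewrite /opU; case: ifP => // _; apply: h0.
  by rewrite (@mism_eq be w) // => i; rewrite /del ifT //; have := ltn_ord i; lia.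
- move=> R be0 u hR; rewrite /opU -addnS.
  under eq_bigr => be _ do rewrite !lw_ge.
  case: ifP => _; last by rewrite big1 ?mulr0 // => be _; rewrite mulr0.
  rewrite -(h1 R be0 _ hR); apply: eq_bigr => be _; congr (_ * Phi be _)%R.
  apply: lwP => [i|k]; rewrite /del.
    by rewrite ifT ?lw_lt //; have := ltn_ord i; lia.
  by rewrite ltn_add2l -!addnS !lw_ge; case: ifP.
- move=> be w hq; rewrite /opA big1 // => a _; apply: h0.
  by rewrite (@mism_eq be w) // => i; rewrite /ins ifT //; have := ltn_ord i; lia.
- move=> R be0 u hR; rewrite /opA mulr_sumr.
  under eq_bigr => be _ do rewrite mulr_sumr.
  rewrite exchange_big; apply: eq_bigr => a _.
  rewrite -(h1 R be0 _ hR); apply: eq_bigr => be _; congr (_ * Phi be _)%R.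
  apply: lwP => [i|k]; rewrite /ins.
    by rewrite ifT ?lw_lt //; have := ltn_ord i; lia.
  rewrite ltn_add2l -!addnS leq_add2l lw_ge; case: ifP => // k1; case: ifP => // k2.
  by rewrite (_ : n + k - 2 = n + (k - 2)) ?lw_ge //; lia.
- move=> be w hq; rewrite /opS /opP; apply: h0.
  by rewrite (@mism_eq be w) // => i; have hi := ltn_ord i; rewrite /tr; iflia.
- move=> R be0 u hR; rewrite /opS /opP.
  rewrite -(h1 R be0 _ hR); apply: eq_bigr => be _; congr (_ * Phi be _)%R.
  apply: lwP => [i|k]; rewrite /tr.
    by have hi := ltn_ord i; iflia; rewrite lw_lt.
  by rewrite -!addnS !eqn_add2l !lw_ge.
Qed.

Lemma symbol_opO q Phi be R p u (i : 'I_n) : #|R| = q.+1 ->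
    (forall be w, q < mism be w -> Phi be w = 0%R :> rat) ->
  opO i (n + p) (Phi be) (lw R be u) = (if (i \in R) && (be i == (u p).1)
    then sg (u p).2 * Phi be (lw (R :\ i) be (flip p u)) else 0)%R.
Proof.
move=> hR h0; have hi := ltn_ord i; have inp : (nat_of_ord i == n + p) = false by lia.
have ne (j : 'I_n) : (nat_of_ord j == n + p) = false by have := ltn_ord j; lia.
have nN (j : 'I_n) : j != i -> (nat_of_ord j == i) = false.
  by rewrite -val_eqE => /negbTE.
have big w : (forall j : 'I_n, lw R be u j != (be j, true) -> w j != (be j, true)) ->
    Phi be w = 0%R.
  by move=> h; apply: h0; rewrite -hR -(mism_lw R be u); apply: mism_ge.
have tgt w : (forall k : 'I_n, k != i -> w k = lw R be u k) -> w i = (be i, true) ->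
    (forall k, w (n + k) = flip p u k) -> w = lw (R :\ i) be (flip p u).
  move=> h1 h2 h3; apply: lwP => // j; rewrite !inE; case: (eqVneq j i) => [->|ji] //=.
  by rewrite h1 // lw_lt.
rewrite /opO /opP /opE lw_lt lw_ge.
case: (boolP (i \in R)) => iR /=; last first.
  have -> : Phi be (tr i (n + p) (lw R be u)) = 0%R.
    apply: big => j; rewrite /tr; case: (eqVneq j i) => [->|/nN->]; last by rewrite ne.
    by rewrite lw_lt iR eqxx.
  rewrite big1 ?if_same ?subr0 // => a _; apply: big => j.
  rewrite /set2 ne orbF; case: (eqVneq j i) => [->|/nN-> //].
  by rewrite lw_lt iR eqxx.
have trE : u p = (be i, true) -> tr i (n + p) (lw R be u) = lw (R :\ i) be (flip p u).
  move=> up; apply: tgt => [k ki|| k].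
  - by rewrite /tr ne nN.
  - by rewrite /tr eqxx lw_ge.
  - rewrite /tr (_ : (n + k == i) = false) ?eqn_add2l; last lia.
    by rewrite /flip; case: eqP => [->|_]; rewrite ?lw_lt ?lw_ge ?up ?iR.
have trN : u p <> (be i, true) -> Phi be (tr i (n + p) (lw R be u)) = 0%R.
  move=> /eqP up; apply: big => j; rewrite /tr ne; case: (eqVneq j i) => [->|/nN-> //].
  by rewrite eqxx lw_ge.
case: (eqVneq (be i, false) (u p)) => up.
- rewrite trN; last by rewrite -up; case.
  rewrite -up /= eqxx /sg mulN1r sub0r; congr (- _)%R.
  rewrite (bigD1 (be i, true)) //= [X in (_ + X)%R]big1 ?addr0 => [|a an].
    congr (Phi be _); apply: tgt => [k ki|| k].
    + by rewrite /set2 ne orbF nN.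
    + by rewrite /set2 eqxx.
    + rewrite /set2 (_ : (n + k == i) = false) /= ?eqn_add2l; last lia.
      by rewrite /flip; case: eqP => [->|_]; rewrite ?lw_ge -?up.
  by apply: big => j; rewrite /set2 ne orbF; case: (eqVneq j i) => [->|/nN-> //]; rewrite eqxx.
- rewrite subr0; case: (eqVneq (u p) (be i, true)) => [e|/eqP e].
    by rewrite trE // e /= eqxx /sg mul1r.
  rewrite trN // ifF //; apply/negP=> /eqP e1.
  case: (u p) e up e1 => c b /= e up e1; subst c.
  by case: b e up => //; rewrite eqxx.
Qed.

Lemma symbol_dot q Phi G p : symbol q Phi G ->
  symbol q.+1 (fun be => opX (n + p) (Phi be)) (hop gX p G).
Proof.
move=> [h0 h1]; have opO_right be w (i : 'I_p) : q < mism be w ->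
    opO (n + i) (n + p) (Phi be) w = 0%R.
  move=> hq; rewrite /opO /opP /opE (h0 be) ?big1 ?if_same ?subr0 // => [a _|].
    apply: h0; rewrite (@mism_eq be w) // => j; have hj := ltn_ord j.
    by rewrite /set2 ifF //; lia.
  by rewrite (@mism_eq be w) // => j; have hj := ltn_ord j; rewrite /tr; iflia.
split=> [be w hq|R be0 u hR].
- rewrite /opX h0 ?mulr0 ?add0r; last lia.
  rewrite big_split_ord /= [X in (_ + X)%R]big1 ?addr0; last first.
    by move=> i _; apply: opO_right; lia.
  rewrite big1 // => i _; rewrite /opO /opP /opE.
  have hi := ltn_ord i.
  rewrite h0; last first.
    suff h : mism be w <= (mism be (tr i (n + p) w)).+1 by exact: (leq_trans hq h).
    apply: (@mism_one be w _ i) => j; rewrite -val_eqE /= => ji; have hj := ltn_ord j.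
    by rewrite /tr ifF ?ifF //; lia.
  rewrite big1 ?if_same ?subr0 // => a _; apply: h0.
  suff h : mism be w <= (mism be (set2 i (n + p) a w)).+1 by exact: (leq_trans hq h).
  apply: (@mism_one be w _ i) => j; rewrite -val_eqE /= => ji; have hj := ltn_ord j.
  by rewrite /set2 ifF //; lia.
- have E be : opX (n + p) (Phi be) (lw R be u) = (\sum_(i in R) if be i == (u p).1
      then sg (u p).2 * Phi be (lw (R :\ i) be (flip p u)) else 0)%R.
    have hq : q < mism be (lw R be u) by rewrite mism_lw hR.
    rewrite /opX h0 // mulr0 add0r big_split_ord /= [X in (_ + X)%R]big1 ?addr0.
      rewrite [RHS]big_mkcond; apply: eq_bigr => i _.
      by rewrite (symbol_opO be p u i hR h0); case: (i \in R).
    by move=> i _; apply: opO_right.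
  under eq_bigr => be _ do rewrite E mulr_sumr.
  rewrite exchange_big /=.
  have -> : (q.+1`!%:R * (sg (u p).2 * y (u p).1 * G (flip p u)) =
     \sum_(i in R) sg (u p).2 * y (u p).1 * (q`!%:R * G (flip p u)))%R.
    rewrite sumr_const hR factS natrM -mulr_natl; ring.
  apply: eq_bigr => i iR.
  have hR' : #|R :\ i| = q by have := cardsD1 i R; rewrite iR hR add1n => -[].
  pose be1 := [ffun j => if j == i then (u p).1 else be0 j].
  rewrite -(h1 _ be1 _ hR') mulr_sumr [LHS]big_mkcond [RHS]big_mkcond /=.
  apply: eq_bigr => be _.
  have aE : agree (R :\ i) be1 be = agree R be0 be && (be i == (u p).1).
    apply/forallP/andP.
      move=> h; split; last by have := h i; rewrite !inE eqxx ffunE eqxx.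
      apply/forallP=> j; apply/implyP=> jR; have := h j; rewrite !inE (negbTE jR) andbF /=.
      by rewrite ffunE (_ : (j == i) = false) //; apply/negbTE; apply: contraNneq jR => ->.
    case=> /forallP h /eqP hi j; apply/implyP; rewrite !inE negb_and negbK ffunE.
    by case: eqP => [-> _|_ /= jR]; [apply/eqP | apply: (implyP (h j))].
  rewrite aE; case: (agree R be0 be) => //=; case: eqP => bi; last by rewrite mulr0.
  rewrite (bigD1 i) //= bi.
  rewrite (eq_bigl (fun j => j \in R :\ i)) => [|j]; last by rewrite !inE andbC.
  by ring.
Qed.

Lemma symbol_word l q Phi G : symbol q Phi G ->
  symbol (q + dots l) (fun be => act (@op I) (shift n l) (Phi be)) (act hop l G).
Proof.
elim: l q Phi G => [|[g p] l IH] q Phi G h; first by rewrite addn0.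
rewrite dots_cons addnA /=; apply: IH.
case gX: (isX g).
  by case: g gX => //= _; rewrite addn1; apply: symbol_dot.
have := symbol_nodot p (negbT gX) h; rewrite addn0.
by case: g gX.
Qed.

Definition start (G : tensor) be : tensor := fun w =>
  ([forall i : 'I_n, w i == (be i, true)]%:R * G (fun k => w (n + k)))%R.

Lemma symbol_start G : symbol 0 (start G) G.
Proof.
split=> [be w|R be0 u /eqP].
  rewrite /mism card_gt0 => /set0Pn[i]; rewrite inE => wi.
  rewrite /start; case: forallP => [/(_ i)|]; last by rewrite mul0r.
  by rewrite (negbTE wi).
rewrite cards_eq0 => /eqP->; rewrite (big_pred1 be0) => [|be]; last first.
  apply/forallP/eqP => [h|-> i]; last by rewrite eqxx implybT.
  by apply/ffunP=> i; apply/eqP; have := h i; rewrite inE.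
rewrite big_set0 mul1r /start; case: forallP => [_|[]]; last first.
  by move=> i; rewrite lw_lt inE.
by congr (_ * G _)%R; apply: funext => k; rewrite lw_ge.
Qed.

(** The coefficient extracted from the action of a word with at most n dots. *)
Definition probe (f : tensor -> tensor) (G : tensor) (u : nat -> I) : rat :=
  (\sum_(be : {ffun 'I_n -> B}) (\prod_i y (be i)) * f (start G be) (lw setT be u))%R.

Lemma probe_word l G u : dots l <= n -> probe (act (@op I) (shift n l)) G u =
  (if dots l == n then n`!%:R * act hop l G u else 0)%R.
Proof.
move=> hl; have [h0 h1] := symbol_word l (symbol_start G); rewrite add0n in h0 h1.
rewrite /probe; case: eqP => e.
  have := h1 setT (finfun (fun i => (u 0).1)) u; rewrite cardsT card_ord => /(_ (esym e)).
  rewrite (congr1 factorial e) => <-.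
  rewrite [RHS](eq_bigl predT) => [|be]; last by apply/forallP=> i; rewrite inE.
  by apply: eq_bigr => be _; congr (_ * _)%R; apply: eq_bigl => i; rewrite inE.
rewrite big1 // => be _; rewrite h0 ?mulr0 // mism_lw cardsT card_ord; lia.
Qed.

End Left.
End Symbol.

(*BEGIN*)
Lemma count_dotlist m (a : 'I_m -> nat) (k : 'I_m) :
  count_mem (nat_of_ord k) (dotlist a) = a k.
Proof.
rewrite /dotlist count_flatten -map_comp sumnE big_map big_enum /= (bigD1 k) //=.
rewrite count_nseq /= eqxx mul1n big1 ?addn0 // => i ik.
by rewrite count_nseq /= val_eqE (negbTE ik).
Qed.

Lemma bks_even k : all (fun i => ~~ odd i) (bks k).
Proof.
rewrite /bks; elim: (iota _ _) => //= i r IH; rewrite all_cat IH /=.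
by apply/allP=> j; rewrite mem_nseq => /andP[_ /eqP->]; rewrite odd_double.
Qed.

Fixpoint sgnw (w : seq nat) (e : nat -> bool) : rat :=
  if w is i :: w' then (sgnw w' e * sg (e i (+) odd (count_mem i w')))%R else 1%R.

Lemma sgnw_eq w e e' : (forall i, i \in w -> e i = e' i) -> sgnw w e = sgnw w e'.
Proof.
elim: w => //= i w IH h; rewrite IH; last by move=> j jw; apply: h; rewrite inE jw orbT.
by rewrite h ?mem_head.
Qed.

Lemma sgnw_neq0 w e : sgnw w e != 0%R.
Proof.
elim: w => [|i w IH] //=.
by rewrite mulf_neq0 // /sg; case: ifP => _; rewrite ?oppr_eq0 oner_eq0.
Qed.

Lemma sgnw_double k e : sgnw (nseq k.*2 0) e = ((-1) ^+ k)%R.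
Proof.
elim: k => //= k IH; rewrite IH -mulrA exprS mulrC; congr (_ * _)%R.
rewrite count_nseq /= mul1n add0n odd_double addbF /sg.
by case: (e 0); rewrite /= ?mul1r ?mulr1.
Qed.

Definition ext (T : Type) (c0 : T) n (v : 'I_n -> T) : nat -> T :=
  fun k => if insub k is Some i then v i else c0.

Lemma extE (T : Type) (c0 : T) n (v : 'I_n -> T) i : ext c0 v (nat_of_ord i) = v i.
Proof. by rewrite /ext valK. Qed.

Lemma ext_comp (T T' : Type) (h : T -> T') c0 n (v : 'I_n -> T) k :
  h (ext c0 v k) = ext (h c0) (fun i => h (v i)) k.
Proof. by rewrite /ext; case: insubP. Qed.

(** The bottom dots change the colours of the bottom endpoints, so that their
    signs are those of the changed colours. *)
Definition eps m s (a : 'I_s -> nat) (b : 'I_m -> nat) (e : 'I_m + 'I_s -> bool) : rat :=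
  (sgnw (dotlist a) (ext true (fun i => e (inr i))) *
   sgnw (dotlist b) (ext true (fun j => e (inl j) (+) odd (b j))))%R.

Lemma eps_neq0 m s a b e : @eps m s a b e != 0%R.
Proof. by rewrite mulf_neq0 ?sgnw_neq0. Qed.

Section HopND.
Context (B : finType) (y : B -> rat).
Let I := (B * bool)%type.
Local Notation tensor := ((nat -> I) -> rat).
Local Notation hop := (hop y).
Implicit Types (u : nat -> I) (w : seq nat).

Definition fl w u : nat -> I := fun k => ((u k).1, (u k).2 (+) odd (count_mem k w)).

Lemma hop_xs w (G : tensor) u : act hop (xs w) G u =
  (sgnw w (fun k => (u k).2) * (\prod_(i <- w) y (u i).1) * G (fl w u))%R.
Proof.
elim: w G => [|i w IH] G /=.
  rewrite big_nil !mul1r; congr G; apply: funext => k.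
  by rewrite /fl /= addbF -surjective_pairing.
rewrite IH big_cons (_ : flip i (fl w u) = fl (i :: w) u); last first.
  apply: funext => k; rewrite /flip /fl /=; case: (eqVneq k i) => [->|ki].
    by rewrite ?eqxx ?add1n /= addbN.
  by rewrite ?add0n.
by rewrite -!mulrA; congr (_ * _)%R; rewrite mulrCA; congr (_ * _)%R; rewrite mulrCA.
Qed.

Definition bubw (k : nat) : rat := (2%:R * (-1) ^+ k./2 * psum y k)%R.

Lemma hop_bub k (G : tensor) u : ~~ odd k -> act hop (bub k) G u = (bubw k * G u)%R.
Proof.
move=> ek; rewrite -[k]odd_double_half (negbTE ek) add0n; move: k./2 => {ek}k.
rewrite /bub xs_nseq -cat1s !act_cat /= /opA.
have E a : act hop (xs (nseq k.*2 0)) (opU 0 G) (ins 0 a u) =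
    ((-1) ^+ k * y a.1 ^+ k.*2 * G u)%R.
  rewrite hop_xs sgnw_double big_nseq iter_mulr_1; congr (_ * _)%R.
  rewrite (_ : fl _ _ = ins 0 a u); last first.
    apply: funext => j; rewrite /fl count_nseq /=; case: (0 == j).
      by rewrite mul1n odd_double addbF -surjective_pairing.
    by rewrite mul0n addbF -surjective_pairing.
  rewrite /opU (_ : ins 0 a u 0 = a) // (_ : ins 0 a u 1 = a) // eqxx.
  by rewrite (_ : del 0 (ins 0 a u) = u) //; apply: funext => j; rewrite /del /ins /= subn2.
under eq_bigr => a _ do rewrite E.
rewrite -big_distrl /=; congr (_ * _)%R.
rewrite /bubw doubleK /psum -mulrA !mulr_sumr.
rewrite -(pair_bigA _ (fun c (b : bool) => (-1) ^+ k * y c ^+ k.*2)%R) /=.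
by apply: eq_bigr => c _; rewrite sumr_const card_bool mulr_natl.
Qed.

Lemma hop_bubs ks (G : tensor) u : all (fun i => ~~ odd i) ks ->
  act hop (bubs ks) G u = ((\prod_(k <- ks) bubw k) * G u)%R.
Proof.
elim: ks G => [|k ks IH] G; first by rewrite big_nil mul1r.
by case/andP=> ek eks; rewrite bubs_cons act_cat IH // hop_bub // big_cons mulrCA mulrA.
Qed.

Lemma hop_nodots l (G : tensor) z : nodots l -> act hop l G = act (opZ z) l G.
Proof.
elim: l G => //= -[g p] l IH G /andP[gX /IH->]; congr act.
by case: g gX.
Qed.

Context (c0 : B) (m s : nat).
Implicit Types (v : 'I_m + 'I_s -> I) (a : 'I_s -> nat) (b : 'I_m -> nat).

Definition flab a b v p : I := ((v p).1, (v p).2 (+) odd (label a b p)).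

Lemma hop_ndiag k a (d : diag m s) b v : dot_free d -> bubble_free d ->
  act hop (layers (ndiag k a d b)) (indic rat (fun i => v (inl i))) (ext (c0, true) (fun i => v (inr i)))
  = ((\prod_(k <- bks k) bubw k) * (eps a b (fun p => (v p).2) * (\prod_p y (v p).1 ^+ label a b p)) *
     (consistent d (flab a b v))%:R)%R.
Proof.
move=> df bf; set u := ext _ _; rewrite layers_ndiag !act_cat hop_bubs ?bks_even //.
rewrite -mulrA; congr (_ * _)%R; rewrite hop_xs prod_dotlist.
have -> : act hop (xs (dotlist b)) (indic rat (fun i => v (inl i))) =
  (fun x => (sgnw (dotlist b) (ext true (fun j => (v (inl j)).2 (+) odd (b j))) *
             (\prod_j y (v (inl j)).1 ^+ b j)) *
            indic rat (fun j => flab a b v (inl j)) x)%R.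
  apply: funext => x; rewrite hop_xs prod_dotlist /indic.
  have -> : [forall i : 'I_m, fl (dotlist b) x i == v (inl i)]
          = [forall i : 'I_m, x i == flab a b v (inl i)].
    apply: eq_forallb => i; rewrite /fl /flab count_dotlist /=.
    case: (x i) (v (inl i)) => [c e] [c' e'] /=; rewrite !xpair_eqE; congr andb.
    by case: e e' (odd _) => [] [] [].
  case: forallP => [H|_]; last by rewrite !mulr0.
  rewrite !mulr1; congr (_ * _)%R.
    apply: sgnw_eq => i ib; have hi := allP (dotlist_lt b) i ib.
    have := eqP (H (Ordinal hi)); rewrite /= => -> /=.
    exact: esym (extE true (fun j => (v (inl j)).2 (+) odd (b j)) (Ordinal hi)).
  by apply: eq_bigr => j _; rewrite (eqP (H j)).
rewrite (hop_nodots _ (fun=> 1%R)); last by rewrite -dot_free_layers.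
rewrite act_scale act_zc (zc_dotfree _ (c0, true)) // mulrA; congr (_ * (nat_of_bool _)%:R)%R.
  rewrite /eps big_sumType /= -/u.
  rewrite (eq_bigr (fun i => y (v (inr i)).1 ^+ a i)%R); last by move=> i _; rewrite /u extE.
  rewrite (@sgnw_eq _ (fun k => (u k).2) (ext true (fun i => (v (inr i)).2))); first by ring.
  by move=> k' _; exact: (ext_comp snd).
congr consistent; apply: funext => -[i|i] //.
by rewrite /fl /flab count_dotlist /u extE.
Qed.

End HopND.

(*BEGIN*)
(** * Independence of products of power sums *)

Section PowerSums.
Local Open Scope ring_scope.

Lemma poly_nat_roots (p : {poly rat}) : (forall n : nat, p.[n%:R] = 0) -> p = 0.
Proof.
move=> h; apply: (@roots_geq_poly_eq0 _ _ [seq n%:R | n <- iota 0 (size p)]).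
- by apply/allP=> x /mapP[n _ ->]; apply/rootP.
- by rewrite map_inj_uniq ?iota_uniq // => i j /eqP; rewrite eqr_nat => /eqP.
- by rewrite size_map size_iota.
Qed.

Lemma poly_all_roots (p : {poly rat}) : (forall t, p.[t] = 0) -> p = 0.
Proof. by move=> h; apply: poly_nat_roots. Qed.

Section Derivative.
Variable P : nat -> rat.

(* The coefficient of N in the product of the P k + N t^k, as a polynomial in t. *)
Fixpoint pderiv (l : seq nat) : {poly rat} :=
  if l is k :: l' then 'X^k * (\prod_(i <- l') P i)%:P + (P k)%:P * pderiv l' else 0.

Lemma pderivE t l : (\prod_(k <- l) ((P k)%:P + (t ^+ k)%:P * 'X))`_0 = \prod_(k <- l) P k /\
  (\prod_(k <- l) ((P k)%:P + (t ^+ k)%:P * 'X))`_1 = (pderiv l).[t].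
Proof.
elim: l => [|k l [h0 h1]]; first by rewrite !big_nil !coefC horner0.
rewrite !big_cons /= mulrDl -mulrA !coefD !coefCM !coefXM /= h0 h1 mulr0 addr0.
by split=> //; rewrite !hornerE addrC; congr (_ + _); rewrite mulrC.
Qed.

Lemma coef_pderiv k l : (pderiv l)`_k = (count_mem k l)%:R * \prod_(i <- rem k l) P i.
Proof.
elim: l => [|k' l IH] /=; first by rewrite coef0 mul0r.
rewrite coefD coefMC coefXn coefCM IH.
case: (eqVneq k' k) => [->|kk].
  rewrite mul1r add1n -[in RHS]addn1 natrD mulrDl mul1r addrC; congr (_ + _).
  case: (boolP (k \in l)) => [kl|/count_memPn->]; last by rewrite !mul0r mulr0.
  by rewrite mulrCA [in RHS](perm_big _ (perm_to_rem kl)) big_cons.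
by rewrite mul0r add0r add0n big_cons mulrCA.
Qed.

End Derivative.

Lemma powersum_derive (Z : nat -> rat) (J : seq (rat * seq nat)) k :
    (forall E : seq rat,
      \sum_(j <- J) j.1 * \prod_(i <- j.2) (Z i + \sum_(t <- E) t ^+ i) = 0) ->
  forall E : seq rat, \sum_(j <- J) j.1 * (count_mem k j.2)%:R *
      \prod_(i <- rem k j.2) (Z i + \sum_(t <- E) t ^+ i) = 0.
Proof.
move=> H E; pose P i := Z i + \sum_(t <- E) t ^+ i.
pose p := \sum_(j <- J) j.1 *: pderiv P j.2.
suff p0 : p = 0.
  transitivity p`_k; last by rewrite p0 coef0.
  rewrite /p coef_sum; apply: eq_bigr => j _.
  by rewrite coefZ coef_pderiv mulrA.
apply: poly_all_roots => t.
pose q := \sum_(j <- J) j.1 *: \prod_(i <- j.2) ((P i)%:P + (t ^+ i)%:P * 'X).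
suff q0 : q = 0.
  transitivity q`_1; last by rewrite q0 coef0.
  rewrite /p /q horner_sum coef_sum; apply: eq_bigr => j _.
  by rewrite hornerZ coefZ; have [_ ->] := pderivE P t j.2.
apply: poly_nat_roots => n; rewrite -[RHS](H (nseq n t ++ E)) /q horner_sum.
apply: eq_bigr => j _; rewrite hornerZ horner_prod; congr (_ * _).
apply: eq_bigr => i _; rewrite !hornerE big_cat /= big_nseq /P.
rewrite [in RHS]addrCA [in RHS]addrC; congr (_ + _).
by rewrite iter_addr_0 mulr_natr.
Qed.

(** Adding N more variables of value t to the power sums and extracting the
    coefficient of N t^k differentiates with respect to the k-th power sum;
    differentiating along a longest product leaves its own coefficient. *)
Lemma powersum_indep (Z : nat -> rat) (l0 : seq nat) (J : seq (rat * seq nat)) :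
    (forall E : seq rat,
      \sum_(j <- J) j.1 * \prod_(i <- j.2) (Z i + \sum_(t <- E) t ^+ i) = 0) ->
    (forall j, j \in J -> (size j.2 <= size l0)%N) ->
  \sum_(j <- J | perm_eq j.2 l0) j.1 = 0.
Proof.
elim: l0 J => [|k l0 IH] J H hs.
  rewrite -[RHS](H [::]) big_mkcond big_seq_cond [RHS]big_seq_cond; apply: eq_bigr => j.
  rewrite andbT => /hs; rewrite leqn0 => /nilP->; by rewrite perm_refl big_nil mulr1.
pose J' := [seq (j.1 * (count_mem k j.2)%:R, rem k j.2) | j <- J & k \in j.2].
have : \sum_(j <- J | (k \in j.2) && perm_eq (rem k j.2) l0)
    j.1 * (count_mem k j.2)%:R = 0.
  transitivity (\sum_(j <- J' | perm_eq j.2 l0) j.1); first by rewrite big_map big_filter_cond.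
  apply: IH => [E|j /mapP[j']].
    rewrite big_map big_filter -[RHS](powersum_derive k H E) big_mkcond.
    apply: eq_bigr => j _; case: ifP => //= /negbT/count_memPn->.
    by rewrite mulr0 mul0r.
  rewrite mem_filter => /andP[kj /hs hj] -> /=.
  by rewrite size_rem //; move: hj => /=; case: (size j'.2).
have E (j : rat * seq nat) : (k \in j.2) && perm_eq (rem k j.2) l0 = perm_eq j.2 (k :: l0).
  apply/andP/idP => [[kj p]|p].
    by rewrite (permPl (perm_to_rem kj)) perm_cons.
  have kj : k \in j.2 by rewrite (perm_mem p) mem_head.
  by split=> //; rewrite -(perm_cons k) -(permPl (perm_to_rem kj)).
rewrite (eq_bigl _ _ E) (eq_bigr (fun j => j.1 * (count_mem k (k :: l0))%:R)); last first.
  by move=> j pj; rewrite (permP pj).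
rewrite -mulr_suml => /eqP; rewrite mulf_eq0 => /orP[/eqP //|].
by rewrite pnatr_eq0 /= eqxx.
Qed.

End PowerSums.

Lemma digits_inj M N (f g : nat -> nat) : (forall i, i < N -> f i < M) ->
    (forall i, i < N -> g i < M) ->
    \sum_(i < N) f i * M ^ i = \sum_(i < N) g i * M ^ i ->
  forall i, i < N -> f i = g i.
Proof.
elim: N f g => // N IH f g hf hg; rewrite !big_ord_recl !expn0 !muln1 => e.
have M0 : 0 < M by have := hf 0 isT; lia.
have tl (h : nat -> nat) : \sum_(i < N) h (lift ord0 i) * M ^ lift ord0 i =
            (\sum_(i < N) h i.+1 * M ^ i) * M.
  by rewrite big_distrl; apply: eq_bigr => i _; rewrite /= /bump /= add1n expnSr mulnA.
rewrite (tl f) (tl g) in e.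
have e0 : f 0 = g 0.
  have := congr1 (modn^~ M) e.
  rewrite /= addnC modnMDl [X in _ = X %% _]addnC modnMDl.
  by rewrite !modn_small ?hf ?hg.
move: e; rewrite e0 => /addnI/eqP; rewrite eqn_pmul2r // => /eqP e.
case=> [|i] hi //; apply: (IH (fun i => f i.+1) (fun i => g i.+1)) => // j hj; [exact: hf|exact: hg].
Qed.

(*BEGIN*)
(** * Linear independence over subrings of the rationals *)

Lemma consistent_inj (I J : finType) (h : I -> J) m s (d : diag m s) (w : 'I_m + 'I_s -> I) :
  injective h -> consistent d (fun p => h (w p)) = consistent d w.
Proof.
by move=> hh; apply: eq_forallb => p; apply: eq_forallb => q; rewrite (inj_eq hh).
Qed.

(** Two perfect matchings are equal as soon as one refines the other. *)
Lemma strands_refine m s (d d' : diag m s) :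
    dot_free d -> bubble_free d -> dot_free d' -> bubble_free d' ->
    (forall p q, same_strand (endpt d p) (endpt d q) -> same_strand (endpt d' p) (endpt d' q)) ->
  forall p q, same_strand (endpt d p) (endpt d q) = same_strand (endpt d' p) (endpt d' q).
Proof.
move=> df bf df' bf' H p q.
have [mu vm r] := exists_nf df bf; have [mu' vm' r'] := exists_nf df' bf'.
have [vb _] := bend_dims (layers_valid d) (nxts_layers d).
have [vb' _] := bend_dims (layers_valid d') (nxts_layers d').
have [_ _ e] := redP r vb; have [_ _ e'] := redP r' vb'.
have [_ S] := strands_nf df vm (e rat); have [_ S'] := strands_nf df' vm' (e' rat).
rewrite S S'; congr orb.
have [x xE] := mpos_surj (prt_lt vm (mpos_lt q)).
have := H x q; rewrite S S' xE eqxx orbT => /(_ isT).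
by rewrite (negbTE (prt_neq vm (mpos_lt q))) => /eqP<-.
Qed.

Section Independence.
Context (L : comPzRingType) (iota : {rmorphism L -> rat}) (iota_inj : injective iota).
Context (m s : nat) (X : eqType) (k_ : X -> seq nat) (a_ : X -> 'I_s -> nat)
  (d_ : X -> diag m s) (b_ : X -> 'I_m -> nat).
Hypotheses (df : forall x, dot_free (d_ x)) (bf : forall x, bubble_free (d_ x)).
Hypotheses (ha : forall x i, left_of_cup (d_ x) i -> a_ x i = 0)
  (hb : forall x j, right_of_cap (d_ x) j || on_vertical (d_ x) j -> b_ x j = 0).
Hypothesis separated : forall x x',
  (forall p q, same_strand (endpt (d_ x) p) (endpt (d_ x) q)
             = same_strand (endpt (d_ x') p) (endpt (d_ x') q)) ->
  a_ x = a_ x' -> b_ x = b_ x' -> perm_eq (bks (k_ x)) (bks (k_ x')) -> x = x'.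
Local Notation D x := (ndiag (k_ x) (a_ x) (d_ x) (b_ x)).
Local Notation lab x := (label (a_ x) (b_ x)).
Local Notation dotsD x := (dots (layers (D x))).

Lemma T_relation (I : finType) (r : seq X) (c : X -> L) n phi (w : nat -> I) :
    (\sum_(x <- r) c x *: hom_of L (D x) = 0)%R ->
  (\sum_(x <- r) iota (c x) * T iota n (term_of L (D x)) phi w = 0)%R.
Proof.
move=> e; transitivity (T iota n (repr (\sum_(x <- r) c x *: hom_of L (D x))%R) phi w).
  elim: r {e} => [|x r IH].
    by rewrite !big_nil -hpi_zero (T_sound _ iota (repr_eqv _)).
  rewrite !big_cons IH; set S := (\sum_(x <- r) _)%R.
  have -> : (c x *: hom_of L (D x) + S)%R =
      \pi_(ABHom L m s) (tadd (tscale (c x) (term_of L (D x))) (repr S)).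
    by rewrite hpi_add hpi_scale reprK.
  by rewrite (T_sound _ iota (repr_eqv _)).
by rewrite e -hpi_zero (T_sound _ iota (repr_eqv _)).
Qed.

Lemma symbol_relation (B : finType) (y : B -> rat) (r : seq X) (c : X -> L) n G u :
    (\sum_(x <- r) c x *: hom_of L (D x) = 0)%R ->
    (forall x, x \in r -> dotsD x <= n) ->
  (\sum_(x <- r | dotsD x == n) iota (c x) * act (hop y) (layers (D x)) G u = 0)%R.
Proof.
move=> e hr; apply: (@mulfI _ (n`!%:R : rat)%R); first by rewrite pnatr_eq0 -lt0n fact_gt0.
rewrite mulr0 mulr_sumr.
transitivity (\sum_(x <- r) iota (c x) * probe y n (T iota n (term_of L (D x))) G u)%R.
  rewrite big_mkcond big_seq [RHS]big_seq; apply: eq_bigr => x xr.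
  by rewrite T_layers (probe_word y G u (hr x xr)); case: eqP => _; rewrite ?mulr0 // mulrCA.
rewrite /probe; under eq_bigr => x _ do rewrite mulr_sumr.
rewrite exchange_big big1 //= => be _.
under eq_bigr => x _ do rewrite mulrCA.
by rewrite -mulr_sumr T_relation ?mulr0.
Qed.

Lemma size_dotlist n (a : 'I_n -> nat) : size (dotlist a) = \sum_k a k.
Proof.
rewrite /dotlist size_flatten /shape -map_comp sumnE big_map big_enum /=.
by apply: eq_bigr => k _; rewrite size_nseq.
Qed.

Lemma lab_le_dots x : \sum_p lab x p <= dotsD x.
Proof.
rewrite layers_ndiag !dotsE big_sumType /= !size_dotlist leq_add2l.
by rewrite addnCA leq_addr.
Qed.

Lemma argmax (Y : eqType) (r : seq Y) (f : Y -> nat) x : x \in r ->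
  exists2 x0, x0 \in r & forall z, z \in r -> f z <= f x0.
Proof.
move=> xr; have [i _ hi] := @arg_maxnP _ (Ordinal (etrans (index_mem x r) xr)) predT
  (fun i => f (tnth (in_tuple r) i)) isT.
exists (tnth (in_tuple r) i); first exact: mem_tnth.
by move=> z /(tnthP (in_tuple r))[j ->]; apply: hi.
Qed.

Section Top.
Context (x0 : X).
Local Notation d0 := (d_ x0).
Local Notation A := (earc d0).

Definition strand p : A := fingraph.root (@glued _ _ d0) (endpt d0 p).

Lemma strandE p q : (strand p == strand q) = same_strand (endpt d0 p) (endpt d0 q).
Proof. by rewrite same_strandE. Qed.

(* The parity of the dots makes the changed colours of x0 agree along strands. *)
Definition fits0 x : bool :=
  consistent (d_ x) (fun p => (strand p, odd (lab x0 p) (+) odd (lab x p))).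

Lemma fits0_strands x : fits0 x -> forall p q,
  same_strand (endpt (d_ x) p) (endpt (d_ x) q) = same_strand (endpt d0 p) (endpt d0 q).
Proof.
move=> /forallP h; apply: strands_refine => // p q pq.
by have /forallP/(_ q)/implyP/(_ pq)/eqP[/eqP] := h p; rewrite strandE.
Qed.

Lemma fits0_refl : fits0 x0.
Proof.
apply/forallP=> p; apply/forallP=> q; apply/implyP; rewrite -strandE => /eqP->.
by rewrite !addbb.
Qed.

Definition expo M x : nat := \sum_p lab x p * M ^ enum_rank (strand p).

Lemma expo_inj M x : fits0 x -> (\sum_p lab x p < M) -> \sum_p lab x0 p < M ->
  expo M x = expo M x0 -> a_ x = a_ x0 /\ b_ x = b_ x0.
Proof.
move=> hx hM hM0 e; have ss := fits0_strands hx.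
pose f z i := \sum_(p | nat_of_ord (enum_rank (strand p)) == i) lab z p.
have fE z : expo M z = \sum_(i < #|A|) f z i * M ^ i.
  rewrite /expo (partition_big (fun p => enum_rank (strand p)) predT) //=.
  apply: eq_bigr => i _; rewrite /f big_distrl; apply: eq_bigr => p /eqP-> //.
have fM z i : \sum_p lab z p < M -> f z i < M.
  by apply: leq_ltn_trans; rewrite [X in _ <= X](bigID (fun p => nat_of_ord (enum_rank (strand p)) == i)) leq_addr.
apply: (labels_eq (@ha x) (@hb x) (@ha x0) (@hb x0) ss).
move=> p; have := digits_inj (fun i _ => fM x i hM) (fun i _ => fM x0 i hM0)
  (etrans (esym (fE x)) (etrans e (fE x0))) (ltn_ord (enum_rank (strand p))).
have E q : (nat_of_ord (enum_rank (strand q)) == enum_rank (strand p)) =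
    same_strand (endpt d0 p) (endpt d0 q).
  by rewrite val_eqE (inj_eq enum_rank_inj) strandE same_strand_sym.
rewrite /f !(eq_bigl _ _ E) => <-.
by apply: eq_bigl => q; rewrite ss.
Qed.

End Top.

Theorem nd_indep (r : seq X) (c : X -> L) : uniq r ->
    (\sum_(x <- r) c x *: hom_of L (D x) = 0)%R ->
  {in r, forall x, c x = 0%R}.
Proof.
move=> ur e x1 x1r; apply/eqP/negPn/negP => c1.
pose r' := [seq x <- r | c x != 0%R].
have e' : (\sum_(x <- r') c x *: hom_of L (D x) = 0)%R.
  rewrite big_filter -[RHS]e big_mkcond; apply: eq_bigr => x _.
  by case: eqP => //= ->; rewrite scale0r.
have x1r' : x1 \in r' by rewrite mem_filter c1.
have [x2 x2r n_max] := argmax (fun x => dotsD x) x1r'.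
have [n nE] : exists n, dotsD x2 = n by eexists.
pose r'' := [seq x <- r' | dotsD x == n].
have x2r' : x2 \in r'' by rewrite mem_filter nE eqxx.
have [x0 x0r b_max] := argmax (fun x => size (bks (k_ x))) x2r'.
have {x1 x1r c1 x1r' x2r x2r'} c0 : c x0 != 0%R.
  by move: x0r; rewrite !mem_filter => /and3P[].
have hn x : x \in r' -> dotsD x <= n by rewrite -nE; apply: n_max.
have hlab x : x \in r'' -> \sum_p lab x p < n.+1.
  by rewrite mem_filter ltnS => /andP[/eqP<- _]; apply: lab_le_dots.
pose q x : rat := (\prod_(k <- bks (k_ x)) (2%:R * (-1) ^+ k./2))%R.
have q0 : q x0 != 0%R.
  by rewrite /q prodf_seq_neq0; apply/allP=> k _; rewrite /= mulf_neq0 // signr_eq0.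
pose ee x : rat := eps (a_ x) (b_ x) (fun p => odd (lab x0 p)).
pose cf x : rat := (iota (c x) * ee x * (fits0 x0 x)%:R)%R.
have reorder (f1 f2 f3 f4 f5 f6 : rat) :
    (f1 * (f2 * f3 * (f4 * f5) * f6) = f1 * f4 * f6 * f5 * f2 * f3)%R by ring.
have key t (E : seq rat) : (\sum_(x <- r'') (cf x * t ^+ expo x0 n.+1 x * q x) *
   \prod_(k <- bks (k_ x)) ((\sum_(o : option (earc (d_ x0)))
       t ^+ (n.+1 ^ (if o is Some z then enum_rank z else 0)) ^+ k) + \sum_(z <- E) z ^+ k)
   = 0)%R.
  pose B := (option (earc (d_ x0)) + 'I_(size E))%type.
  pose y (z : B) : rat := match z with
    | inl o => (t ^+ (n.+1 ^ (if o is Some z then enum_rank z else 0)))%R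
    | inr i => nth 0%R E i end.
  pose v p : B * bool := (inl (Some (strand x0 p)), odd (lab x0 p)).
  rewrite big_filter -[RHS](symbol_relation y (indic rat (fun i => v (inl i)))
    (ext (inl None, true) (fun i => v (inr i))) e' hn).
  apply: eq_bigr => x _; rewrite hop_ndiag //.
  have -> : consistent (d_ x) (flab (a_ x) (b_ x) v) = fits0 x0 x.
    pose h (z : earc (d_ x0) * bool) : B * bool := (inl (Some z.1), z.2).
    rewrite /fits0 -(@consistent_inj _ _ h) //.
    by move=> [z1 z2] [z3 z4] [-> ->].
  rewrite /cf /q.
  have -> : (\prod_p y (v p).1 ^+ lab x p = t ^+ expo x0 n.+1 x)%R.
    rewrite /expo (big_morph _ (exprD t) (expr0 t)) /=; apply: eq_bigr => p _.
    by rewrite -exprM mulnC.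
  have -> : (\prod_(k <- bks (k_ x)) bubw y k = \prod_(k <- bks (k_ x)) (2%:R * (-1) ^+ k./2) *
    \prod_(k <- bks (k_ x)) ((\sum_(o : option (earc (d_ x0)))
       t ^+ (n.+1 ^ (if o is Some z then enum_rank z else 0)) ^+ k) + \sum_(z <- E) z ^+ k))%R.
    rewrite -big_split /=; apply: eq_bigr => k _; rewrite /bubw /psum; congr (_ * _)%R.
    rewrite big_sumType /=; congr (_ + _)%R.
    by rewrite (big_nth 0%R) big_mkord.
  exact: esym (reorder _ _ _ _ _ _).
have {key} key t : (\sum_(x <- r'' | perm_eq (bks (k_ x)) (bks (k_ x0))) cf x * t ^+ expo x0 n.+1 x
   = 0)%R.
  apply: (mulIf q0); rewrite mul0r mulr_suml.
  pose Z k : rat := (\sum_(o : option (earc (d_ x0)))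
    t ^+ (n.+1 ^ (if o is Some z then enum_rank z else 0)) ^+ k)%R.
  pose J := [seq ((cf x * t ^+ expo x0 n.+1 x * q x)%R, bks (k_ x)) | x <- r''].
  transitivity (\sum_(j <- J | perm_eq j.2 (bks (k_ x0))) j.1)%R.
    by rewrite big_map; apply: eq_bigr => x px; rewrite /q (perm_big _ px).
  apply: (@powersum_indep Z) => [E|j /mapP[x xr ->] /=]; last exact: b_max.
  by rewrite big_map; apply: key.
pose p : {poly rat} := (\sum_(x <- r'' | perm_eq (bks (k_ x)) (bks (k_ x0))) cf x *: 'X^(expo x0 n.+1 x))%R.
have p0 : p = 0%R.
  apply: poly_all_roots => t; rewrite -[RHS](key t) horner_sum; apply: eq_bigr => x _.
  by rewrite !hornerE.
have := congr1 (fun p : {poly rat} => p`_(expo x0 n.+1 x0))%R p0.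
rewrite coef0 coef_sum => /eqP; apply/negP.
have ur'' : uniq r'' by rewrite !filter_uniq.
rewrite -big_filter (bigD1_seq x0) /= ?filter_uniq //; last by rewrite mem_filter perm_refl.
rewrite coefZ coefXn eqxx mulr1 big_seq_cond big1 ?addr0.
  rewrite /cf fits0_refl mulr1 mulf_neq0 ?eps_neq0 //.
  by rewrite -(rmorph0 iota) (inj_eq iota_inj).
move=> x; rewrite mem_filter => /andP[/andP[px xr] xx].
rewrite coefZ coefXn; case: eqP => [ex|_]; last by rewrite mulr0.
rewrite /cf; case fx: (fits0 x0 x); last by rewrite !mulr0 mul0r.
have [ea eb] := expo_inj fx (hlab _ xr) (hlab _ x0r) (esym ex).
by case/eqP: xx; apply: separated => //; apply: fits0_strands.
Qed.

End Independence.

(*BEGIN*)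
(** * Coordinates *)

Section Coordinates.
Local Open Scope ring_scope.
Context (R : comPzRingType) (V : lmodType R) (I : eqType) (b : I -> V).

Definition coords (x : V) (f : I -> R) : Prop :=
  exists2 r : seq I, uniq r & (forall i, i \notin r -> f i = 0) /\ x = \sum_(i <- r) f i *: b i.

Lemma coords_wide (r r' : seq I) (f : I -> R) : uniq r -> uniq r' -> {subset r <= r'} ->
  (forall i, i \notin r -> f i = 0) -> \sum_(i <- r) f i *: b i = \sum_(i <- r') f i *: b i.
Proof.
move=> u u' s f0; rewrite [RHS](bigID (mem r)) /= [X in _ + X]big1 ?addr0; last first.
  by move=> i /f0->; rewrite scale0r.
rewrite -[RHS]big_filter; apply: perm_big; apply: uniq_perm; rewrite ?filter_uniq // => i.
by rewrite mem_filter /=; case: (boolP (i \in r)) => // /s.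
Qed.

Lemma coords_lin c x y f g : coords x f -> coords y g ->
  coords (c *: x + y) (fun i => c * f i + g i).
Proof.
case=> r u [f0 ->] [r' u' [g0 ->]]; have ur := undup_uniq (r ++ r').
have sub1 : {subset r <= undup (r ++ r')} by move=> i; rewrite mem_undup mem_cat => ->.
have sub2 : {subset r' <= undup (r ++ r')} by move=> i; rewrite mem_undup mem_cat orbC => ->.
exists (undup (r ++ r')) => //; split=> [i|].
  by rewrite mem_undup mem_cat negb_or => /andP[/f0-> /g0->]; rewrite mulr0 addr0.
rewrite (coords_wide u ur sub1 f0) (coords_wide u' ur sub2 g0) scaler_sumr -big_split /=.
by apply: eq_bigr => i _; rewrite scalerDl scalerA.
Qed.

Lemma coords0 : coords 0 (fun _ => 0).
Proof. by exists [::] => //; split=> //; rewrite big_nil. Qed.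

Lemma coords_basis i : coords (b i) (fun j => (j == i)%:R).
Proof.
exists [:: i] => //; split=> [j|]; first by rewrite inE => /negbTE->.
by rewrite big_seq1 eqxx scale1r.
Qed.

Lemma coords_uniq x f g : lin_indep b -> coords x f -> coords x g -> f = g.
Proof.
move=> ind [r u [f0 e]] [r' u' [g0 e']]; have ur := undup_uniq (r ++ r').
have sub1 : {subset r <= undup (r ++ r')} by move=> i; rewrite mem_undup mem_cat => ->.
have sub2 : {subset r' <= undup (r ++ r')} by move=> i; rewrite mem_undup mem_cat orbC => ->.
have h := ind _ (fun i => f i - g i) ur; apply: funext => i.
case: (boolP (i \in undup (r ++ r'))) => [ir|]; last first.
  by rewrite mem_undup mem_cat negb_or => /andP[/f0-> /g0->].
apply/eqP; rewrite -subr_eq0; apply/eqP/h => //.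
under eq_bigr => j _ do rewrite scalerBl.
by rewrite sumrB -(coords_wide u ur sub1 f0) -(coords_wide u' ur sub2 g0) -e -e' subrr.
Qed.

End Coordinates.

(** * The dyadic rationals *)

Section Dyadic.
Local Open Scope ring_scope.

Definition dyadic : {pred rat} :=
  fun x => `[< exists p : int, exists k : nat, x = p%:~R / 2%:R ^+ k >].

Lemma dyadicP x : reflect (exists p : int, exists k : nat, x = p%:~R / 2%:R ^+ k) (x \in dyadic).
Proof. exact: asboolP. Qed.

Lemma pow2_neq0 k : 2%:R ^+ k != 0 :> rat.
Proof. by rewrite expf_neq0. Qed.

Lemma dyadicB (p q : int) k j :
  p%:~R / 2%:R ^+ k - q%:~R / 2%:R ^+ j =
  (p * 2%:Z ^+ j - q * 2%:Z ^+ k)%:~R / 2%:R ^+ (k + j) :> rat.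
Proof.
rewrite rmorphB !rmorphM !rmorphXn /= exprD; field.
by rewrite !pow2_neq0.
Qed.

Lemma dyadicM (p q : int) k j :
  (p%:~R / 2%:R ^+ k) * (q%:~R / 2%:R ^+ j) = (p * q)%:~R / 2%:R ^+ (k + j) :> rat.
Proof. by rewrite rmorphM /= exprD; field; rewrite !pow2_neq0. Qed.

Lemma dyadic_subring : subring_closed dyadic.
Proof.
split.
- by apply/dyadicP; exists 1, 0%N; rewrite expr0 divr1.
- move=> x y /dyadicP[p [k ->]] /dyadicP[q [j ->]]; apply/dyadicP.
  by rewrite dyadicB; do 2 eexists.
- move=> x y /dyadicP[p [k ->]] /dyadicP[q [j ->]]; apply/dyadicP.
  by rewrite dyadicM; do 2 eexists.
Qed.


Record Dyad := MkDyad { dval : rat; dvalP : dval \in dyadic }.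
HB.instance Definition _ := [isSub for dval].
HB.instance Definition _ := [Choice of Dyad by <:].
HB.instance Definition _ := GRing.SubChoice_isSubComNzRing.Build rat dyadic Dyad dyadic_subring.

Lemma dval_inj : injective (val : Dyad -> rat).
Proof. exact: val_inj. Qed.

Lemma Dyad_half : exists h : Dyad, 2%:R * h = 1.
Proof.
have hP : 2%:R^-1 \in dyadic by apply/dyadicP; exists 1, 1%N; rewrite expr1 mul1r.
by exists (MkDyad hP); apply: val_inj; rewrite rmorphM rmorph_nat /= mulfV.
Qed.

Context (K : comPzRingType) (h : K) (h2 : 2%:R * h = 1).

(** Dyadic rationals act on every ring in which 2 is invertible. *)
Lemma dyad_map_exists : exists phi : Dyad -> K,
  [/\ phi 1 = 1, forall x y, phi (x - y) = phi x - phi y & forall x y, phi (x * y) = phi x * phi y].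
Proof.
have hk k : 2%:R ^+ k * h ^+ k = 1 by rewrite -exprMn h2 expr1n.
have wd (p q : int) k j : p%:~R / 2%:R ^+ k = q%:~R / 2%:R ^+ j :> rat ->
    p%:~R * h ^+ k = q%:~R * h ^+ j.
  move=> /eqP; rewrite eqr_div ?pow2_neq0 // => /eqP e.
  have {}e : p * 2%:Z ^+ j = q * 2%:Z ^+ k.
    by apply: (@intr_inj rat); rewrite !rmorphM !rmorphXn.
  have {}e : p%:~R * 2%:R ^+ j = q%:~R * 2%:R ^+ k :> K.
    by have := congr1 (fun z : int => z%:~R : K) e; rewrite !rmorphM !rmorphXn.
  have -> : p%:~R * h ^+ k = p%:~R * 2%:R ^+ j * (h ^+ k * h ^+ j).
    by transitivity (p%:~R * h ^+ k * (2%:R ^+ j * h ^+ j)); [rewrite hk mulr1 | ring].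
  rewrite e; transitivity (q%:~R * h ^+ j * (2%:R ^+ k * h ^+ k)); [ring|].
  by rewrite hk mulr1.
pose rep (x : Dyad) := cid (elimT (dyadicP (dval x)) (dvalP x)).
pose rep2 (x : Dyad) := cid (projT2 (rep x)).
pose phi x := (projT1 (rep x))%:~R * h ^+ projT1 (rep2 x) : K.
have phiE x (p : int) k : dval x = p%:~R / 2%:R ^+ k -> phi x = p%:~R * h ^+ k.
  by move=> e; apply: wd; apply: etrans e; exact: esym (projT2 (rep2 x)).
have repE x : exists p : int, exists2 k, dval x = p%:~R / 2%:R ^+ k & phi x = p%:~R * h ^+ k.
  by exists (projT1 (rep x)), (projT1 (rep2 x)) => //; exact: (projT2 (rep2 x)).
exists phi; split.
- by rewrite (phiE _ 1 0%N) ?expr0 ?mulr1 // divr1.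
- move=> x y; have [p [k ex ->]] := repE x; have [q [j ey ->]] := repE y.
  rewrite (phiE _ (p * 2%:Z ^+ j - q * 2%:Z ^+ k) (k + j)%N); last first.
    by rewrite -dyadicB -ex -ey.
  rewrite rmorphB !rmorphM !rmorphXn /= exprD.
  transitivity (p%:~R * h ^+ k * (2%:R ^+ j * h ^+ j) - q%:~R * h ^+ j * (2%:R ^+ k * h ^+ k)).
    by ring.
  by rewrite !hk !mulr1.
- move=> x y; have [p [k ex ->]] := repE x; have [q [j ey ->]] := repE y.
  rewrite (phiE _ (p * q) (k + j)%N); last by rewrite -dyadicM -ex -ey.
  by rewrite rmorphM /= exprD; ring.
Qed.

End Dyadic.

(*BEGIN*)
(** * Change of the ground ring *)

Section BaseChange.
Local Open Scope ring_scope.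
Context (K : comPzRingType).

(** Extension by linearity from pictures to terms. *)
Fixpoint expand m s (t : term K m s) : (diag m s -> K) -> K :=
  match t in term _ m s return (diag m s -> K) -> K with
  | tId m => fun lam => lam (dId m)
  | tU => fun lam => lam dU
  | tA => fun lam => lam dA
  | tS => fun lam => lam dS
  | tX => fun lam => lam dX
  | tcomp _ _ _ f g => fun lam => expand f (fun d => expand g (fun d' => lam (dcomp d d')))
  | ttens _ _ _ _ f g => fun lam => expand f (fun d => expand g (fun d' => lam (dtens d d')))
  | t0 _ _ => fun _ => 0
  | tadd _ _ f g => fun lam => expand f lam + expand g lam
  | tscale _ _ c f => fun lam => c * expand f lam
  end.

Lemma expand_lin m s (t : term K m s) c lam mu :
  expand t (fun d => c * lam d + mu d) = c * expand t lam + expand t mu.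
Proof.
elim: t lam mu => //=.
- move=> ? ? ? f hf g hg lam mu; rewrite -hf; congr (expand f); apply: funext => d.
  exact: hg.
- move=> ? ? ? ? f hf g hg lam mu; rewrite -hf; congr (expand f); apply: funext => d.
  exact: hg.
- by move=> _ _ _ _; rewrite mulr0 addr0.
- by move=> ? ? f hf g hg lam mu; rewrite hf hg mulrDr addrACA.
- by move=> ? ? c' f hf lam mu; rewrite hf mulrDr mulrCA.
Qed.

Lemma expandD m s (t : term K m s) lam mu :
  expand t (fun d => lam d + mu d) = expand t lam + expand t mu.
Proof.
rewrite -[in RHS](mul1r (expand t lam)) -expand_lin; congr (expand t).
by apply: funext => d; rewrite mul1r.
Qed.

Lemma expand0 m s (t : term K m s) : expand t (fun _ => 0) = 0.
Proof.
have := expandD t (fun _ => 0) (fun _ => 0).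
rewrite (_ : (fun _ => _) = (fun _ => 0)); last by apply: funext => d; rewrite addr0.
by move=> e; apply: (@addrI _ (expand t (fun _ => 0))); rewrite addr0 -e.
Qed.

Lemma expandZ m s (t : term K m s) c lam : expand t (fun d => c * lam d) = c * expand t lam.
Proof.
have := expand_lin t c lam (fun _ => 0); rewrite expand0 addr0 => <-.
by congr (expand t); apply: funext => d; rewrite addr0.
Qed.

Lemma expandC m s m' s' (f : term K m s) (g : term K m' s') (F : diag m s -> diag m' s' -> K) :
  expand f (fun d => expand g (F d)) = expand g (fun d' => expand f (F^~ d')).
Proof.
elim: f F => //=.
- move=> ? ? ? f hf h hh F; rewrite -(hf (fun d d' => expand h (fun d2 => F (dcomp d d2) d'))).
  congr (expand f); apply: funext => d; exact: (hh (fun d2 d' => F (dcomp d d2) d')).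
- move=> ? ? ? ? f hf h hh F; rewrite -(hf (fun d d' => expand h (fun d2 => F (dtens d d2) d'))).
  congr (expand f); apply: funext => d; exact: (hh (fun d2 d' => F (dtens d d2) d')).
- by move=> ? ? F; rewrite expand0.
- by move=> ? ? f hf h hh F; rewrite hf hh expandD.
- by move=> ? ? c f hf F; rewrite hf expandZ.
Qed.

Lemma expand_term m s (d : diag m s) lam : expand (term_of K d) lam = lam d.
Proof.
elim: d lam => //=.
- move=> ? ? ? g hg h hh lam; rewrite hg; exact: hh.
- move=> ? ? ? ? g hg h hh lam; rewrite hg; exact: hh.
Qed.

Lemma expand_cast m s m' s' (em : m = m') (es : s = s') (t : term K m s) lam :
  expand (cast2 em es t) lam = expand t (fun d => lam (cast2 em es d)).
Proof. by case: m' / em lam; case: s' / es. Qed.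

Lemma term_of_cast (R : comPzRingType) m s m' s' (em : m = m') (es : s = s') (d : diag m s) :
  term_of R (cast2 em es d) = cast2 em es (term_of R d).
Proof. by case: m' / em; case: s' / es. Qed.

Context (L : comPzRingType) (phi : L -> K).
Hypotheses (phi1 : phi 1 = 1) (phiB : forall x y, phi (x - y) = phi x - phi y).
Local Notation H := (hom_of L).

Definition semilin m s (l : ABHom L m s -> K) : Prop :=
  forall c x y, l (c *: x + y) = phi c * l x + l y.

Lemma phiN1 : phi (-1) = -1.
Proof.
have phi0 : phi 0 = 0 by rewrite -(subrr 0) phiB subrr.
by rewrite -[-1]add0r phiB phi0 phi1 add0r.
Qed.

Lemma semilinN m s (l : ABHom L m s -> K) (f : term L m s) : semilin l ->
  l (\pi_(ABHom _ _ _) (tscale (-1) f)) = -1 * l (\pi_(ABHom _ _ _) f).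
Proof.
move=> sl; have l0 : l 0 = 0.
  have := sl 1 0 0; rewrite scaler0 addr0 phi1 mul1r => e.
  by apply: (@addrI _ (l 0)); rewrite addr0 -e.
by rewrite hpi_scale -[_ *: _]addr0 sl phiN1 l0 addr0.
Qed.

Lemma semilinBf m s (l : ABHom L m s -> K) (f g : term L m s) : semilin l ->
  l (\pi_(ABHom _ _ _) (tadd f (tscale (-1) g))) = l (\pi_(ABHom _ _ _) f) + -1 * l (\pi_(ABHom _ _ _) g).
Proof.
move=> sl; rewrite hpi_add -[\pi_(ABHom L m s) f]scale1r sl phi1 mul1r semilinN //.
by rewrite scale1r.
Qed.

Lemma eqv_fun (R : comPzRingType) m s (T : Type) (l : ABHom R m s -> T) (f g : term R m s) : eqv f g ->
  l (\pi_(ABHom _ _ _) f) = l (\pi_(ABHom _ _ _) g).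
Proof. by move=> /Hom_eqP->. Qed.

(** Relations between terms over K hold for the functionals that come from L,
    as they have the coefficients 1 and -1. *)
Lemma expand_sound m s (f g : term K m s) : eqv f g ->
  forall l, semilin l -> expand f (fun d => l (H d)) = expand g (fun d => l (H d)).
Proof.
elim=> {m s f g}.
- by [].
- by move=> m s f g _ h l sl; rewrite h.
- by move=> m s f g k _ h _ h' l sl; rewrite h ?h'.
- move=> m n p f f' g g' _ hf _ hg l sl /=.
  have E f0 g0 : expand f0 (fun d => expand g0 (fun d' => l (H (dcomp d d')))) =
      expand f0 (fun d => expand g0 (fun d' => l (hcomp (H d) (H d')))).
    congr (expand f0); apply: funext => d; congr (expand g0); apply: funext => d'.
    by rewrite /hom_of hcompE.
  rewrite !E; transitivity (expand f (fun d => expand g' (fun d' => l (hcomp (H d) (H d'))))).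
    congr (expand f); apply: funext => d; apply: (hg (fun x => l (hcomp (H d) x))) => c x y.
    by rewrite hcompDZr sl.
  apply: (hf (fun x => expand g' (fun d' => l (hcomp x (H d'))))) => c x y.
  rewrite -expand_lin; congr (expand g'); apply: funext => d'.
  by rewrite hcompDZl sl.
- move=> m s m' s' f f' g g' _ hf _ hg l sl /=.
  have E f0 g0 : expand f0 (fun d => expand g0 (fun d' => l (H (dtens d d')))) =
      expand f0 (fun d => expand g0 (fun d' => l (htens (H d) (H d')))).
    congr (expand f0); apply: funext => d; congr (expand g0); apply: funext => d'.
    by rewrite /hom_of htensE.
  rewrite !E; transitivity (expand f (fun d => expand g' (fun d' => l (htens (H d) (H d'))))).
    congr (expand f); apply: funext => d; apply: (hg (fun x => l (htens (H d) x))) => c x y.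
    by rewrite htensDZr sl.
  apply: (hf (fun x => expand g' (fun d' => l (htens x (H d'))))) => c x y.
  rewrite -expand_lin; congr (expand g'); apply: funext => d'.
  by rewrite htensDZl sl.
- by move=> m s f f' g g' _ hf _ hg l sl /=; rewrite hf ?hg.
- by move=> m s c f f' _ hf l sl /=; rewrite hf.
- by move=> m s f g h l sl /=; rewrite addrA.
- by move=> m s f g l sl /=; rewrite addrC.
- by move=> m s f l sl /=; rewrite add0r.
- by move=> m s f l sl /=; rewrite mulN1r subrr.
- by move=> m s c c' f l sl /=; rewrite mulrA.
- by move=> m s f l sl /=; rewrite mul1r.
- by move=> m s c f g l sl /=; rewrite mulrDr.
- by move=> m s c c' f l sl /=; rewrite mulrDl.
- by [].
- by move=> m n p f g g' l sl /=; rewrite expandD.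
- by [].
- by move=> m n p c f g l sl /=; rewrite expandZ.
- by [].
- by move=> m s m' s' f g g' l sl /=; rewrite expandD.
- by [].
- by move=> m s m' s' c f g l sl /=; rewrite expandZ.
- move=> m n p q f g h l sl /=; congr (expand f); apply: funext => d1.
  congr (expand g); apply: funext => d2; congr (expand h); apply: funext => d3.
  exact/eqv_fun/eqv_compA.
- move=> m s f l sl /=; congr (expand f); apply: funext => d.
  exact/eqv_fun/eqv_idl.
- move=> m s f l sl /=; congr (expand f); apply: funext => d.
  exact/eqv_fun/eqv_idr.
- by move=> m n l sl /=; apply/eqv_fun/eqv_tens_id.
- move=> m n p m' n' p' f g f' g' l sl /=; congr (expand f); apply: funext => d1.
  rewrite (expandC g f'); congr (expand f'); apply: funext => d2.
  congr (expand g); apply: funext => d3; congr (expand g'); apply: funext => d4.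
  exact/eqv_fun/eqv_interchange.
- move=> m1 s1 m2 s2 m3 s3 f g h l sl; rewrite expand_cast /=.
  congr (expand f); apply: funext => d1.
  congr (expand g); apply: funext => d2; congr (expand h); apply: funext => d3.
  by rewrite /hom_of term_of_cast; apply/eqv_fun/eqv_tensA.
- move=> m s f l sl /=; congr (expand f); apply: funext => d.
  exact/eqv_fun/eqv_unitl.
- move=> m s f l sl; rewrite expand_cast /=; congr (expand f); apply: funext => d.
  by rewrite /hom_of term_of_cast; apply/eqv_fun/eqv_unitr.
- by move=> l sl; apply/eqv_fun/rel_SS.
- by move=> l sl; apply/eqv_fun/rel_braid.
- by move=> l sl; apply/eqv_fun/rel_zigzag1.
- by move=> l sl; apply/eqv_fun/rel_zigzag2.
- by move=> l sl; apply/eqv_fun/rel_SU.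
- by move=> l sl; apply/eqv_fun/rel_AS.
- by move=> l sl; apply/eqv_fun/rel_AS_slide.
- by move=> l sl; apply/eqv_fun/rel_SU_slide.
- move=> l sl; rewrite /= /hom_of /= -!semilinBf //; exact/eqv_fun/rel_XS.
- move=> l sl; rewrite /= /hom_of /= -semilinN //; exact/eqv_fun/rel_X_rotate1.
- move=> l sl; rewrite /= /hom_of /= -semilinN //; exact/eqv_fun/rel_X_rotate2.
Qed.

End BaseChange.

(*BEGIN*)
(** * The basis *)

Lemma nd_data m s (D : diag m s) : normally_ordered D ->
  exists t : seq nat * ('I_s -> nat) * diag m s * ('I_m -> nat),
  [/\ dot_free t.1.2, bubble_free t.1.2, forall i, left_of_cup t.1.2 i -> t.1.1.2 i = 0,
      forall j, right_of_cap t.1.2 j || on_vertical t.1.2 j -> t.2 j = 0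
    & D = ndiag t.1.1.1 t.1.1.2 t.1.2 t.2].
Proof. by case=> k a d b df bf ha hb; exists (k, a, d, b). Qed.

Section Basis.
Context (m s : nat).
Local Open Scope ring_scope.

Definition ndhom (R : comPzRingType) (x : NDclass m s) : ABHom R m s := hom_of R (val (repr x)).

Lemma nd_valP (D : ND m s) : normally_ordered (val D).
Proof. exact/asboolP/(valP D). Qed.

Lemma dequiv_hom R (D D' : diag m s) : normally_ordered D -> normally_ordered D' ->
  dequiv D D' -> hom_of R D = hom_of R D'.
Proof.
case/nd_data=> [[[[k a] d] b]] /= [df bf ha hb ->].
case/nd_data=> [[[[k' a'] d'] b']] /= [df' bf' ha' hb' ->].
move/(dequiv_ndiag k k' df bf df' bf' ha hb ha' hb') => [ss ea eb pk].
exact: hom_of_ndiag.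
Qed.

Lemma ndhom_pi R (D : ND m s) : ndhom R (\pi_(NDclass m s) D) = hom_of R (val D).
Proof.
apply: dequiv_hom; try exact: nd_valP.
have : \pi_(NDclass m s) (repr (\pi_(NDclass m s) D)) = \pi_(NDclass m s) D by rewrite reprK.
by move/eqmodP.
Qed.

Lemma ndhom_coords (R : comPzRingType) (half : exists h : R, 2%:R * h = 1) (x : ABHom R m s) :
  exists f, coords (ndhom R) x f.
Proof.
elim: (nd_spans half x) => [|c y z l [D nD DE] v e _ [g hg]]; first by exists (fun _ => 0); apply: coords0.
have DN : `[< normally_ordered D >] by apply/asboolP.
have -> : y = ndhom R (\pi_(NDclass m s) (Sub D DN : ND m s)).
  by rewrite ndhom_pi; apply: Mor_inj; rewrite e run_layers DE.
by eexists; apply: coords_lin hg; apply: coords_basis.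
Qed.

Lemma ndhom_indep_rat (R : comPzRingType) (iota : {rmorphism R -> rat}) : injective iota ->
  lin_indep (ndhom R).
Proof.
move=> ii; have [F hF] := choice (fun x : NDclass m s => nd_data (nd_valP (repr x))).
move=> r c ur e; apply: (@nd_indep R iota ii m s _ (fun x => (F x).1.1.1) (fun x => (F x).1.1.2)
  (fun x => (F x).1.2) (fun x => (F x).2) _ _ _ _ _ r c ur).
- by move=> x; case: (hF x).
- by move=> x; case: (hF x).
- by move=> x; case: (hF x).
- by move=> x; case: (hF x).
- move=> x x' ss ea eb pk; rewrite -[x]reprK -[x']reprK; apply/eqmodP.
  case: (hF x) => df bf ha hb E; case: (hF x') => df' bf' ha' hb' E'.
  rewrite /= /nd_equiv E E'; exact/(dequiv_ndiag _ _ df bf df' bf' ha hb ha' hb').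
- rewrite -[RHS]e; apply: eq_bigr => x _; congr (_ *: _).
  by rewrite /ndhom; case: (hF x) => _ _ _ _ <-.
Qed.

(** The coordinates over the dyadic rationals define functionals over every ring
    in which 2 is invertible. *)
Lemma ndhom_indep (K : comPzRingType) (half : exists h : K, 2%:R * h = 1) :
  lin_indep (ndhom K).
Proof.
have indL : lin_indep (ndhom Dyad) by apply: (@ndhom_indep_rat Dyad val); apply: val_inj.
have [h h2] := half; have [phi [phi1 phiB phiM]] := dyad_map_exists h2.
have [F hF] := choice (ndhom_coords Dyad_half).
have phi0 : phi 0 = 0 by rewrite -(subrr 0) phiB subrr.
have phiD x y : phi (x + y) = phi x + phi y.
  by rewrite -[y in LHS]opprK phiB -[- y]add0r phiB phi0 sub0r opprK.
move=> r c ur e i0 i0r.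
pose l (x : ABHom Dyad m s) : K := phi (F x i0).
have sl : semilin phi l.
  move=> z x y; rewrite /l (coords_uniq indL (hF _) (coords_lin z (hF x) (hF y))).
  by rewrite phiD phiM.
pose lam (d : diag m s) : K := l (hom_of Dyad d).
have lamE f : expand (repr (\pi_(ABHom K m s) f)) lam = expand f lam.
  exact: (expand_sound phi1 phiB (repr_eqv f) sl).
have basisE i : lam (val (repr i)) = (i0 == i)%:R.
  rewrite /lam /l -/(ndhom Dyad i) (coords_uniq indL (hF _) (coords_basis (ndhom Dyad) i)).
  by case: eqP.
have : expand (repr (\sum_(i <- r) c i *: ndhom K i)) lam = \sum_(i <- r) c i * (i0 == i)%:R.
  elim: r {ur e i0r} => [|i r IH]; first by rewrite !big_nil -hpi_zero lamE.
  rewrite !big_cons -IH; set S := \sum_(j <- r) _.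
  have -> : c i *: ndhom K i + S = \pi_(ABHom K m s)
      (tadd (tscale (c i) (term_of K (val (repr i)))) (repr S)).
    by rewrite hpi_add hpi_scale reprK.
  by rewrite lamE /= expand_term basisE.
rewrite e -hpi_zero lamE /= (bigD1_seq i0) //= eqxx mulr1 big1 ?addr0 // => i ii.
by rewrite eq_sym (negbTE ii) mulr0.
Qed.

End Basis.

Local Open Scope ring_scope.

Theorem theoremB (K : comPzRingType) (two_unit : exists h : K, 2%:R * h = 1)
    (m s : nat) :
  exists b : NDclass m s -> ABHom K m s,
    (forall d : ND m s, b (\pi_(NDclass m s) d) = hom_of K (val d)) /\
    is_basis b.
Proof.
exists (@ndhom m s K); split; first exact: ndhom_pi.
split; first exact: ndhom_indep.
move=> x; have [f [r _ [_ ->]]] := ndhom_coords two_unit x.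
by exists r, f.
Qed.
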